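(* Let $a,b\in\mathbb{C}$ with $\Re(a)>0$, let $c,c'\in\mathbb{C}\setminus\mathbb{Z}_{\leqslant 0}$, and fix $\delta\in(0,\frac{\pi}{2}]$. Then for each fixed $y>0$ and for each choice of the sign $\pm$ (the same on both sides), $$\Psi_1\left[a,b;c,c';\pm x,\frac{y}{x}\right]\sim\frac{\Gamma(c')}{\Gamma(a)}\,{}_1F_1\left[\begin{matrix}b\\c\end{matrix};\pm y\right]\left(\frac{y}{x}\right)^{a-c'}\mathrm{e}^{y/x}$$ as $x\to0$ in the sector $|\arg(x)|\leqslant\frac{\pi}{2}-\delta$.
   Context: The Humbert function $\Psi_1$ is defined for $a,b\in\mathbb{C}$, $c,c'\in\mathbb{C}\setminus\mathbb{Z}_{\leqslant 0}$, $|x|<1$, $y\in\mathbb{C}$ by $$\Psi_1[a,b;c,c';x,y]=\sum_{m,n=0}^{\infty}\frac{(a)_{m+n}(b)_m}{(c)_m(c')_n}\frac{x^m}{m!}\frac{y^n}{n!},$$ where $(a)_n=a(a+1)\cdots(a+n-1)$, $(a)_0=1$, and ${}_1F_1\left[\begin{matrix}b\\c\end{matrix};z\right]=\sum_{n\geqslant0}\frac{(b)_n}{(c)_n}\frac{z^n}{n!}$. Complex powers have their principal values. The symbol $\sim$ is leading-term asymptotics: $f(x)\sim C\varphi(x)$, with $C$ independent of $x$, means $f(x)=(C+o(1))\,\varphi(x)$; here $C=\frac{\Gamma(c')}{\Gamma(a)}\,{}_1F_1\left[\begin{matrix}b\\c\end{matrix};\pm y\right]$ and $\varphi(x)=(y/x)^{a-c'}\mathrm{e}^{y/x}$.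 *)

(* Defs.v *)
From Stdlib Require Import Reals Factorial.
From Coquelicot Require Import Coquelicot.

Open Scope C_scope.

Definition CLim_seq (u : nat -> C) : C :=
  (real (Lim_seq (fun n => Re (u n))), real (Lim_seq (fun n => Im (u n)))).

Definition CSeries (u : nat -> C) : C :=
  (Series (fun n => Re (u n)), Series (fun n => Im (u n))).

(* Sum over [m, n >= 0], as an iterated sum; it is applied below only to an
   absolutely convergent double series, where the order is irrelevant. *)
Definition CSeries2 (u : nat -> nat -> C) : C :=
  CSeries (fun m => CSeries (fun n => u m n)).

Definition Cexp (z : C) : C :=
  ((exp (Re z) * cos (Im z))%R, (exp (Re z) * sin (Im z))%R).

(* Principal argument, in (-PI, PI]; the value at 0 is irrelevant. *)
Definition Carg (z : C) : R :=
  if Rle_dec 0 (Im z) then acos (Re z / Cmod z)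
  else (- acos (Re z / Cmod z))%R.

Definition Cln (z : C) : C := (ln (Cmod z), Carg z).

(* Principal value of [z ^ w], for [z <> 0]. *)
Definition Cpower (z w : C) : C := Cexp (w * Cln z).

Definition factC (n : nat) : C := RtoC (INR (fact n)).

Fixpoint poch (a : C) (n : nat) : C :=
  match n with
  | O => 1
  | S k => poch a k * (a + RtoC (INR k))
  end.

Definition nonpos_int (z : C) : Prop := exists k : nat, z = - RtoC (INR k).

(* Euler's limit n! n^z / (z (z+1) ... (z+n)), which converges to the Gamma
   function at every [z] that is not a nonpositive integer. *)
Definition CGamma (z : C) : C :=
  CLim_seq (fun n => factC n * Cpower (RtoC (INR n)) z / poch z (S n)).

Definition hyp1F1 (b c z : C) : C :=
  CSeries (fun n => poch b n / poch c n * (z ^ n / factC n)).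

(* The Humbert function, for [Cmod x < 1]. *)
Definition Psi1 (a b c c' x y : C) : C :=
  CSeries2 (fun m n =>
    poch a (m + n) * poch b m / (poch c m * poch c' n)
    * (x ^ m / factC m) * (y ^ n / factC n)).

(* [x -> 0] with [x <> 0] and |arg x| <= theta. *)
Definition sector0 (theta : R) : (C -> Prop) -> Prop :=
  within (fun x : C => (Rabs (Carg x) <= theta)%R) (locally' (RtoC 0)).

(* f(x) = (K + o(1)) phi(x) along the filter [F]; [K] may vanish. *)
Definition asymp (F : (C -> Prop) -> Prop) (f : C -> C) (K : C) (phi : C -> C)
  : Prop :=
  exists r : C -> C,
    filterlim r F (locally (RtoC 0)) /\
    F (fun x => f x = (K + r x) * phi x).

(* Main.v *)
Require Import Defs.
From Stdlib Require Import Reals Factorial Lra Lia.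
From Coquelicot Require Import Coquelicot.

Open Scope C_scope.

(** Put [z = y / x], so that [z] tends to infinity in a sector
    [e |z| <= Re z] with [e > 0].  Summing over [n] first, the [m]-th term of
    the Humbert series is the [m]-th term of [1F1 (b; c; s y)] times
    [z ^ (- m) F_m (z)], where [F_m (z)] is the sum over [n] of
    [(a)_(m+n) / (c')_n z ^ n / n!].  As [F_m = (a)_m 1F1 (a + m; c'; z)], it
    behaves like [Gamma c' / Gamma a * z ^ (a + m - c') exp z]: after division by
    [z ^ (a - c') exp z] every weight [z ^ (- m) F_m (z)] has the same limit
    [Gamma c' / Gamma a], and the theorem follows by exchanging limit and sum
    ([tannery], [Psi1_asymp]).

    The exchange needs one bound that covers the weights for all [m].  Let
    [F_(m,j)] be the [j]-th derivative of [F_m].  From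
    [F_(m+1,j) = (a + m + j) F_(m,j) + z F_(m,j+1)] both the limit and a bound
    for all [m] follow from the case [m = 0] ([normalized_confluent_lim],
    [normalized_confluent_growth]); the bound is of order [(D + O(m) / R) ^ m] for
    [|z| >= R], which the [1 / m!] of the series turns into geometric decay once
    [R] is large.  The case [m = 0] concerns the derivatives of
    [1F1 (a; c'; z)] only, with a bound [K D ^ j] valid for all [j]
    ([confluent_asymp]).  The identity [1 / (c)_k = (c + k) / (c (c + 1)_k)]
    carries it from [c + 1] down to [c] ([confluent_asymp_step]), so that
    [Re (c - a)] may be assumed large.

    In that case, with [b = c - a], the [j]-th derivative of [1F1 (a; c; z)] is,
    up to a constant factor, the integral of [t ^ j exp (z t)] against
    [t ^ (a - 1) (1 - t) ^ (b - 1)] over [[0, 1]] ([beta_int_exp]).  Absolute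
    values give the uniform bound, and replacing [t ^ j] by [1] costs O(1/|z|).
    It remains to find the limit of
    [W (z) = z ^ b * integral of exp (- z (1 - t)) t ^ (a - 1) (1 - t) ^ (b - 1)].
    Integration by parts shows [W' (z) = O(1/|z|^2)] in the sector, so [W (z)]
    differs by O(1/n) from [W (n)], [n] being the integer part of [Re z]
    ([scaled_laplace_segment]); this takes the place of a rotation of the
    contour.  At an integer, [exp (- n (1 - t))] may be replaced by [t ^ (n + 1)]
    ([scaled_laplace_nat]), and the moments of the Beta density are quotients of
    Pochhammer symbols, whose asymptotics are Euler's limit formula for the Gamma
    function ([poch_ratio_lim]). *)

(** * Complex numbers *)

Lemma C_eq (x y : C) : Re x = Re y -> Im x = Im y -> x = y.
Proof. destruct x, y; unfold Re, Im; simpl; congruence. Qed.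

Lemma RtoC_neq_0 (x : R) : x <> 0%R -> RtoC x <> 0.
Proof. intros H E. now apply H, RtoC_inj. Qed.

Lemma Cmod_le_parts (z : C) : (Cmod z <= Rabs (Re z) + Rabs (Im z))%R.
Proof.
  replace z with (RtoC (Re z) + RtoC (Im z) * Ci).
  - eapply Rle_trans; [apply Cmod_triangle|].
    rewrite Cmod_mult, Cmod_Ci, !Cmod_R. simpl. unfold Re, Im; simpl.
    apply Req_le. f_equal; try (f_equal; ring). rewrite Rmult_1_r; f_equal; ring.
  - apply C_eq; unfold Re, Im; simpl; ring.
Qed.

Lemma im_le_Cmod (z : C) : (Rabs (Im z) <= Cmod z)%R.
Proof. eapply Rle_trans; [apply Rmax_r|apply Rmax_Cmod]. Qed.

Lemma Cminus_0_r (x : C) : x - 0 = x.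
Proof. ring. Qed.

Lemma Cmod_sub_sym (x y : C) : Cmod (x - y) = Cmod (y - x).
Proof. rewrite <- Cmod_opp; f_equal; ring. Qed.

Lemma Cmod_triangle_sub (x y z : C) :
  (Cmod (x - z) <= Cmod (x - y) + Cmod (y - z))%R.
Proof. replace (x - z) with ((x - y) + (y - z)) by ring. apply Cmod_triangle. Qed.

Lemma Cmod_minus (x y : C) : (Cmod (x - y) <= Cmod x + Cmod y)%R.
Proof. unfold Cminus. rewrite <- (Cmod_opp y). apply Cmod_triangle. Qed.

Lemma Cmod_minus_ge (x y : C) : (Cmod x - Cmod y <= Cmod (x - y))%R.
Proof.
  pose proof (Cmod_triangle (x - y) y) as H.
  replace (x - y + y) with x in H by ring. lra.
Qed.

Lemma re_minus (x y : C) : Re (x - y) = (Re x - Re y)%R.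
Proof. reflexivity. Qed.

Lemma im_minus (x y : C) : Im (x - y) = (Im x - Im y)%R.
Proof. reflexivity. Qed.

(** * Limits of complex functions along a filter *)

(** Stated for an arbitrary filter because sequences and sectors both occur. *)
Definition Clim {T : Type} (F : (T -> Prop) -> Prop) (f : T -> C) (l : C) : Prop :=
  forall eps : R, (0 < eps)%R -> F (fun x => (Cmod (f x - l) <= eps)%R).

Lemma Clim_const {T} (F : (T -> Prop) -> Prop) {FF : Filter F} (l : C) :
  Clim F (fun _ => l) l.
Proof.
  intros eps He. apply filter_forall. intros _.
  replace (l - l) with (RtoC 0) by ring. rewrite Cmod_0; lra.
Qed.

Lemma Clim_ext_loc {T} (F : (T -> Prop) -> Prop) {FF : Filter F} f g l :
  F (fun x => f x = g x) -> Clim F f l -> Clim F g l.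
Proof.
  intros H Hf eps He. generalize (filter_and _ _ H (Hf eps He)).
  apply filter_imp. intros x [-> Hx]; exact Hx.
Qed.

Lemma Clim_plus {T} (F : (T -> Prop) -> Prop) {FF : Filter F} f g l m :
  Clim F f l -> Clim F g m -> Clim F (fun x => f x + g x) (l + m).
Proof.
  intros Hf Hg eps He.
  assert (He2 : (0 < eps / 2)%R) by lra.
  generalize (filter_and _ _ (Hf _ He2) (Hg _ He2)).
  apply filter_imp; intros x [H1 H2].
  replace (f x + g x - (l + m)) with ((f x - l) + (g x - m)) by ring.
  eapply Rle_trans; [apply Cmod_triangle|]. lra.
Qed.

Lemma Clim_mult {T} (F : (T -> Prop) -> Prop) {FF : Filter F} f g l m :
  Clim F f l -> Clim F g m -> Clim F (fun x => f x * g x) (l * m).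
Proof.
  intros Hf Hg eps He.
  set (A := (Cmod l + Cmod m + 1)%R).
  pose proof (Cmod_ge_0 l) as Hl. pose proof (Cmod_ge_0 m) as Hm.
  assert (HA : (1 <= A)%R) by (unfold A; lra).
  set (d := Rmin 1 (eps / (2 * A))).
  assert (Hd1 : (d <= 1)%R) by apply Rmin_l.
  assert (Hd2 : (d <= eps / (2 * A))%R) by apply Rmin_r.
  assert (Hd : (0 < d)%R).
  { apply Rmin_pos; [lra|]. apply Rdiv_lt_0_compat; lra. }
  assert (Hd3 : (d * (2 * A) <= eps)%R).
  { apply Rle_trans with (eps / (2 * A) * (2 * A))%R.
    - apply Rmult_le_compat_r; lra.
    - apply Req_le; field; lra. }
  generalize (filter_and _ _ (Hf _ Hd) (Hg _ Hd)).
  apply filter_imp; intros x [H1 H2].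
  replace (f x * g x - l * m) with ((f x - l) * (g x - m) + (f x - l) * m + l * (g x - m)) by ring.
  eapply Rle_trans; [apply Cmod_triangle|].
  eapply Rle_trans; [apply Rplus_le_compat_r; apply Cmod_triangle|].
  rewrite !Cmod_mult.
  pose proof (Cmod_ge_0 (f x - l)). pose proof (Cmod_ge_0 (g x - m)).
  assert ((Cmod (f x - l) * Cmod (g x - m) <= d * 1)%R).
  { apply Rmult_le_compat; lra. }
  assert ((Cmod (f x - l) * Cmod m <= d * Cmod m)%R).
  { apply Rmult_le_compat; lra. }
  assert ((Cmod l * Cmod (g x - m) <= Cmod l * d)%R).
  { apply Rmult_le_compat; lra. }
  assert (0 <= d * A)%R by (apply Rmult_le_pos; lra).
  assert (d * 1 + d * Cmod m + Cmod l * d = d * A)%R by (unfold A; ring).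
  lra.
Qed.

Lemma Clim_unique {T} (F : (T -> Prop) -> Prop) {FF : ProperFilter F} f l m :
  Clim F f l -> Clim F f m -> l = m.
Proof.
  intros Hl Hm.
  assert (H : forall eps, (0 < eps)%R -> (Cmod (l - m) <= 2 * eps)%R).
  { intros eps He.
    destruct (filter_ex _ (filter_and _ _ (Hl _ He) (Hm _ He))) as [x [H1 H2]].
    eapply Rle_trans; [apply (Cmod_triangle_sub l (f x) m)|].
    rewrite (Cmod_sub_sym l). lra. }
  assert (Hz : Cmod (l - m) = 0%R).
  { destruct (Cmod_ge_0 (l - m)) as [Hp|Hp]; [|easy].
    specialize (H (Cmod (l - m) / 4)%R). lra. }
  apply Cmod_eq_0 in Hz. replace l with (l - m + m) by ring. rewrite Hz; ring.
Qed.

Lemma Clim_eventually_intro (u : nat -> C) (l : C) (K : R) :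
  (forall n : nat, (1 <= n)%nat -> (Cmod (u n - l) <= K / INR n)%R) ->
  Clim eventually u l.
Proof.
  intros H eps He.
  destruct (nfloor_ex (Rabs K / eps)) as [N [_ HN]].
  { apply Rdiv_le_0_compat; [apply Rabs_pos|lra]. }
  exists (S N). intros n Hn.
  eapply Rle_trans; [apply H; lia|].
  assert (HnN : (INR N + 1 <= INR n)%R) by (rewrite <- S_INR; apply le_INR; lia).
  pose proof (pos_INR N). pose proof (Rle_abs K).
  apply Rmult_le_reg_r with (INR n); [lra|].
  unfold Rdiv; rewrite Rmult_assoc, Rinv_l, Rmult_1_r by lra.
  assert (Hk : (Rabs K = Rabs K / eps * eps)%R) by (field; lra).
  nra.
Qed.

Lemma Clim_eventually_ext (u v : nat -> C) l :
  (forall n, (1 <= n)%nat -> u n = v n) -> Clim eventually u l -> Clim eventually v l.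
Proof.
  intros H. apply Clim_ext_loc; [apply eventually_filter|]. exists 1%nat. exact H.
Qed.

Lemma Clim_squeeze (u : nat -> C) l (v : nat -> R) :
  (forall n, (Cmod (u n - l) <= v n)%R) -> is_lim_seq v 0%R -> Clim eventually u l.
Proof.
  intros H Hv eps He. apply is_lim_seq_spec in Hv.
  destruct (Hv (mkposreal eps He)) as [N HN]. exists N. intros n Hn.
  specialize (HN n Hn). simpl in HN. rewrite Rminus_0_r in HN.
  eapply Rle_trans; [apply H|]. pose proof (Rle_abs (v n)). lra.
Qed.

Lemma Clim_components (u : nat -> C) (l : C) :
  Clim eventually u l ->
  is_lim_seq (fun n => Re (u n)) (Re l) /\ is_lim_seq (fun n => Im (u n)) (Im l).
Proof.
  intros H; split; apply is_lim_seq_spec; intros eps.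
  - assert (He : (0 < pos eps / 2)%R) by (pose proof (cond_pos eps); lra).
    destruct (H _ He) as [N HN].
    exists N; intros n Hn. specialize (HN n Hn). cbv beta in HN.
    pose proof (re_le_Cmod (u n - l)) as H1.
    rewrite re_minus in H1.
    pose proof (cond_pos eps). lra.
  - assert (He : (0 < pos eps / 2)%R) by (pose proof (cond_pos eps); lra).
    destruct (H _ He) as [N HN].
    exists N; intros n Hn. specialize (HN n Hn). cbv beta in HN.
    pose proof (im_le_Cmod (u n - l)) as H1.
    rewrite im_minus in H1.
    pose proof (cond_pos eps). lra.
Qed.

Lemma Clim_of_components (u : nat -> C) (l : C) :
  is_lim_seq (fun n => Re (u n)) (Re l) -> is_lim_seq (fun n => Im (u n)) (Im l) ->
  Clim eventually u l.
Proof.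
  intros H1 H2 eps He.
  apply is_lim_seq_spec in H1; apply is_lim_seq_spec in H2.
  assert (He2 : (0 < eps / 2)%R) by lra.
  destruct (H1 (mkposreal _ He2)) as [N1 HN1]. destruct (H2 (mkposreal _ He2)) as [N2 HN2].
  exists (max N1 N2). intros n Hn.
  specialize (HN1 n ltac:(lia)); specialize (HN2 n ltac:(lia)); simpl in *.
  eapply Rle_trans; [apply Cmod_le_parts|].
  rewrite re_minus, im_minus.
  lra.
Qed.

Lemma CLim_seq_unique (u : nat -> C) (l : C) : Clim eventually u l -> CLim_seq u = l.
Proof.
  intros H; apply Clim_components in H; destruct H as [H1 H2].
  apply C_eq; unfold CLim_seq, Re at 1, Im at 1; cbn [fst snd].
  - now rewrite (is_lim_seq_unique _ _ H1).
  - now rewrite (is_lim_seq_unique _ _ H2).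
Qed.

(** * Complex series *)

Definition is_Cseries (u : nat -> C) (l : C) : Prop :=
  is_series (fun n => Re (u n)) (Re l) /\ is_series (fun n => Im (u n)) (Im l).

Lemma CSeries_unique u l : is_Cseries u l -> CSeries u = l.
Proof.
  intros [H1 H2]. apply C_eq; unfold CSeries, Re at 1, Im at 1; cbn [fst snd];
  now apply is_series_unique.
Qed.

Lemma CSeries_ext u v : (forall n, u n = v n) -> CSeries u = CSeries v.
Proof. intros H. unfold CSeries. f_equal; apply Series_ext; intros n; now rewrite H. Qed.

Lemma is_Cseries_ext u v l : (forall n, u n = v n) -> is_Cseries u l -> is_Cseries v l.
Proof.
  intros H [H1 H2]; split.
  - apply is_series_ext with (2 := H1). intros n; now rewrite H.
  - apply is_series_ext with (2 := H2). intros n; now rewrite H.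
Qed.

Lemma is_Cseries_plus u v l m : is_Cseries u l -> is_Cseries v m -> is_Cseries (fun n => u n + v n) (l + m).
Proof.
  intros [H1 H2] [H3 H4]; split.
  - exact (is_series_plus _ _ _ _ H1 H3).
  - exact (is_series_plus _ _ _ _ H2 H4).
Qed.

Lemma is_Cseries_scal k u l : is_Cseries u l -> is_Cseries (fun n => k * u n) (k * l).
Proof.
  intros [H1 H2]; split.
  - exact (is_series_minus _ _ _ _ (is_series_scal (Re k) _ _ H1) (is_series_scal (Im k) _ _ H2)).
  - exact (is_series_plus _ _ _ _ (is_series_scal (Re k) _ _ H2) (is_series_scal (Im k) _ _ H1)).
Qed.

Lemma is_Cseries_shift (u : nat -> C) (l : C) : u 0%nat = 0 -> is_Cseries (fun n => u (S n)) l -> is_Cseries u l.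
Proof.
  intros H0 [H1 H2]; split.
  - apply is_series_decr_1. rewrite H0.
    match goal with |- is_series _ ?x => replace x with (Re l) end; [exact H1|].
    unfold plus, opp; simpl; ring.
  - apply is_series_decr_1. rewrite H0.
    match goal with |- is_series _ ?x => replace x with (Im l) end; [exact H2|].
    unfold plus, opp; simpl; ring.
Qed.

Lemma is_Cseries_dom u v : (forall n, (Cmod (u n) <= v n)%R) -> ex_series v -> is_Cseries u (CSeries u).
Proof.
  intros H Hv; split; apply Series_correct.
  - apply (ex_series_le (fun n => Re (u n)) v); [|exact Hv].
    intros n. eapply Rle_trans; [apply re_le_Cmod|apply H].
  - apply (ex_series_le (fun n => Im (u n)) v); [|exact Hv].
    intros n. eapply Rle_trans; [apply im_le_Cmod|apply H].
Qed.

Lemma Cconj_mod2 (l : C) : Re (Cconj l * l) = (Cmod l * Cmod l)%R.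
Proof.
  replace (Cmod l * Cmod l)%R with (Cmod l ^ 2)%R by ring.
  rewrite Cmod2_alt. unfold Re, Im, Cconj; simpl; ring.
Qed.

(** Multiplying the series by the conjugate of its sum makes the sum real, and
    real parts are then compared without losing a constant. *)
Lemma is_Cseries_le u l v s :
  is_Cseries u l -> (forall n, (Cmod (u n) <= v n)%R) -> is_series v s -> (Cmod l <= s)%R.
Proof.
  intros Hu Hv Hs.
  pose proof (proj1 (is_Cseries_scal (Cconj l) _ _ Hu)) as H.
  rewrite Cconj_mod2 in H.
  assert (Hle : (Cmod l * Cmod l <= Cmod l * s)%R).
  { rewrite <- (is_series_unique _ _ H).
    rewrite <- (is_series_unique _ _ Hs), <- Series_scal_l.
    eapply Rle_trans; [apply Rle_abs|].
    assert (Hb : forall n, (Rabs (Re (Cconj l * u n)) <= Cmod l * v n)%R).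
    { intros n. eapply Rle_trans; [apply re_le_Cmod|].
      rewrite Cmod_mult, Cmod_conj. apply Rmult_le_compat_l; [apply Cmod_ge_0|apply Hv]. }
    assert (Hex : ex_series (fun n => (Cmod l * v n)%R)).
    { apply (ex_series_scal (Cmod l) v). now exists s. }
    eapply Rle_trans; [apply Series_Rabs|].
    - apply (ex_series_le (fun n => Rabs (Re (Cconj l * u n))) (fun n => (Cmod l * v n)%R)); [|exact Hex].
      intros n. unfold norm; simpl; unfold abs; simpl. rewrite Rabs_Rabsolu. apply Hb.
    - apply Series_le; [|exact Hex]. intros n; split; [apply Rabs_pos|apply Hb]. }
  destruct (Cmod_ge_0 l) as [Hp|Hp]; [nra|].
  rewrite <- Hp.
  rewrite <- (is_series_unique _ _ Hs).
  assert (H0 : Series (fun n => (0 * v n)%R) = 0%R) by (rewrite Series_scal_l; ring).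
  rewrite <- H0.
  apply Series_le; [|now exists s].
  intros n; rewrite Rmult_0_l; split; [lra|].
  eapply Rle_trans; [apply Cmod_ge_0|apply Hv].
Qed.

Lemma is_series_half (K : R) : is_series (fun n => (K * (/ 2) ^ n)%R) (K * 2)%R.
Proof.
  replace (K * 2)%R with (K * / (1 - / 2))%R by lra.
  apply (is_series_scal (V := R_NormedModule) K (fun n => ((/ 2) ^ n)%R)).
  apply is_series_geom. rewrite Rabs_right; lra.
Qed.

Lemma filter_forall_lt {T} (F : (T -> Prop) -> Prop) {FF : Filter F} (P : nat -> T -> Prop) (N : nat) :
  (forall n, F (P n)) -> F (fun x => forall n, (n < N)%nat -> P n x).
Proof.
  intros H. induction N as [|N IH].
  - apply filter_forall. intros x n Hn; lia.
  - generalize (filter_and _ _ IH (H N)). apply filter_imp.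
    intros x [H1 H2] n Hn.
    destruct (Nat.eq_dec n N) as [->|]; [exact H2|apply H1; lia].
Qed.

(** Tannery's theorem.  The gap between the ratios 1/4 and 1/2 turns the
    smallness of the tail of the majorant into a factor in front of a fixed
    geometric series, so head and tail are estimated by the same majorant. *)
Lemma tannery {T} (F : (T -> Prop) -> Prop) {FF : Filter F} (d : nat -> T -> C) (M : R) :
  F (fun x => forall n, (Cmod (d n x) <= M * (/ 4) ^ n)%R) ->
  (forall n, Clim F (d n) 0) ->
  Clim F (fun x => CSeries (fun n => d n x)) 0.
Proof.
  intros HM Hd eps He.
  set (eta := (eps / 2)%R).
  assert (Heta : (0 < eta)%R) by (unfold eta; lra).
  assert (HN : exists N, forall n, (N <= n)%nat -> (Rabs M * (/ 4) ^ n <= eta * (/ 2) ^ n)%R).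
  { assert (Hk : (0 < eta / (Rabs M + 1))%R).
    { apply Rdiv_lt_0_compat; [lra|]. pose proof (Rabs_pos M); lra. }
    destruct (pow_lt_1_zero (/ 2)) with (y := (eta / (Rabs M + 1))%R) as [N HN].
    - rewrite Rabs_right; lra.
    - exact Hk.
    - exists N. intros n Hn. specialize (HN n Hn).
      replace (/ 4)%R with (/ 2 * / 2)%R by lra. rewrite Rpow_mult_distr.
      assert (Hp : (0 < (/ 2) ^ n)%R) by (apply pow_lt; lra).
      rewrite Rabs_right in HN by lra.
      rewrite <- Rmult_assoc. apply Rmult_le_compat_r; [lra|].
      pose proof (Rabs_pos M).
      apply Rle_trans with (Rabs M * (eta / (Rabs M + 1)))%R.
      + apply Rmult_le_compat_l; lra.
      + apply Rmult_le_reg_r with (Rabs M + 1)%R; [lra|].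
        replace (Rabs M * (eta / (Rabs M + 1)) * (Rabs M + 1))%R with (Rabs M * eta)%R by (field; lra).
        nra. }
  destruct HN as [N HN].
  assert (Hhead : F (fun x => forall n, (n < N)%nat -> (Cmod (d n x) <= eta * (/ 2) ^ n)%R)).
  { apply filter_forall_lt; [exact FF|]. intros n.
    assert (Hp : (0 < eta * (/ 2) ^ n)%R) by (apply Rmult_lt_0_compat; [lra|apply pow_lt; lra]).
    generalize (Hd n _ Hp). apply filter_imp. intros x Hx.
    replace (d n x) with (d n x - 0) by ring. exact Hx. }
  generalize (filter_and _ _ HM Hhead). apply filter_imp.
  intros x [H1 H2].
  assert (Hall : forall n, (Cmod (d n x) <= eta * (/ 2) ^ n)%R).
  { intros n. destruct (Nat.lt_ge_cases n N) as [Hn|Hn]; [now apply H2|].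
    eapply Rle_trans; [apply H1|]. eapply Rle_trans; [|apply HN, Hn].
    apply Rmult_le_compat_r; [apply pow_le; lra|apply Rle_abs]. }
  replace (CSeries (fun n => d n x) - 0) with (CSeries (fun n => d n x)) by ring.
  replace eps with (eta * 2)%R by (unfold eta; field).
  apply (is_Cseries_le (fun n => d n x) _ _ _) with (2 := Hall).
  - apply is_Cseries_dom with (1 := Hall). eexists; apply is_series_half.
  - apply is_series_half.
Qed.


(** * Derivatives of complex functions of a real variable *)

Definition is_Cderive (f : R -> C) (s : R) (l : C) : Prop :=
  is_derive (fun t => Re (f t)) s (Re l) /\ is_derive (fun t => Im (f t)) s (Im l).

Lemma Cderive_eq f s l l' : is_Cderive f s l -> l = l' -> is_Cderive f s l'.
Proof. now intros H <-. Qed.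

Lemma Cderive_ext_loc f g s l : locally s (fun t => f t = g t) -> is_Cderive f s l -> is_Cderive g s l.
Proof.
  intros H [H1 H2]; split.
  - apply is_derive_ext_loc with (2 := H1). revert H; apply filter_imp. now intros t ->.
  - apply is_derive_ext_loc with (2 := H2). revert H; apply filter_imp. now intros t ->.
Qed.

Lemma Cderive_ext f g s l : (forall t, f t = g t) -> is_Cderive f s l -> is_Cderive g s l.
Proof. intros H. apply Cderive_ext_loc. now apply filter_forall. Qed.

Lemma Cderive_const k s : is_Cderive (fun _ => k) s 0.
Proof.
  split.
  - exact (is_derive_const (V := R_NormedModule) (Re k) s).
  - exact (is_derive_const (V := R_NormedModule) (Im k) s).
Qed.

Lemma Cderive_real f s l : is_derive f s l -> is_Cderive (fun t => RtoC (f t)) s (RtoC l).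
Proof. intros H; split; [exact H|exact (is_derive_const (V := R_NormedModule) 0%R s)]. Qed.

Lemma Cderive_id s : is_Cderive (fun t => RtoC t) s 1.
Proof. exact (Cderive_real (fun t => t) s 1%R (is_derive_id (K := R_AbsRing) s)). Qed.

Lemma Cderive_plus f g s l m : is_Cderive f s l -> is_Cderive g s m -> is_Cderive (fun t => f t + g t) s (l + m).
Proof.
  intros [H1 H2] [H3 H4]; split.
  - exact (is_derive_plus _ _ _ _ _ H1 H3).
  - exact (is_derive_plus _ _ _ _ _ H2 H4).
Qed.

Lemma Cderive_mult f g s l m :
  is_Cderive f s l -> is_Cderive g s m -> is_Cderive (fun t => f t * g t) s (l * g s + f s * m).
Proof.
  intros [H1 H2] [H3 H4]; split.
  - assert (H : is_derive (fun t => Re (f t) * Re (g t) - Im (f t) * Im (g t))%R s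
      ((Re l * Re (g s) + Re (f s) * Re m) - (Im l * Im (g s) + Im (f s) * Im m))%R).
    { exact (is_derive_minus _ _ _ _ _
        (is_derive_mult _ _ _ _ _ H1 H3 Rmult_comm) (is_derive_mult _ _ _ _ _ H2 H4 Rmult_comm)). }
    match goal with |- is_derive _ _ ?x =>
      match type of H with is_derive _ _ ?y => replace x with y end end.
    + exact H.
    + unfold Re, Im; simpl; ring.
  - assert (H : is_derive (fun t => Re (f t) * Im (g t) + Im (f t) * Re (g t))%R s
      ((Re l * Im (g s) + Re (f s) * Im m) + (Im l * Re (g s) + Im (f s) * Re m))%R).
    { exact (is_derive_plus _ _ _ _ _
        (is_derive_mult _ _ _ _ _ H1 H4 Rmult_comm) (is_derive_mult _ _ _ _ _ H2 H3 Rmult_comm)). }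
    match goal with |- is_derive _ _ ?x =>
      match type of H with is_derive _ _ ?y => replace x with y end end.
    + exact H.
    + unfold Re, Im; simpl; ring.
Qed.

Lemma Cderive_scal k f s l : is_Cderive f s l -> is_Cderive (fun t => k * f t) s (k * l).
Proof.
  intros H. eapply Cderive_eq; [apply (Cderive_mult (fun _ => k)); [apply Cderive_const|exact H]|].
  cbv beta; ring.
Qed.

Lemma Cderive_minus f g s l m : is_Cderive f s l -> is_Cderive g s m -> is_Cderive (fun t => f t - g t) s (l - m).
Proof.
  intros H1 H2. apply Cderive_plus; [exact H1|].
  eapply Cderive_eq; [eapply Cderive_ext; [|apply (Cderive_scal (-(1)) _ _ _ H2)]|].
  - intros t; cbv beta; ring.
  - ring.
Qed.

Lemma Cderive_pow f s l n :
  is_Cderive f s l -> is_Cderive (fun t => f t ^ S n) s (RtoC (INR (S n)) * f s ^ n * l).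
Proof.
  intros H. induction n as [|n IH].
  - eapply Cderive_eq; [eapply Cderive_ext; [|exact H]|].
    + intros t; simpl; ring.
    + simpl; ring.
  - eapply Cderive_eq; [apply (Cderive_mult f (fun t => f t ^ S n)); [exact H|exact IH]|].
    cbv beta. rewrite (S_INR (S n)), RtoC_plus. simpl (f s ^ S n). ring.
Qed.

Lemma Cderive_comp_real f (g : R -> R) s l g' :
  is_derive g s g' -> is_Cderive f (g s) l -> is_Cderive (fun t => f (g t)) s (RtoC g' * l).
Proof.
  intros Hg [H1 H2]; split; rewrite ?re_scal_l.
  - exact (is_derive_comp _ _ _ _ _ H1 Hg).
  - replace (Im (RtoC g' * l)) with (g' * Im l)%R by (unfold Im; simpl; ring).
    exact (is_derive_comp _ _ _ _ _ H2 Hg).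
Qed.

(** Projecting on the direction of [f 1 - f 0] reduces the claim to real
    functions; separate estimates of real and imaginary part would cost a
    factor, which the induction in [Cexp_taylor] cannot afford. *)
Lemma mean_value_le f f' g g' :
  (forall s, (0 <= s <= 1)%R -> is_Cderive f s (f' s)) ->
  (forall s, (0 <= s <= 1)%R -> is_derive g s (g' s)) ->
  (forall s, (0 <= s <= 1)%R -> (Cmod (f' s) <= g' s)%R) ->
  (Cmod (f 1%R - f 0%R) <= g 1%R - g 0%R)%R.
Proof.
  intros Hf Hg Hle.
  set (d := f 1%R - f 0%R).
  set (h := fun t => (Cmod d * g t - Re (Cconj d * f t))%R).
  assert (Hh : forall s, (0 <= s <= 1)%R ->
     is_derive h s (Cmod d * g' s - Re (Cconj d * f' s))%R).
  { intros s Hs. apply @is_derive_minus.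
    - apply is_derive_scal, Hg, Hs.
    - exact (proj1 (Cderive_scal (Cconj d) _ _ _ (Hf s Hs))). }
  assert (H01 : (h 0 <= h 1)%R).
  { destruct (MVT_gen h 0 1 (fun s => (Cmod d * g' s - Re (Cconj d * f' s))%R)) as [c [Hc Heq]].
    - rewrite Rmin_left, Rmax_right by lra. intros x Hx; apply Hh; lra.
    - rewrite Rmin_left, Rmax_right by lra. intros x Hx.
      apply derivable_continuous_pt. eexists. apply is_derive_Reals, Hh; lra.
    - rewrite Rmin_left, Rmax_right in Hc by lra.
      assert (Re (Cconj d * f' c) <= Cmod d * g' c)%R.
      { eapply Rle_trans; [apply Rle_abs|]. eapply Rle_trans; [apply re_le_Cmod|].
        rewrite Cmod_mult, Cmod_conj. apply Rmult_le_compat_l; [apply Cmod_ge_0|now apply Hle]. }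
      lra. }
  unfold h in H01.
  assert (Hd : (Re (Cconj d * f 1%R) - Re (Cconj d * f 0%R) = Cmod d * Cmod d)%R).
  { rewrite <- Cconj_mod2. unfold d at 4. rewrite <- re_minus. f_equal; ring. }
  destruct (Cmod_ge_0 d) as [Hp|Hp]; [nra|].
  rewrite <- Hp.
  destruct (MVT_gen g 0 1 g') as [c [Hc Heq]].
  - rewrite Rmin_left, Rmax_right by lra. intros x Hx; apply Hg; lra.
  - rewrite Rmin_left, Rmax_right by lra. intros x Hx.
    apply derivable_continuous_pt. eexists. apply is_derive_Reals, Hg; lra.
  - rewrite Rmin_left, Rmax_right in Hc by lra.
    pose proof (Hle c Hc). pose proof (Cmod_ge_0 (f' c)). lra.
Qed.

Lemma mean_value_const f f' M :
  (forall s, (0 <= s <= 1)%R -> is_Cderive f s (f' s)) ->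
  (forall s, (0 <= s <= 1)%R -> (Cmod (f' s) <= M)%R) ->
  (Cmod (f 1%R - f 0%R) <= M)%R.
Proof.
  intros Hf HM.
  replace M with (M * 1 - M * 0)%R by ring.
  apply (mean_value_le f f' (fun t => (M * t)%R) (fun _ => M)); trivial.
  intros s _. auto_derive; trivial; ring.
Qed.

Lemma is_derive_quadratic (f : R -> R) s l K :
  (forall h, (Rabs h <= 1)%R -> (Rabs (f (s + h)%R - f s - h * l) <= K * h ^ 2)%R) ->
  is_derive f s l.
Proof.
  intros H. apply is_derive_Reals. intros eps He.
  assert (HK : (0 <= K)%R).
  { specialize (H 1%R ltac:(rewrite Rabs_R1; lra)).
    pose proof (Rabs_pos (f (s + 1)%R - f s - 1 * l)). lra. }
  assert (Hd : (0 < Rmin 1 (eps / (K + 1)))%R).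
  { apply Rmin_pos; [lra|apply Rdiv_lt_0_compat; lra]. }
  exists (mkposreal _ Hd). intros h Hh0 Hh; simpl in Hh.
  assert (H1 : (Rabs h < 1)%R) by (eapply Rlt_le_trans; [exact Hh|apply Rmin_l]).
  assert (H2 : (Rabs h < eps / (K + 1))%R) by (eapply Rlt_le_trans; [exact Hh|apply Rmin_r]).
  specialize (H h ltac:(lra)).
  replace ((f (s + h) - f s) / h - l)%R with ((f (s + h)%R - f s - h * l) / h)%R by (field; easy).
  assert (Hp : (0 < Rabs h)%R) by now apply Rabs_pos_lt.
  unfold Rdiv; rewrite Rabs_mult, Rabs_inv.
  apply Rmult_lt_reg_r with (Rabs h); [easy|].
  rewrite Rmult_assoc, Rinv_l, Rmult_1_r by lra.
  eapply Rle_lt_trans; [exact H|].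
  rewrite <- (pow2_abs h).
  assert (H3 : (Rabs h * (K + 1) < eps)%R).
  { apply Rmult_lt_reg_r with (/ (K + 1))%R; [apply Rinv_0_lt_compat; lra|].
    rewrite Rmult_assoc, Rinv_r by lra. lra. }
  nra.
Qed.

(** A quadratic remainder is how derivatives at a singular base point and under
    the integral sign are obtained below. *)
Lemma Cderive_quadratic f s l K :
  (forall h, (Rabs h <= 1)%R -> (Cmod (f (s + h)%R - f s - RtoC h * l) <= K * h ^ 2)%R) ->
  is_Cderive f s l.
Proof.
  intros H; split; apply is_derive_quadratic with K; intros h Hh.
  - eapply Rle_trans; [|apply (H h Hh)]. eapply Rle_trans; [|apply re_le_Cmod].
    apply Req_le; f_equal. rewrite !re_minus, re_scal_l. ring.
  - eapply Rle_trans; [|apply (H h Hh)]. eapply Rle_trans; [|apply im_le_Cmod].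
    apply Req_le; f_equal. rewrite !im_minus. unfold Im; simpl; ring.
Qed.

Definition Ccont (f : R -> C) : Prop :=
  forall s, continuous (fun t => Re (f t)) s /\ continuous (fun t => Im (f t)) s.

Lemma Cderive_cont f : (forall s, exists l, is_Cderive f s l) -> Ccont f.
Proof.
  intros H s. destruct (H s) as [l [H1 H2]].
  split; apply @ex_derive_continuous; eexists; eassumption.
Qed.

Lemma Ccont_const k : Ccont (fun _ => k).
Proof. intros s; split; apply continuous_const. Qed.

Lemma Ccont_plus f g : Ccont f -> Ccont g -> Ccont (fun t => f t + g t).
Proof.
  intros Hf Hg s. destruct (Hf s) as [H1 H2]; destruct (Hg s) as [H3 H4]. split.
  - exact (continuous_plus _ _ _ H1 H3).
  - exact (continuous_plus _ _ _ H2 H4).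
Qed.

Lemma Ccont_mult f g : Ccont f -> Ccont g -> Ccont (fun t => f t * g t).
Proof.
  intros Hf Hg s. destruct (Hf s) as [H1 H2]; destruct (Hg s) as [H3 H4]. split.
  - apply (continuous_minus (V := R_NormedModule) (fun t => Re (f t) * Re (g t))%R (fun t => Im (f t) * Im (g t))%R);
      apply (continuous_mult (K := R_AbsRing)); assumption.
  - apply (continuous_plus (V := R_NormedModule) (fun t => Re (f t) * Im (g t))%R (fun t => Im (f t) * Re (g t))%R);
      apply (continuous_mult (K := R_AbsRing)); assumption.
Qed.

Lemma Ccont_ext f g : (forall t, f t = g t) -> Ccont f -> Ccont g.
Proof.
  intros H Hf s; destruct (Hf s) as [H1 H2]; split.
  - apply continuous_ext with (2 := H1). intros t; now rewrite H.
  - apply continuous_ext with (2 := H2). intros t; now rewrite H.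
Qed.

Lemma Ccont_comp f (g : R -> R) :
  Ccont f -> (forall s, continuous g s) -> Ccont (fun t => f (g t)).
Proof.
  intros Hf Hg s; destruct (Hf (g s)) as [H1 H2]; split.
  - exact (continuous_comp g (fun x => Re (f x)) s (Hg s) H1).
  - exact (continuous_comp g (fun x => Im (f x)) s (Hg s) H2).
Qed.

(** * The complex exponential *)

Lemma Cexp_0 : Cexp 0 = 1.
Proof. unfold Cexp; simpl. rewrite exp_0, cos_0, sin_0. apply C_eq; unfold Re, Im; simpl; ring. Qed.

Lemma Cexp_plus x y : Cexp (x + y) = Cexp x * Cexp y.
Proof.
  apply C_eq; unfold Cexp, Re, Im; simpl; rewrite exp_plus, ?cos_plus, ?sin_plus; ring.
Qed.

Lemma Cmod_Cexp z : Cmod (Cexp z) = exp (Re z).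
Proof.
  unfold Cexp, Cmod; simpl.
  replace (exp (Re z) * cos (Im z) * (exp (Re z) * cos (Im z) * 1) +
    exp (Re z) * sin (Im z) * (exp (Re z) * sin (Im z) * 1))%R
   with ((exp (Re z))² * ((sin (Im z))² + (cos (Im z))²))%R by (unfold Rsqr; ring).
  rewrite sin2_cos2, Rmult_1_r. apply sqrt_Rsqr, Rlt_le, exp_pos.
Qed.

Lemma Cexp_neq_0 z : Cexp z <> 0.
Proof. apply Cmod_gt_0. rewrite Cmod_Cexp. apply exp_pos. Qed.

Lemma Cexp_opp z : Cexp (- z) = / Cexp z.
Proof.
  assert (H : Cexp (- z) * Cexp z = 1).
  { rewrite <- Cexp_plus. replace (- z + z) with (RtoC 0) by ring. apply Cexp_0. }
  pose proof (Cexp_neq_0 z).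
  replace (Cexp (- z)) with (Cexp (- z) * Cexp z / Cexp z) by (field; easy).
  rewrite H. field; easy.
Qed.

Lemma Cexp_real (x : R) : Cexp (RtoC x) = RtoC (exp x).
Proof. unfold Cexp; simpl. rewrite cos_0, sin_0. apply C_eq; unfold Re, Im; simpl; ring. Qed.

Lemma Cderive_Cexp f s l : is_Cderive f s l -> is_Cderive (fun t => Cexp (f t)) s (l * Cexp (f s)).
Proof.
  intros [H1 H2].
  assert (He : is_derive (fun t => exp (Re (f t))) s (Re l * exp (Re (f s)))%R).
  { apply (is_derive_comp exp (fun t => Re (f t))); [apply is_derive_exp|exact H1]. }
  assert (Hc : is_derive (fun t => cos (Im (f t))) s (Im l * - sin (Im (f s)))%R).
  { apply (is_derive_comp cos (fun t => Im (f t))); [apply is_derive_cos|exact H2]. }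
  assert (Hs : is_derive (fun t => sin (Im (f t))) s (Im l * cos (Im (f s)))%R).
  { apply (is_derive_comp sin (fun t => Im (f t))); [apply is_derive_sin|exact H2]. }
  split.
  - assert (H := is_derive_mult _ _ _ _ _ He Hc ltac:(intros; apply Rmult_comm)).
    match goal with |- is_derive _ _ ?x =>
      match type of H with is_derive _ _ ?y => replace x with y end end.
    + exact H.
    + unfold Cexp, Re, Im, plus, mult; simpl; ring.
  - assert (H := is_derive_mult _ _ _ _ _ He Hs ltac:(intros; apply Rmult_comm)).
    match goal with |- is_derive _ _ ?x =>
      match type of H with is_derive _ _ ?y => replace x with y end end.
    + exact H.
    + unfold Cexp, Re, Im, plus, mult; simpl; ring.
Qed.

Lemma factC_S n : factC (S n) = RtoC (INR (S n)) * factC n.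
Proof. unfold factC. change (fact (S n)) with (S n * fact n)%nat. now rewrite mult_INR, RtoC_mult. Qed.

Lemma factC_neq_0 n : factC n <> 0.
Proof. unfold factC. apply RtoC_neq_0, INR_fact_neq_0. Qed.

Lemma Cmod_factC n : Cmod (factC n) = INR (fact n).
Proof. unfold factC. rewrite Cmod_R, Rabs_right; [easy|apply Rle_ge, pos_INR]. Qed.

Lemma INR_S_neq_0 n : RtoC (INR (S n)) <> 0.
Proof. apply RtoC_neq_0, not_0_INR; lia. Qed.

Fixpoint Csum (u : nat -> C) (N : nat) : C :=
  match N with O => 0 | S n => Csum u n + u n end.

Lemma sum_n_SR (a : nat -> R) n : @eq R (sum_n a (S n)) (sum_n a n + a (S n))%R.
Proof. exact (sum_Sn a n). Qed.

Lemma Csum_ext u v N : (forall n, u n = v n) -> Csum u N = Csum v N.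
Proof. intros H; induction N as [|N IH]; simpl; [easy|now rewrite IH, H]. Qed.

Lemma Csum_lim u l : is_Cseries u l -> Clim eventually (Csum u) l.
Proof.
  intros [H1 H2].
  apply Clim_of_components; apply is_lim_seq_incr_1.
  - apply is_lim_seq_ext with (2 := H1). intros n. induction n as [|n IH].
    + rewrite sum_O. change (Re (u 0%nat) = (0 + Re (u 0%nat))%R). ring.
    + exact (eq_trans (sum_n_SR _ n) (f_equal (fun x => x + Re (u (S n)))%R IH)).
  - apply is_lim_seq_ext with (2 := H2). intros n. induction n as [|n IH].
    + rewrite sum_O. change (Im (u 0%nat) = (0 + Im (u 0%nat))%R). ring.
    + exact (eq_trans (sum_n_SR _ n) (f_equal (fun x => x + Im (u (S n)))%R IH)).
Qed.

(** Induction on [N]: the derivative of the remainder of order [N + 1] along the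
    segment from [0] to [w] is [w] times the remainder of order [N]. *)
Lemma Cexp_taylor N w :
  (Cmod (Cexp w - Csum (fun n => w ^ n / factC n)%C N)
     <= Cmod w ^ N / INR (fact N) * exp (Cmod w))%R.
Proof.
  revert w. induction N as [|N IH]; intros w.
  - simpl. replace (Cexp w - 0) with (Cexp w) by ring. rewrite Cmod_Cexp.
    replace (1 / 1 * exp (Cmod w))%R with (exp (Cmod w)) by field.
    assert (Hr : (Re w <= Cmod w)%R) by (eapply Rle_trans; [apply Rle_abs|apply re_le_Cmod]).
    destruct Hr as [Hr| ->]; [left; now apply exp_increasing|lra].
  - set (rem := fun M (s : R) => Cexp (RtoC s * w) - Csum (fun n => (RtoC s * w) ^ n / factC n) M).
    assert (HD : forall M s, is_Cderive (rem (S M)) s (w * rem M s)).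
    { intros M s. unfold rem.
      assert (H1 : is_Cderive (fun t => RtoC t * w) s w).
      { eapply Cderive_eq; [apply (Cderive_mult _ (fun _ => w)); [apply Cderive_id|apply Cderive_const]|cbv beta; ring]. }
      assert (HS : is_Cderive (fun t => Csum (fun n => (RtoC t * w) ^ n / factC n) (S M)) s
                      (w * Csum (fun n => (RtoC s * w) ^ n / factC n) M)).
      { induction M as [|M IHM].
        - eapply Cderive_eq; [eapply Cderive_ext; [|apply (Cderive_const 1)]|simpl; ring].
          intros t; simpl. change (factC 0) with (RtoC 1). field.
        - eapply Cderive_eq.
          + eapply Cderive_ext; [|apply Cderive_plus; [exact IHM|apply (Cderive_scal (/ factC (S M))), (Cderive_pow _ _ _ M H1)]].
            intros t; cbv beta.
            change (Csum (fun n => (RtoC t * w) ^ n / factC n) (S (S M))) with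
              (Csum (fun n => (RtoC t * w) ^ n / factC n) (S M) + (RtoC t * w) ^ S M / factC (S M)).
            unfold Cdiv; ring.
          + change (Csum (fun n => (RtoC s * w) ^ n / factC n) (S M)) with
              (Csum (fun n => (RtoC s * w) ^ n / factC n) M + (RtoC s * w) ^ M / factC M).
            rewrite factC_S. pose proof (factC_neq_0 M). pose proof (INR_S_neq_0 M).
            generalize dependent (factC M). generalize dependent (RtoC (INR (S M))).
            intros; field; auto. }
      eapply Cderive_eq; [apply Cderive_minus; [apply Cderive_Cexp, H1|exact HS]|]. unfold rem; ring. }
    assert (H0 : rem (S N) 0%R = 0).
    { unfold rem. replace (RtoC 0 * w) with (RtoC 0) by ring. rewrite Cexp_0.
      clear. induction N as [|N IH].
      - simpl. change (factC 0) with (RtoC 1). field.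
      - change (Csum (fun n => 0 ^ n / factC n) (S (S N))) with
          (Csum (fun n => 0 ^ n / factC n) (S N) + 0 ^ S N / factC (S N)).
        replace (0 ^ S N / factC (S N)) with (RtoC 0) by (simpl; unfold Cdiv; ring).
        rewrite Cplus_0_r. exact IH. }
    replace (Cexp w - Csum (fun n => w ^ n / factC n) (S N)) with (rem (S N) 1%R - rem (S N) 0%R).
    2:{ rewrite H0. unfold rem. rewrite Cmult_1_l. ring. }
    set (B := (Cmod w ^ S N / INR (fact (S N)) * exp (Cmod w))%R).
    replace B with (B * 1 ^ S N - B * 0 ^ S N)%R by (rewrite pow1, pow_i by lia; ring).
    apply (mean_value_le (rem (S N)) (fun s => w * rem N s)
      (fun s => (B * s ^ S N)%R) (fun s => (B * (INR (S N) * 1 * s ^ N))%R)).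
    + intros s _; apply HD.
    + intros s _. apply is_derive_scal. apply (is_derive_pow (fun t => t) (S N)).
      apply @is_derive_id.
    + intros s Hs. rewrite Cmod_mult. unfold rem.
      eapply Rle_trans; [apply Rmult_le_compat_l; [apply Cmod_ge_0|apply IH]|].
      assert (Hm : Cmod (RtoC s * w) = (s * Cmod w)%R).
      { rewrite Cmod_mult, Cmod_R, Rabs_right by lra. easy. }
      rewrite Hm. unfold B.
      change (fact (S N)) with (S N * fact N)%nat. rewrite mult_INR.
      pose proof (INR_fact_lt_0 N) as Hf. pose proof (Cmod_ge_0 w) as Hw.
      assert (HSN : (0 < INR (S N))%R) by (apply lt_0_INR; lia).
      replace (Cmod w ^ S N / (INR (S N) * INR (fact N)) * exp (Cmod w) * (INR (S N) * 1 * s ^ N))%R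
        with (Cmod w * ((s * Cmod w) ^ N / INR (fact N) * exp (Cmod w)))%R.
      2:{ rewrite Rpow_mult_distr. simpl (Cmod w ^ S N)%R. field. lra. }
      apply Rmult_le_compat_l; [easy|]. apply Rmult_le_compat_l.
      { apply Rdiv_le_0_compat; [apply pow_le; nra|easy]. }
      destruct (Rle_lt_or_eq_dec (s * Cmod w) (Cmod w)) as [Hlt|Heq]; [nra| |].
      * left; now apply exp_increasing.
      * rewrite Heq; lra.
Qed.

Lemma Cexp_2_le w : (Cmod (Cexp w - 1 - w) <= Cmod w ^ 2 * exp (Cmod w))%R.
Proof.
  pose proof (Cexp_taylor 2 w) as H. simpl in H.
  change (factC 0) with (RtoC 1) in H. change (factC 1) with (RtoC 1) in H.
  replace (Cexp w - (0 + 1 / 1 + w * 1 / 1)) with (Cexp w - 1 - w) in H by field.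
  eapply Rle_trans; [exact H|]. apply Rmult_le_compat_r; [left; apply exp_pos|].
  pose proof (Cmod_ge_0 w). simpl. nra.
Qed.


Lemma Ccont_real (f : R -> R) : (forall s, continuous f s) -> Ccont (fun t => RtoC (f t)).
Proof. intros H s; split; [apply H|apply continuous_const]. Qed.

Lemma Ccont_id : Ccont (fun t => RtoC t).
Proof. apply Ccont_real. intros s; apply continuous_id. Qed.

Lemma Ccont_one_minus : Ccont (fun t => RtoC (1 - t)).
Proof.
  apply Ccont_real. intros s.
  apply (continuous_minus (V := R_NormedModule)); [apply continuous_const|apply continuous_id].
Qed.

Lemma Ccont_opp f : Ccont f -> Ccont (fun t => - f t).
Proof.
  intros H. apply Ccont_ext with (fun t => (- (1)) * f t); [intros t; ring|].
  apply Ccont_mult; [apply Ccont_const|exact H].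
Qed.

Lemma Ccont_minus f g : Ccont f -> Ccont g -> Ccont (fun t => f t - g t).
Proof. intros Hf Hg. apply Ccont_plus; [exact Hf|now apply Ccont_opp]. Qed.

Lemma Ccont_pow f n : Ccont f -> Ccont (fun t => f t ^ n).
Proof.
  intros H. induction n as [|n IH]; simpl; [apply Ccont_const|now apply Ccont_mult].
Qed.

Lemma Ccont_Cexp f : Ccont f -> Ccont (fun t => Cexp (f t)).
Proof.
  intros H s. destruct (H s) as [H1 H2].
  assert (He : continuous (fun t => exp (Re (f t))) s).
  { apply (continuous_comp (fun t => Re (f t)) exp); [exact H1|].
    apply @ex_derive_continuous. eexists; apply is_derive_exp. }
  split; apply (continuous_mult (K := R_AbsRing)); trivial.
  - apply (continuous_comp (fun t => Im (f t)) cos); [exact H2|].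
    apply @ex_derive_continuous. eexists; apply is_derive_cos.
  - apply (continuous_comp (fun t => Im (f t)) sin); [exact H2|].
    apply @ex_derive_continuous. eexists; apply is_derive_sin.
Qed.

Lemma Ccont_Csum (u : nat -> R -> C) N :
  (forall n, Ccont (u n)) -> Ccont (fun t => Csum (fun n => u n t) N).
Proof.
  intros H. induction N as [|N IH]; simpl; [apply Ccont_const|now apply Ccont_plus].
Qed.

Ltac ccont :=
  repeat lazymatch goal with
  | |- Ccont (fun _ => ?k) => apply (Ccont_const k)
  | |- Ccont (fun t => RtoC t) => apply Ccont_id
  | |- Ccont (fun t => RtoC (1 - t)) => apply Ccont_one_minus
  | |- Ccont (fun t => @?f t + @?g t) => apply (Ccont_plus f g)
  | |- Ccont (fun t => @?f t - @?g t) => apply (Ccont_minus f g)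
  | |- Ccont (fun t => @?f t * @?g t) => apply (Ccont_mult f g)
  | |- Ccont (fun t => - @?f t) => apply (Ccont_opp f)
  | |- Ccont (fun t => @?f t ^ ?n) => apply (Ccont_pow f n)
  | |- Ccont (fun t => Cexp (@?f t)) => apply (Ccont_Cexp f)
  end.

(** * Logarithm and powers in the right half-plane *)

Lemma sqrt_1_tan z : (0 < Re z)%R -> sqrt (1 + (Im z / Re z)²) = (Cmod z / Re z)%R.
Proof.
  intros Hz. pose proof (Cmod_ge_0 z) as Hm.
  symmetry. rewrite <- (sqrt_Rsqr (Cmod z / Re z)).
  2:{ now apply Rdiv_le_0_compat. }
  f_equal. unfold Rsqr.
  replace (Cmod z / Re z * (Cmod z / Re z))%R with (Cmod z ^ 2 / Re z ^ 2)%R by (field; lra).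
  rewrite Cmod2_alt. field. lra.
Qed.

Lemma Carg_atan z : (0 < Re z)%R -> Carg z = atan (Im z / Re z).
Proof.
  intros Hz.
  assert (Hm : (0 < Cmod z)%R).
  { eapply Rlt_le_trans; [exact Hz|]. eapply Rle_trans; [apply Rle_abs|apply re_le_Cmod]. }
  assert (Hc : (cos (atan (Im z / Re z)) = Re z / Cmod z)%R).
  { rewrite cos_atan.
    rewrite sqrt_1_tan by easy. field. lra. }
  pose proof (atan_bound (Im z / Re z)) as Hb.
  assert (Hq : (0 < / Re z)%R) by (now apply Rinv_0_lt_compat).
  unfold Carg. destruct (Rle_dec 0 (Im z)) as [Hi|Hi].
  - rewrite <- Hc. apply acos_cos.
    assert (0 <= atan (Im z / Re z))%R.
    { destruct Hi as [Hi|Hi].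
      - left. rewrite <- atan_0. apply atan_increasing. unfold Rdiv. nra.
      - rewrite <- Hi. unfold Rdiv; rewrite Rmult_0_l, atan_0. lra. }
    lra.
  - rewrite <- Hc, <- cos_neg.
    rewrite acos_cos; [lra|].
    assert (atan (Im z / Re z) < 0)%R.
    { rewrite <- atan_0. apply atan_increasing. unfold Rdiv. nra. }
    lra.
Qed.

Lemma Re_pos_neq_0 z : (0 < Re z)%R -> z <> 0.
Proof. intros H E. rewrite E in H. simpl in H. lra. Qed.

Lemma Re_le_Cmod z : (Re z <= Cmod z)%R.
Proof. eapply Rle_trans; [apply Rle_abs|apply re_le_Cmod]. Qed.

Lemma Carg_bound z : (0 < Re z)%R -> (Rabs (Carg z) <= PI)%R.
Proof.
  intros H. rewrite Carg_atan by easy.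
  pose proof (atan_bound (Im z / Re z)). pose proof PI_RGT_0. apply Rabs_le; lra.
Qed.

Lemma Cexp_Cln z : (0 < Re z)%R -> Cexp (Cln z) = z.
Proof.
  intros Hz.
  assert (Hm : (0 < Cmod z)%R) by (pose proof (Re_le_Cmod z); lra).
  unfold Cexp, Cln; simpl. rewrite exp_ln by easy. rewrite Carg_atan by easy.
  rewrite cos_atan, sin_atan.
  rewrite sqrt_1_tan by easy. apply C_eq; unfold Re at 1, Im at 1; simpl.
  - field; lra.
  - field; lra.
Qed.

Lemma Cln_real (x : R) : (0 < x)%R -> Cln (RtoC x) = RtoC (ln x).
Proof.
  intros Hx. unfold Cln. rewrite Carg_atan by (simpl; easy).
  rewrite Cmod_R, Rabs_right by lra. unfold RtoC; simpl. unfold Rdiv; rewrite Rmult_0_l, atan_0.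
  reflexivity.
Qed.

Lemma Cpower_plus z v w : Cpower z (v + w) = Cpower z v * Cpower z w.
Proof. unfold Cpower. rewrite <- Cexp_plus. f_equal; ring. Qed.

Lemma Cpower_opp z w : Cpower z (- w) = / Cpower z w.
Proof. unfold Cpower. rewrite <- Cexp_opp. f_equal; ring. Qed.

Lemma Cpower_1 z : (0 < Re z)%R -> Cpower z 1 = z.
Proof. intros H. unfold Cpower. rewrite Cmult_1_l. now apply Cexp_Cln. Qed.

Lemma Cpower_neq_0 z w : Cpower z w <> 0.
Proof. apply Cexp_neq_0. Qed.

Lemma Cmod_Cpower z w :
  Cmod (Cpower z w) = exp (Re w * ln (Cmod z) - Im w * Carg z).
Proof. unfold Cpower. now rewrite Cmod_Cexp, re_mult. Qed.

Lemma exp_le x y : (x <= y)%R -> (exp x <= exp y)%R.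
Proof. intros [H| ->]; [left; now apply exp_increasing|lra]. Qed.

Lemma exp_le_1 x : (x <= 0)%R -> (exp x <= 1)%R.
Proof. intros H. apply exp_le in H. now rewrite exp_0 in H. Qed.

Lemma exp_ge_1 x : (0 <= x)%R -> (1 <= exp x)%R.
Proof. intros H. apply exp_le in H. now rewrite exp_0 in H. Qed.

Lemma Cmod_Cpower_le z w : (0 < Re z)%R ->
  (Cmod (Cpower z w) <= exp (Rabs (Im w) * PI) * Rpower (Cmod z) (Re w))%R.
Proof.
  intros Hz. rewrite Cmod_Cpower. unfold Rpower. rewrite <- exp_plus. apply exp_le.
  pose proof (Carg_bound z Hz) as Hb.
  assert (- (Im w * Carg z) <= Rabs (Im w) * PI)%R.
  { eapply Rle_trans; [apply Rle_abs|]. rewrite Rabs_Ropp, Rabs_mult.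
    apply Rmult_le_compat_l; [apply Rabs_pos|easy]. }
  lra.
Qed.

Lemma Rpower_le_base x y q : (0 < x <= y)%R -> (0 <= q)%R -> (Rpower x q <= Rpower y q)%R.
Proof.
  intros Hx Hq. unfold Rpower. apply exp_le. apply Rmult_le_compat_l; [easy|].
  destruct (proj2 Hx) as [H| ->]; [left; apply ln_increasing; lra|lra].
Qed.

Lemma Rpower_inv_le x y q : (0 < x <= y)%R -> (0 <= q)%R -> (Rpower y (- q) <= Rpower x (- q))%R.
Proof.
  intros Hx Hq. unfold Rpower. apply exp_le.
  assert (ln x <= ln y)%R.
  { destruct (proj2 Hx) as [H| ->]; [left; apply ln_increasing; lra|lra]. }
  nra.
Qed.

Lemma polar_derive (x y : R -> R) s x' y' :
  is_derive x s x' -> is_derive y s y' -> (0 < x s)%R ->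
  is_derive (fun t => / 2 * ln (x t * x t + y t * y t))%R s
     ((x' * x s + y' * y s) / (x s * x s + y s * y s))%R /\
  is_derive (fun t => atan (y t / x t))%R s
     ((y' * x s - x' * y s) / (x s * x s + y s * y s))%R.
Proof.
  intros H1 H2 Hp.
  assert (Hm2 : (0 < x s * x s + y s * y s)%R) by nra. split.
  - auto_derive.
    + repeat split; trivial; eexists; eassumption.
    + replace (Derive (fun t => x t) s) with x' by (symmetry; apply is_derive_unique, H1).
      replace (Derive (fun t => y t) s) with y' by (symmetry; apply is_derive_unique, H2). field. lra.
  - auto_derive.
    + repeat split; trivial; try (eexists; eassumption). lra.
    + replace (Derive (fun t => x t) s) with x' by (symmetry; apply is_derive_unique, H1).
      replace (Derive (fun t => y t) s) with y' by (symmetry; apply is_derive_unique, H2). field.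
      repeat split; nra.
Qed.

Lemma Cderive_Cln f s l : is_Cderive f s l -> (0 < Re (f s))%R -> is_Cderive (fun t => Cln (f t)) s (l / f s).
Proof.
  intros [H1 H2] Hp.
  assert (Hm2 : (0 < Re (f s) * Re (f s) + Im (f s) * Im (f s))%R) by nra.
  assert (Hloc : locally s (fun t => (0 < Re (f t))%R)).
  { assert (Hc : continuous (fun t => Re (f t)) s).
    { apply @ex_derive_continuous. eexists; exact H1. }
    apply (Hc (fun y => (0 < y)%R)). apply (open_gt 0). exact Hp. }
  destruct (polar_derive _ _ _ _ _ H1 H2 Hp) as [Hl Ha].
  assert (Hmod : forall z, (0 < Re z)%R -> (ln (Cmod z) = / 2 * ln (Re z * Re z + Im z * Im z))%R).
  { intros z Hz. assert (0 < Cmod z)%R by (pose proof (Re_le_Cmod z); lra).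
    replace (Re z * Re z + Im z * Im z)%R with (Cmod z * Cmod z)%R.
    - rewrite ln_mult by easy. field.
    - pose proof (Cmod2_alt z) as Hz2. simpl in Hz2. lra. }
  split.
  - apply is_derive_ext_loc with (fun t => (/ 2 * ln (Re (f t) * Re (f t) + Im (f t) * Im (f t)))%R).
    + revert Hloc. apply filter_imp. intros t Ht. unfold Cln; simpl. now rewrite <- Hmod.
    + match goal with |- is_derive _ _ ?x =>
        match type of Hl with is_derive _ _ ?y => replace x with y end end; [exact Hl|].
      unfold Re, Im in *; simpl. field. nra.
  - apply is_derive_ext_loc with (fun t => atan (Im (f t) / Re (f t))%R).
    + revert Hloc. apply filter_imp. intros t Ht. unfold Cln; simpl. now rewrite Carg_atan.
    + match goal with |- is_derive _ _ ?x =>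
        match type of Ha with is_derive _ _ ?y => replace x with y end end; [exact Ha|].
      unfold Re, Im in *; simpl. field. nra.
Qed.

Lemma Cderive_Cpower f s l w : is_Cderive f s l -> (0 < Re (f s))%R ->
  is_Cderive (fun t => Cpower (f t) w) s (w * l / f s * Cpower (f s) w).
Proof.
  intros H Hp. unfold Cpower.
  eapply Cderive_eq; [apply Cderive_Cexp, Cderive_scal, Cderive_Cln; eassumption|].
  unfold Cdiv; ring.
Qed.

(** Complex powers of a nonnegative real base, extended by [0] to the left so
    that for exponents with real part at least [2] they are differentiable on
    the whole line. *)
Definition rpow (x : R) (w : C) : C :=
  if Rlt_dec 0 x then Cexp (w * RtoC (ln x)) else 0.

Lemma rpow_pos x w : (0 < x)%R -> rpow x w = Cexp (w * RtoC (ln x)).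
Proof. intros H. unfold rpow. destruct (Rlt_dec 0 x); [easy|lra]. Qed.

Lemma rpow_nonpos x w : (x <= 0)%R -> rpow x w = 0.
Proof. intros H. unfold rpow. destruct (Rlt_dec 0 x); [lra|easy]. Qed.

Lemma rpow_1 w : rpow 1 w = 1.
Proof. rewrite rpow_pos by lra. rewrite ln_1, Cmult_0_r. apply Cexp_0. Qed.

Lemma rpow_S x w : rpow x w = RtoC x * rpow x (w - 1).
Proof.
  destruct (Rlt_dec 0 x) as [H|H].
  - rewrite !rpow_pos by easy.
    assert (Hx : RtoC x = Cexp (RtoC (ln x))) by (rewrite Cexp_real, exp_ln; easy).
    rewrite Hx at 1. rewrite <- Cexp_plus. f_equal. ring.
  - rewrite !rpow_nonpos by lra. ring.
Qed.

Lemma Cmod_rpow x w : (0 < x)%R -> Cmod (rpow x w) = exp (Re w * ln x).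
Proof.
  intros H. rewrite rpow_pos by easy. rewrite Cmod_Cexp, re_mult. simpl. f_equal; ring.
Qed.

Lemma ln_nonpos x : (0 < x <= 1)%R -> (ln x <= 0)%R.
Proof.
  intros [H1 [H2| ->]]; [|rewrite ln_1; lra].
  left. rewrite <- ln_1. apply ln_increasing; lra.
Qed.

Lemma Cmod_rpow_le_1 x w : (x <= 1)%R -> (0 <= Re w)%R -> (Cmod (rpow x w) <= 1)%R.
Proof.
  intros H1 Hw. destruct (Rlt_dec 0 x) as [H|H].
  - rewrite Cmod_rpow by easy. rewrite <- exp_0. apply exp_le.
    pose proof (ln_nonpos x ltac:(lra)). nra.
  - rewrite rpow_nonpos by lra. rewrite Cmod_0; lra.
Qed.

Lemma Cderive_rpow w s : (2 <= Re w)%R -> is_Cderive (fun x => rpow x w) s (w * rpow s (w - 1)).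
Proof.
  intros Hw. destruct (Rtotal_order s 0) as [H|[H|H]].
  - apply Cderive_ext_loc with (fun _ => RtoC 0).
    + apply filter_imp with (fun t => (t < 0)%R); [|apply (open_lt 0); exact H].
      intros t Ht. rewrite rpow_nonpos by lra. easy.
    + eapply Cderive_eq; [apply Cderive_const|]. rewrite rpow_nonpos by lra. ring.
  - subst s. apply Cderive_quadratic with 1%R. intros h Hh.
    rewrite !(rpow_nonpos 0) by lra. rewrite Rplus_0_l.
    replace (rpow h w - 0 - RtoC h * (w * 0)) with (rpow h w) by ring.
    rewrite Rmult_1_l.
    destruct (Rlt_dec 0 h) as [Hp|Hp].
    + rewrite Cmod_rpow by easy. rewrite Rabs_right in Hh by lra.
      replace (h ^ 2)%R with (exp (2 * ln h))%R.
      * apply exp_le. pose proof (ln_nonpos h ltac:(lra)). nra.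
      * replace (2 * ln h)%R with (ln h + ln h)%R by ring. rewrite exp_plus, exp_ln by easy. ring.
    + rewrite rpow_nonpos by lra. rewrite Cmod_0. apply pow2_ge_0.
  - apply Cderive_ext_loc with (fun t => Cexp (w * RtoC (ln t))).
    + apply filter_imp with (fun t => (0 < t)%R); [|apply (open_gt 0); exact H].
      intros t Ht. rewrite rpow_pos by lra. easy.
    + eapply Cderive_eq.
      * apply Cderive_Cexp, Cderive_scal. apply (Cderive_real ln s (/ s)%R). now apply is_derive_ln.
      * cbv beta. rewrite <- (rpow_pos s w) by easy. rewrite (rpow_S s w).
        rewrite RtoC_inv by lra. field. apply RtoC_neq_0; lra.
Qed.

Lemma Ccont_rpow w : (2 <= Re w)%R -> Ccont (fun x => rpow x w).
Proof. intros Hw. apply Cderive_cont. intros s. eexists. now apply Cderive_rpow. Qed.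

(** * Exponential generating functions *)

Definition egf (u : nat -> C) (z : C) : C := CSeries (fun n => u n * (z ^ n / factC n)).

Definition geom_bounded (u : nat -> C) : Prop :=
  exists K D : R, forall n, (Cmod (u n) <= K * D ^ n)%R.

Lemma egf_term_le u K D z n : (Cmod (u n) <= K * D ^ n)%R ->
  (Cmod (u n * (z ^ n / factC n)) <= K * ((D * Cmod z) ^ n / INR (fact n)))%R.
Proof.
  intros H. rewrite Cmod_mult, Cmod_div, Cmod_pow, Cmod_factC by apply factC_neq_0.
  eapply Rle_trans.
  - apply Rmult_le_compat_r; [|exact H].
    apply Rdiv_le_0_compat; [apply pow_le, Cmod_ge_0|apply INR_fact_lt_0].
  - rewrite Rpow_mult_distr. apply Req_le. field. apply INR_fact_neq_0.
Qed.

Lemma is_series_exp x : is_series (fun n => x ^ n / INR (fact n))%R (exp x).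
Proof.
  apply is_series_ext with (2 := is_exp_Reals x).
  intros n. unfold scal; simpl; unfold mult; simpl. rewrite pow_n_pow. easy.
Qed.

Lemma pow_fact_le_exp x m : (0 <= x)%R -> (x ^ m / INR (fact m) <= exp x)%R.
Proof.
  intros Hx. rewrite <- (is_series_unique _ _ (is_series_exp x)).
  assert (Hpos : forall n, (0 <= x ^ n / INR (fact n))%R).
  { intros n. apply Rdiv_le_0_compat; [now apply pow_le|apply INR_fact_lt_0]. }
  assert (Hex : ex_series (fun n => x ^ n / INR (fact n))%R) by (eexists; apply is_series_exp).
  rewrite (Series_incr_n _ (S m)); [|lia|exact Hex].
  simpl pred.
  assert (H1 : (x ^ m / INR (fact m) <= sum_f_R0 (fun n => x ^ n / INR (fact n)) m)%R).
  { destruct m as [|m]; [simpl; lra|]. rewrite tech5.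
    assert (0 <= sum_f_R0 (fun n => x ^ n / INR (fact n)) m)%R by now apply cond_pos_sum.
    lra. }
  assert (H2 : (0 <= Series (fun k => x ^ (S m + k) / INR (fact (S m + k))))%R).
  { assert (H0 : Series (fun k : nat => (0 * (x ^ (S m + k) / INR (fact (S m + k))))%R) = 0%R)
      by (rewrite Series_scal_l; ring).
    rewrite <- H0. apply Series_le.
    - intros n. rewrite Rmult_0_l. split; [lra|apply Hpos].
    - apply (ex_series_incr_n (fun n => x ^ n / INR (fact n))%R (S m)). exact Hex. }
  lra.
Qed.

Lemma is_Cseries_egf u z : geom_bounded u -> is_Cseries (fun n => u n * (z ^ n / factC n)) (egf u z).
Proof.
  intros [K [D H]].
  apply is_Cseries_dom with (v := fun n => (K * ((D * Cmod z) ^ n / INR (fact n)))%R).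
  - intros n. now apply egf_term_le.
  - apply (ex_series_scal (V := R_NormedModule) K). eexists; apply is_series_exp.
Qed.

Lemma egf_ext u v z : (forall n, u n = v n) -> geom_bounded u -> egf u z = egf v z.
Proof.
  intros H Hu. symmetry. apply CSeries_unique.
  apply is_Cseries_ext with (2 := is_Cseries_egf u z Hu). intros n; now rewrite H.
Qed.

Lemma egf_lin u v k l z : geom_bounded u -> geom_bounded v ->
  egf (fun n => k * u n + l * v n) z = k * egf u z + l * egf v z.
Proof.
  intros Hu Hv. apply CSeries_unique.
  apply is_Cseries_ext with (2 := is_Cseries_plus _ _ _ _
    (is_Cseries_scal k _ _ (is_Cseries_egf u z Hu)) (is_Cseries_scal l _ _ (is_Cseries_egf v z Hv))).
  intros n; cbv beta; ring.
Qed.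

Lemma INR_le_pow2 n : (INR n <= 2 ^ n)%R.
Proof.
  induction n as [|n IH]; [simpl; lra|]. rewrite S_INR. simpl.
  pose proof (pow_R1_Rle 2 n ltac:(lra)). lra.
Qed.

Lemma geom_bounded_index u : geom_bounded u -> geom_bounded (fun n => RtoC (INR n) * u n).
Proof.
  intros [K [D H]]. exists (Rabs K)%R, (2 * Rabs D)%R. intros n.
  rewrite Cmod_mult, Cmod_R, Rabs_right by apply Rle_ge, pos_INR.
  rewrite Rpow_mult_distr.
  pose proof (INR_le_pow2 n) as Hn.
  specialize (H n).
  assert (Hk : (K * D ^ n <= Rabs K * Rabs D ^ n)%R).
  { rewrite RPow_abs, <- Rabs_mult. apply Rle_abs. }
  replace (Rabs K * (2 ^ n * Rabs D ^ n))%R with (2 ^ n * (Rabs K * Rabs D ^ n))%R by ring.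
  apply Rmult_le_compat; [apply pos_INR|apply Cmod_ge_0|easy|lra].
Qed.

Lemma geom_bounded_shift u : geom_bounded u -> geom_bounded (fun n => u (S n)).
Proof.
  intros [K [D H]]. exists (K * D)%R, D. intros n.
  eapply Rle_trans; [apply H|]. simpl; lra.
Qed.

Lemma egf_index u z : geom_bounded u ->
  egf (fun n => RtoC (INR n) * u n) z = z * egf (fun n => u (S n)) z.
Proof.
  intros Hu. apply CSeries_unique. apply is_Cseries_shift.
  - simpl. ring.
  - apply is_Cseries_ext with (2 := is_Cseries_scal z _ _ (is_Cseries_egf _ z (geom_bounded_shift u Hu))).
    intros n. rewrite factC_S, Cpow_S. field.
    split; [apply factC_neq_0|apply INR_S_neq_0].
Qed.

Lemma geom_bounded_ratio (u q : nat -> C) (D : R) :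
  (forall n, u (S n) = q n * u n) -> (forall n, (Cmod (q n) <= D)%R) -> geom_bounded u.
Proof.
  intros Hu Hq. exists (Cmod (u 0%nat)), D. intros n. induction n as [|n IH].
  - simpl; lra.
  - rewrite Hu, Cmod_mult. simpl.
    replace (Cmod (u 0%nat) * (D * D ^ n))%R with (D * (Cmod (u 0%nat) * D ^ n))%R by ring.
    apply Rmult_le_compat; trivial; apply Cmod_ge_0.
Qed.


(** * Pochhammer symbols and Euler's limit for the Gamma function *)

Lemma add_nat_neq_0 c n : ~ nonpos_int c -> c + RtoC (INR n) <> 0.
Proof.
  intros Hc H. apply Hc. exists n.
  replace c with (c + RtoC (INR n) - RtoC (INR n)) by ring. rewrite H. ring.
Qed.

Lemma nonpos_int_S c : ~ nonpos_int c -> ~ nonpos_int (c + 1).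
Proof.
  intros Hc [k Hk]. apply Hc. exists (S k). rewrite S_INR, RtoC_plus.
  replace c with (c + 1 - 1) by ring. rewrite Hk. ring.
Qed.

Lemma nonpos_int_add c n : ~ nonpos_int c -> ~ nonpos_int (c + RtoC (INR n)).
Proof.
  intros Hc. induction n as [|n IH].
  - simpl. now rewrite Cplus_0_r.
  - rewrite S_INR, RtoC_plus, Cplus_assoc. now apply nonpos_int_S.
Qed.

Lemma Re_pos_nonpos_int a : (0 < Re a)%R -> ~ nonpos_int a.
Proof.
  intros Ha [k Hk]. rewrite Hk, re_opp, re_RtoC in Ha. pose proof (pos_INR k). lra.
Qed.

Lemma nonpos_int_neq_0 c : ~ nonpos_int c -> c <> 0.
Proof. intros Hc E. apply Hc. exists 0%nat. rewrite E. simpl. ring. Qed.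

Lemma poch_S c n : poch c (S n) = poch c n * (c + RtoC (INR n)).
Proof. reflexivity. Qed.

Lemma poch_neq_0 c n : ~ nonpos_int c -> poch c n <> 0.
Proof.
  intros Hc. induction n as [|n IH]; simpl.
  - apply C1_nz.
  - apply Cmult_neq_0; [easy|now apply add_nat_neq_0].
Qed.

Lemma poch_shift c n : poch c n * (c + RtoC (INR n)) = c * poch (c + 1) n.
Proof.
  induction n as [|n IH].
  - simpl. ring.
  - simpl (poch _ (S n)). rewrite IH, S_INR, RtoC_plus. ring.
Qed.

Lemma Cmod_nat n : Cmod (RtoC (INR n)) = INR n.
Proof. rewrite Cmod_R. apply Rabs_right, Rle_ge, pos_INR. Qed.

(** The sequence [c + n] never vanishes and grows linearly. *)
Lemma add_nat_lower_bound c : ~ nonpos_int c ->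
  exists e, (0 < e)%R /\ forall n, (e * (1 + INR n) <= Cmod (c + RtoC (INR n)))%R.
Proof.
  intros Hc.
  assert (Hfin : forall N, exists e, (0 < e)%R /\
    forall n, (n < N)%nat -> (e * (1 + INR n) <= Cmod (c + RtoC (INR n)))%R).
  { induction N as [|N [e [He IH]]].
    - exists 1%R. split; [lra|]. intros n Hn; lia.
    - pose proof (proj1 (Cmod_gt_0 _) (add_nat_neq_0 c N Hc)) as HN.
      pose proof (pos_INR N) as HpN.
      set (e' := (Cmod (c + RtoC (INR N)) / (1 + INR N))%R).
      assert (He' : (0 < e')%R) by (apply Rdiv_lt_0_compat; lra).
      exists (Rmin e e'). split; [now apply Rmin_pos|].
      intros n Hn. destruct (Nat.eq_dec n N) as [->|Hne].
      + apply Rle_trans with (e' * (1 + INR N))%R.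
        * apply Rmult_le_compat_r; [lra|apply Rmin_r].
        * unfold e'. apply Req_le. field. lra.
      + eapply Rle_trans; [|apply IH; lia].
        pose proof (pos_INR n).
        apply Rmult_le_compat_r; [lra|apply Rmin_l]. }
  (* Beyond [2 |c|] the term [n] dominates [c]; below, [Hfin] applies. *)
  destruct (nfloor_ex (2 * Cmod c + 1)) as [N [_ HN]].
  { pose proof (Cmod_ge_0 c); lra. }
  destruct (Hfin (S N)) as [e [He H]].
  exists (Rmin e (/ 4)). split; [apply Rmin_pos; lra|].
  intros n. pose proof (pos_INR n).
  destruct (Nat.lt_ge_cases n (S N)) as [Hn|Hn].
  - eapply Rle_trans; [|apply H, Hn].
    apply Rmult_le_compat_r; [lra|apply Rmin_l].
  - apply Rle_trans with (/ 4 * (1 + INR n))%R.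
    + apply Rmult_le_compat_r; [lra|apply Rmin_r].
    + assert (INR N + 1 <= INR n)%R by (rewrite <- S_INR; apply le_INR; lia).
      pose proof (Cmod_minus_ge (RtoC (INR n)) (- c)) as Hm.
      rewrite Cmod_opp, Cmod_nat in Hm.
      replace (RtoC (INR n) - - c) with (c + RtoC (INR n)) in Hm by ring.
      pose proof (Cmod_ge_0 c). lra.
Qed.

Lemma add_nat_ratio_bound a c : ~ nonpos_int c ->
  exists D, forall n, (Cmod ((a + RtoC (INR n)) / (c + RtoC (INR n))) <= D)%R.
Proof.
  intros Hc. destruct (add_nat_lower_bound c Hc) as [e [He H]].
  exists ((Cmod a + 1) / e)%R. intros n.
  pose proof (pos_INR n) as Hn. pose proof (Cmod_ge_0 a) as Ha.
  rewrite Cmod_div by now apply add_nat_neq_0.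
  assert (Hp : (0 < Cmod (c + RtoC (INR n)))%R).
  { eapply Rlt_le_trans; [|apply H]. apply Rmult_lt_0_compat; lra. }
  assert (Hu : (Cmod (a + RtoC (INR n)) <= (Cmod a + 1) * (1 + INR n))%R).
  { eapply Rle_trans; [apply Cmod_triangle|]. rewrite Cmod_nat. nra. }
  apply Rmult_le_reg_r with (Cmod (c + RtoC (INR n))); [easy|].
  replace (Cmod (a + RtoC (INR n)) / Cmod (c + RtoC (INR n)) * Cmod (c + RtoC (INR n)))%R
    with (Cmod (a + RtoC (INR n))) by (field; lra).
  eapply Rle_trans; [exact Hu|].
  apply Rle_trans with ((Cmod a + 1) / e * (e * (1 + INR n)))%R.
  - apply Req_le; field; lra.
  - apply Rmult_le_compat_l; [|apply H]. apply Rdiv_le_0_compat; lra.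
Qed.

Lemma Clim_nat_ratio a c : ~ nonpos_int c ->
  Clim eventually (fun n => (a + RtoC (INR n)) / (c + RtoC (INR n))) 1.
Proof.
  intros Hc. destruct (add_nat_lower_bound c Hc) as [e [He H]].
  apply Clim_eventually_intro with (Cmod (a - c) / e)%R. intros n Hn.
  assert (HnR : (1 <= INR n)%R) by (change 1%R with (INR 1); now apply le_INR).
  pose proof (add_nat_neq_0 c n Hc) as Hne.
  replace ((a + RtoC (INR n)) / (c + RtoC (INR n)) - 1) with ((a - c) / (c + RtoC (INR n))) by (field; easy).
  rewrite Cmod_div by easy. unfold Rdiv.
  rewrite Rmult_assoc. apply Rmult_le_compat_l; [apply Cmod_ge_0|].
  rewrite <- Rinv_mult. apply Rinv_le_contravar; [nra|].
  eapply Rle_trans; [|apply H]. nra.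
Qed.

(** A telescoping majorant of [1 / (n + 2) ^ 2]. *)
Definition gap_inv (n : nat) : R := (/ (INR n + 1) - / (INR n + 2))%R.

Lemma gap_inv_pos n : (0 <= gap_inv n)%R.
Proof.
  unfold gap_inv. pose proof (pos_INR n).
  assert (/ (INR n + 2) <= / (INR n + 1))%R by (apply Rinv_le_contravar; lra). lra.
Qed.

Lemma ex_series_gap_inv : ex_series gap_inv.
Proof.
  exists 1%R.
  assert (H : forall n, @eq R (sum_n gap_inv n) (1 - / (INR n + 2))%R).
  { induction n as [|n IH].
    - rewrite sum_O. unfold gap_inv. simpl. field.
    - rewrite sum_n_SR, IH. unfold gap_inv. rewrite S_INR.
      pose proof (pos_INR n). field. lra. }
  unfold is_series. apply filterlim_ext with (f := fun n => (1 - / (INR n + 2))%R).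
  { intros n; now rewrite H. }
  change (is_lim_seq (fun n => (1 - / (INR n + 2))%R) 1%R).
  replace (Finite 1) with (Rbar_minus 1 0) by (simpl; f_equal; ring).
  apply is_lim_seq_minus'; [apply is_lim_seq_const|].
  apply (is_lim_seq_ext (fun n => / INR (n + 2))%R).
  { intros n. rewrite plus_INR. reflexivity. }
  apply (is_lim_seq_incr_n (fun n => / INR n)%R 2).
  apply (is_lim_seq_inv _ p_infty); [apply is_lim_seq_INR|easy].
Qed.

(** Convergence of an infinite product whose factors are [1 + O(1/n^2)]: the
    partial products are bounded by the exponential of the summable errors, so
    their increments are summable. *)
Lemma product_converges (u : nat -> C) (K : R) : (0 <= K)%R ->
  (forall n, (Cmod (u (S n) - u n) <= K * gap_inv n * Cmod (u n))%R) ->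
  exists l, Clim eventually u l.
Proof.
  intros HK H.
  assert (Hb : forall n, (Cmod (u n) <= Cmod (u 0%nat) * exp (K * (1 - / (INR n + 1))))%R).
  { induction n as [|n IH].
    - simpl. replace (K * (1 - / (0 + 1)))%R with 0%R by field. rewrite exp_0. lra.
    - pose proof (gap_inv_pos n) as Ht.
      apply Rle_trans with ((1 + K * gap_inv n) * Cmod (u n))%R.
      + replace (u (S n)) with ((u (S n) - u n) + u n) by ring.
        eapply Rle_trans; [apply Cmod_triangle|]. specialize (H n). lra.
      + apply Rle_trans with (exp (K * gap_inv n) * (Cmod (u 0%nat) * exp (K * (1 - / (INR n + 1)))))%R.
        * apply Rmult_le_compat; [|apply Cmod_ge_0| |exact IH]; [nra|].
          apply exp_ineq1_le.
        * apply Req_le.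
          replace (K * (1 - / (INR (S n) + 1)))%R with (K * gap_inv n + K * (1 - / (INR n + 1)))%R.
          { rewrite exp_plus; ring. }
          unfold gap_inv. rewrite S_INR. replace (INR n + 1 + 1)%R with (INR n + 2)%R by ring. ring. }
  set (B := (Cmod (u 0%nat) * exp K)%R).
  assert (HB : forall n, (Cmod (u n) <= B)%R).
  { intros n. eapply Rle_trans; [apply Hb|]. apply Rmult_le_compat_l; [apply Cmod_ge_0|].
    apply exp_le. assert (0 < / (INR n + 1))%R.
    { apply Rinv_0_lt_compat. pose proof (pos_INR n); lra. }
    nra. }
  assert (Hs : is_Cseries (fun n => u (S n) - u n) (CSeries (fun n => u (S n) - u n))).
  { apply is_Cseries_dom with (fun n => (K * B * gap_inv n)%R).
    - intros n. eapply Rle_trans; [apply H|].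
      pose proof (gap_inv_pos n). specialize (HB n).
      replace (K * B * gap_inv n)%R with (K * gap_inv n * B)%R by ring.
      apply Rmult_le_compat_l; [nra|easy].
    - apply (ex_series_scal (V := R_NormedModule)), ex_series_gap_inv. }
  set (l := CSeries (fun n => u (S n) - u n)) in *.
  exists (u 0%nat + l).
  destruct Hs as [H1 H2].
  apply Clim_of_components.
  - apply is_lim_seq_incr_1. rewrite re_plus.
    apply is_lim_seq_ext with (fun n => (Re (u 0%nat) + sum_n (fun k => Re (u (S k) - u k)) n)%R).
    + intros n. induction n as [|n IH].
      * rewrite sum_O, re_minus. ring.
      * rewrite sum_n_SR, re_minus. lra.
    + apply is_lim_seq_plus'; [apply is_lim_seq_const|exact H1].
  - apply is_lim_seq_incr_1.
    change (Im (u 0%nat + l)) with (Im (u 0%nat) + Im l)%R.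
    apply is_lim_seq_ext with (fun n => (Im (u 0%nat) + sum_n (fun k => Im (u (S k) - u k)) n)%R).
    + intros n. induction n as [|n IH].
      * rewrite sum_O, im_minus. ring.
      * rewrite sum_n_SR, im_minus. lra.
    + apply is_lim_seq_plus'; [apply is_lim_seq_const|exact H2].
Qed.

(** The sequence whose limit defines [CGamma]. *)
Definition euler_seq (z : C) (n : nat) : C :=
  factC n * Cpower (RtoC (INR n)) z / poch z (S n).

Lemma euler_seq_neq_0 z n : ~ nonpos_int z -> euler_seq z n <> 0.
Proof.
  intros Hz. unfold euler_seq, Cdiv.
  apply Cmult_neq_0.
  - apply Cmult_neq_0; [apply factC_neq_0|apply Cpower_neq_0].
  - intros E. pose proof (poch_neq_0 z (S n) Hz) as Hp.
    apply C1_nz. rewrite <- (Cinv_r _ Hp), E. ring.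
Qed.

Lemma ln_1_minus e : (0 < e <= / 2)%R ->
  (- (2 * e) <= ln (1 - e) <= 0)%R /\ (Rabs (e + ln (1 - e)) <= 2 * e ^ 2)%R.
Proof.
  intros He.
  assert (Hl1 : forall x, (0 < x)%R -> (ln x <= x - 1)%R).
  { intros x Hx. pose proof (exp_ineq1_le (ln x)) as H. rewrite exp_ln in H by easy. lra. }
  pose proof (Hl1 (1 - e)%R ltac:(lra)) as H1.
  pose proof (Hl1 (/ (1 - e))%R ltac:(apply Rinv_0_lt_compat; lra)) as H2.
  rewrite ln_Rinv in H2 by lra.
  assert (H3 : (/ (1 - e) <= 1 + e + 2 * e ^ 2)%R).
  { apply Rmult_le_reg_r with (1 - e)%R; [lra|]. rewrite Rinv_l by lra. nra. }
  split; [nra|]. apply Rabs_le. nra.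
Qed.

(** With [e = 1/(n+2)], the inverse ratio [(1 + z e) (1 - e)^z] of consecutive
    terms agrees with [1] to first order in [e]. *)
Lemma euler_ratio_estimate z e : (0 < e <= / 2)%R ->
  (Cmod ((1 + z * RtoC e) * Cexp (z * RtoC (ln (1 - e))) - 1)
    <= ((1 + Cmod z) * (4 * Cmod z ^ 2 * exp (Cmod z)) + 2 * Cmod z + 2 * Cmod z ^ 2) * e ^ 2)%R.
Proof.
  intros He. destruct (ln_1_minus e He) as [HL HL2].
  set (L := ln (1 - e)) in *. set (A := Cmod z).
  assert (HA : (0 <= A)%R) by apply Cmod_ge_0.
  set (w := z * RtoC L).
  assert (HabsL : (Rabs L <= 2 * e)%R) by (apply Rabs_le; lra).
  assert (Hw : (Cmod w <= A * (2 * e))%R).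
  { unfold w. rewrite Cmod_mult, Cmod_R. now apply Rmult_le_compat_l. }
  replace ((1 + z * RtoC e) * Cexp w - 1) with
    ((1 + z * RtoC e) * (Cexp w - 1 - w) + (z * RtoC (e + L) + z * z * RtoC (e * L))).
  2:{ unfold w. rewrite RtoC_plus, RtoC_mult. ring. }
  eapply Rle_trans; [apply Cmod_triangle|].
  eapply Rle_trans; [apply Rplus_le_compat_l, Cmod_triangle|].
  rewrite !Cmod_mult, !Cmod_R. fold A.
  pose proof (Rabs_pos (e + L)) as Hp1.
  assert (H1 : (Cmod (1 + z * RtoC e) <= 1 + A)%R).
  { eapply Rle_trans; [apply Cmod_triangle|]. rewrite Cmod_1, Cmod_mult, Cmod_R, Rabs_right by lra.
    fold A. nra. }
  assert (H2 : (Cmod (Cexp w - 1 - w) <= 4 * A ^ 2 * exp A * e ^ 2)%R).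
  { eapply Rle_trans; [apply Cexp_2_le|].
    replace (4 * A ^ 2 * exp A * e ^ 2)%R with ((A * (2 * e)) ^ 2 * exp A)%R by ring.
    apply Rmult_le_compat.
    - apply pow_le, Cmod_ge_0.
    - left; apply exp_pos.
    - apply pow_incr. split; [apply Cmod_ge_0|easy].
    - apply exp_le. nra. }
  assert (H3 : (A * Rabs (e + L) <= A * (2 * e ^ 2))%R) by (apply Rmult_le_compat_l; easy).
  assert (H4 : (A * A * Rabs (e * L) <= A * A * (2 * e ^ 2))%R).
  { apply Rmult_le_compat_l; [nra|]. rewrite Rabs_mult, (Rabs_right e) by lra. nra. }
  assert (H5 : (Cmod (1 + z * RtoC e) * Cmod (Cexp w - 1 - w) <= (1 + A) * (4 * A ^ 2 * exp A * e ^ 2))%R).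
  { apply Rmult_le_compat; trivial; apply Cmod_ge_0. }
  lra.
Qed.

Lemma euler_seq_ratio z n : ~ nonpos_int z ->
  euler_seq z (S n) = euler_seq z (S (S n)) *
   ((1 + z * RtoC (/ (INR n + 2))) * Cexp (z * RtoC (ln (1 - / (INR n + 2))))).
Proof.
  intros Hz. unfold euler_seq. pose proof (pos_INR n) as Hn.
  assert (H1 : Cpower (RtoC (INR (S n))) z =
    Cpower (RtoC (INR (S (S n)))) z * Cexp (z * RtoC (ln (1 - / (INR n + 2))))).
  { unfold Cpower. rewrite <- Cexp_plus. f_equal.
    rewrite !Cln_real by (apply lt_0_INR; lia).
    rewrite <- Cmult_plus_distr_l, <- RtoC_plus. do 2 f_equal.
    rewrite !S_INR.
    assert (Hi : (/ (INR n + 2) < 1)%R).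
    { rewrite <- Rinv_1. apply Rinv_lt_contravar; lra. }
    rewrite <- ln_mult by lra. f_equal. field. lra. }
  rewrite H1, (factC_S (S n)), (poch_S z (S (S n))).
  assert (H2 : 1 + z * RtoC (/ (INR n + 2)) = (z + RtoC (INR (S (S n)))) / RtoC (INR (S (S n)))).
  { rewrite !S_INR. replace (INR n + 1 + 1)%R with (INR n + 2)%R by ring.
    rewrite RtoC_inv by lra. field. apply RtoC_neq_0; lra. }
  rewrite H2. clear H1 H2.
  pose proof (poch_neq_0 z (S (S n)) Hz) as Hp.
  pose proof (add_nat_neq_0 z (S (S n)) Hz) as Hq.
  pose proof (INR_S_neq_0 (S n)) as Hr.
  generalize dependent (poch z (S (S n))). generalize dependent (RtoC (INR (S (S n)))).
  intros Q HQ1 HQ2 P HP. field. auto.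
Qed.


Lemma gap_inv_ge n : ((/ (INR n + 2)) ^ 2 <= gap_inv n)%R.
Proof.
  unfold gap_inv. pose proof (pos_INR n).
  replace (/ (INR n + 1) - / (INR n + 2))%R with (/ (INR n + 1) * / (INR n + 2))%R by (field; lra).
  simpl. rewrite Rmult_1_r. apply Rmult_le_compat_r.
  - left; apply Rinv_0_lt_compat; lra.
  - apply Rinv_le_contravar; lra.
Qed.

(** Both the sequence and its inverse satisfy the hypothesis of
    [product_converges], hence the limit cannot vanish. *)
Lemma euler_seq_converges z : ~ nonpos_int z ->
  exists l : C, l <> 0 /\ Clim eventually (euler_seq z) l.
Proof.
  intros Hz.
  destruct (add_nat_lower_bound z Hz) as [e [He Hlow]].
  set (A := Cmod z). assert (HA : (0 <= A)%R) by apply Cmod_ge_0.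
  set (K := ((1 + A) * (4 * A ^ 2 * exp A) + 2 * A + 2 * A ^ 2)%R).
  pose proof (exp_pos A) as HeA.
  assert (HA2 : (0 <= A ^ 2)%R) by apply pow2_ge_0.
  assert (HK : (0 <= K)%R) by (unfold K; assert (0 <= 4 * A ^ 2 * exp A)%R by nra; nra).
  set (sig := fun n => (1 + z * RtoC (/ (INR n + 2))) * Cexp (z * RtoC (ln (1 - / (INR n + 2))))).
  set (u := fun n => euler_seq z (S n)).
  assert (Hu : forall n, u n = u (S n) * sig n) by (intros n; now apply euler_seq_ratio).
  assert (Hu0 : forall n, u n <> 0) by (intros n; now apply euler_seq_neq_0).
  assert (Hs0 : forall n, sig n <> 0).
  { intros n E. apply (Hu0 n). rewrite Hu, E. ring. }
  assert (Hs : forall n, (Cmod (sig n - 1) <= K * gap_inv n)%R).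
  { intros n. pose proof (pos_INR n) as Hn. eapply Rle_trans.
    - apply (euler_ratio_estimate z (/ (INR n + 2))). split.
      + apply Rinv_0_lt_compat; lra.
      + apply Rinv_le_contravar; lra.
    - apply Rmult_le_compat_l; [exact HK|apply gap_inv_ge]. }
  assert (Hi : forall n, (Cmod (/ sig n) <= exp A / e)%R).
  { intros n. pose proof (pos_INR n) as Hn.
    assert (Hep : (0 < / (INR n + 2) <= / 2)%R).
    { split; [apply Rinv_0_lt_compat; lra|apply Rinv_le_contravar; lra]. }
    destruct (ln_1_minus _ Hep) as [HL _].
    rewrite Cmod_inv by apply Hs0. unfold sig. rewrite Cmod_mult.
    replace (exp A / e)%R with (/ (e * exp (- A)))%R.
    2:{ rewrite exp_Ropp. field. lra. }
    apply Rinv_le_contravar.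
    { apply Rmult_lt_0_compat; [easy|apply exp_pos]. }
    apply Rmult_le_compat; [lra|left; apply exp_pos| |].
    - replace (1 + z * RtoC (/ (INR n + 2))) with ((z + RtoC (INR (S (S n)))) * RtoC (/ (INR n + 2))).
      2:{ rewrite !S_INR. replace (INR n + 1 + 1)%R with (INR n + 2)%R by ring.
          rewrite RtoC_inv by lra. field. apply RtoC_neq_0; lra. }
      rewrite Cmod_mult, Cmod_R, Rabs_right by lra.
      apply Rmult_le_reg_r with (INR n + 2)%R; [lra|].
      rewrite Rmult_assoc, Rinv_l, Rmult_1_r by lra.
      eapply Rle_trans; [|apply Hlow]. rewrite !S_INR.
      apply Rmult_le_compat_l; lra.
    - rewrite Cmod_Cexp. apply exp_le. rewrite re_scal_r.
      pose proof (re_le_Cmod z) as Hr. fold A in Hr.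
      assert (Rabs (Re z * ln (1 - / (INR n + 2))) <= A * 1)%R.
      { rewrite Rabs_mult. apply Rmult_le_compat; try apply Rabs_pos; trivial.
        apply Rabs_le. lra. }
      pose proof (Rle_abs (- (Re z * ln (1 - / (INR n + 2))))) as Ha. rewrite Rabs_Ropp in Ha. lra. }
  destruct (product_converges u (exp A / e * K)) as [l Hl].
  { apply Rmult_le_pos; [apply Rdiv_le_0_compat; lra|easy]. }
  { intros n. replace (u (S n) - u n) with (- (/ sig n * (sig n - 1) * u n)).
    - rewrite Cmod_opp, !Cmod_mult. apply Rmult_le_compat_r; [apply Cmod_ge_0|].
      rewrite Rmult_assoc.
      apply Rmult_le_compat; try apply Cmod_ge_0; auto.
    - rewrite (Hu n). field. apply Hs0. }
  destruct (product_converges (fun n => / u n) K) as [l' Hl'].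
  { exact HK. }
  { intros n. replace (/ u (S n) - / u n) with ((sig n - 1) * / u n).
    - rewrite Cmod_mult. apply Rmult_le_compat_r; [apply Cmod_ge_0|apply Hs].
    - rewrite (Hu n). field. split; [apply Hs0|apply Hu0]. }
  exists l. split.
  - intros E. subst l.
    assert (H1 : Clim eventually (fun n => u n * / u n) (0 * l')) by now apply Clim_mult; [apply eventually_filter| |].
    assert (H2 : Clim eventually (fun n => u n * / u n) 1).
    { apply Clim_ext_loc with (fun _ => RtoC 1); [apply eventually_filter| |].
      - apply filter_forall. intros n. field. apply Hu0.
      - apply Clim_const, eventually_filter. }
    apply C1_nz. rewrite <- (Clim_unique _ _ _ _ H1 H2). ring.
  - intros eps Heps. destruct (Hl eps Heps) as [N HN].
    exists (S N). intros n Hn. destruct n as [|n]; [lia|]. apply (HN n). lia.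
Qed.

Lemma CGamma_lim z : ~ nonpos_int z -> Clim eventually (euler_seq z) (CGamma z).
Proof.
  intros Hz. destruct (euler_seq_converges z Hz) as [l [_ Hl]].
  replace (CGamma z) with l; [exact Hl|]. symmetry. exact (CLim_seq_unique _ _ Hl).
Qed.

Lemma CGamma_neq_0 z : ~ nonpos_int z -> CGamma z <> 0.
Proof.
  intros Hz. destruct (euler_seq_converges z Hz) as [l [Hl0 Hl]].
  now rewrite (Clim_unique _ _ _ _ (CGamma_lim z Hz) Hl).
Qed.

Lemma CGamma_S z : ~ nonpos_int z -> CGamma (z + 1) = z * CGamma z.
Proof.
  intros Hz. pose proof (nonpos_int_S z Hz) as Hz1.
  apply (Clim_unique eventually (euler_seq (z + 1))); [now apply CGamma_lim|].
  replace (z * CGamma z) with (1 * (z * CGamma z)) by ring.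
  apply Clim_eventually_ext with
    (fun n => (0 + RtoC (INR n)) / ((z + 1) + RtoC (INR n)) * (z * euler_seq z n)).
  - intros n Hn. unfold euler_seq.
    assert (HnR : (0 < INR n)%R) by (apply lt_0_INR; lia).
    rewrite Cpower_plus, Cpower_1 by (simpl; easy).
    pose proof (poch_shift z (S n)) as Hp.
    pose proof (poch_neq_0 z (S n) Hz) as Hp1. pose proof (poch_neq_0 (z + 1) (S n) Hz1) as Hp2.
    pose proof (add_nat_neq_0 _ n Hz1) as Hq. pose proof (nonpos_int_neq_0 z Hz) as Hz0.
    assert (E : z + RtoC (INR (S n)) = z + 1 + RtoC (INR n)) by (rewrite S_INR, RtoC_plus; ring).
    rewrite E in Hp.
    assert (Hp' : poch (z + 1) (S n) = poch z (S n) * (z + 1 + RtoC (INR n)) / z).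
    { rewrite Hp. field. easy. }
    rewrite Hp'. field. auto.
  - apply Clim_mult; [apply eventually_filter|now apply Clim_nat_ratio|].
    apply Clim_mult; [apply eventually_filter|apply Clim_const, eventually_filter|now apply CGamma_lim].
Qed.

(** The quotient of the Euler sequences of [c] and [a]. *)
Lemma poch_ratio_lim a c : ~ nonpos_int a -> ~ nonpos_int c ->
  Clim eventually (fun n => poch a (S n) / poch c (S n) * Cpower (RtoC (INR n)) (c - a))
   (CGamma c / CGamma a).
Proof.
  intros Ha Hc.
  assert (Hinv : Clim eventually (fun n => / euler_seq a n) (/ CGamma a)).
  { intros eps He. pose proof (CGamma_neq_0 a Ha) as Hg.
    pose proof (proj1 (Cmod_gt_0 _) Hg) as Hgp.
    set (G := Cmod (CGamma a)) in *.
    assert (H1 : (0 < G / 2)%R) by lra.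
    assert (H2 : (0 < eps * (G * G / 2))%R) by (apply Rmult_lt_0_compat; nra).
    generalize (filter_and _ _ (CGamma_lim a Ha _ H1) (CGamma_lim a Ha _ H2)).
    apply filter_imp. intros n [Hn1 Hn2].
    pose proof (euler_seq_neq_0 a n Ha) as Hn0.
    pose proof (Cmod_minus_ge (CGamma a) (CGamma a - euler_seq a n)) as Hm.
    replace (CGamma a - (CGamma a - euler_seq a n)) with (euler_seq a n) in Hm by ring.
    rewrite (Cmod_sub_sym (CGamma a)) in Hm. fold G in Hm.
    replace (/ euler_seq a n - / CGamma a) with (- ((euler_seq a n - CGamma a) / (euler_seq a n * CGamma a)))
      by (field; auto).
    rewrite Cmod_opp, Cmod_div, Cmod_mult by now apply Cmult_neq_0. fold G.
    assert (Hge : (G * G / 2 <= Cmod (euler_seq a n) * G)%R) by nra.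
    apply Rmult_le_reg_r with (Cmod (euler_seq a n) * G)%R; [nra|].
    replace (Cmod (euler_seq a n - CGamma a) / (Cmod (euler_seq a n) * G) * (Cmod (euler_seq a n) * G))%R
      with (Cmod (euler_seq a n - CGamma a)) by (field; nra).
    eapply Rle_trans; [exact Hn2|]. apply Rmult_le_compat_l; lra. }
  apply Clim_eventually_ext with (fun n => euler_seq c n * / euler_seq a n).
  - intros n Hn. unfold euler_seq, Cminus. rewrite Cpower_plus, Cpower_opp.
    pose proof (poch_neq_0 a (S n) Ha). pose proof (poch_neq_0 c (S n) Hc).
    pose proof (factC_neq_0 n). pose proof (Cpower_neq_0 (RtoC (INR n)) a).
    field. auto.
  - apply Clim_mult; [apply eventually_filter|now apply CGamma_lim|exact Hinv].
Qed.


(** * Integrals of complex functions over the unit interval *)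

Definition CInt (h : R -> C) : C :=
  (RInt (fun v => Re (h v)) 0 1, RInt (fun v => Im (h v)) 0 1).

Lemma Ccont_ex_RInt h : Ccont h ->
  ex_RInt (fun v => Re (h v)) 0 1 /\ ex_RInt (fun v => Im (h v)) 0 1.
Proof.
  intros H; split; apply (ex_RInt_continuous (V := R_CompleteNormedModule));
  intros v _; apply H.
Qed.

Lemma is_RInt_CInt h : Ccont h ->
  is_RInt (fun v => Re (h v)) 0 1 (Re (CInt h)) /\ is_RInt (fun v => Im (h v)) 0 1 (Im (CInt h)).
Proof.
  intros H; destruct (Ccont_ex_RInt h H) as [H1 H2].
  split; apply (RInt_correct (V := R_CompleteNormedModule)); assumption.
Qed.

Lemma CInt_unique h l : 
  is_RInt (fun v => Re (h v)) 0 1 (Re l) -> is_RInt (fun v => Im (h v)) 0 1 (Im l) -> CInt h = l.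
Proof.
  intros H1 H2. apply C_eq; unfold CInt, Re at 1, Im at 1; cbn [fst snd].
  - exact (is_RInt_unique _ _ _ _ H1).
  - exact (is_RInt_unique _ _ _ _ H2).
Qed.

Lemma CInt_plus f g : Ccont f -> Ccont g -> CInt (fun v => f v + g v) = CInt f + CInt g.
Proof.
  intros Hf Hg. destruct (is_RInt_CInt f Hf) as [H1 H2], (is_RInt_CInt g Hg) as [H3 H4].
  apply CInt_unique.
  - exact (is_RInt_plus _ _ _ _ _ _ H1 H3).
  - exact (is_RInt_plus _ _ _ _ _ _ H2 H4).
Qed.

Lemma CInt_scal k f : Ccont f -> CInt (fun v => k * f v) = k * CInt f.
Proof.
  intros Hf. destruct (is_RInt_CInt f Hf) as [H1 H2].
  apply CInt_unique.
  - exact (is_RInt_minus _ _ _ _ _ _ (is_RInt_scal _ _ _ (Re k) _ H1) (is_RInt_scal _ _ _ (Im k) _ H2)).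
  - exact (is_RInt_plus _ _ _ _ _ _ (is_RInt_scal _ _ _ (Re k) _ H2) (is_RInt_scal _ _ _ (Im k) _ H1)).
Qed.

Lemma CInt_ext f g : (forall v, (0 <= v <= 1)%R -> f v = g v) -> CInt f = CInt g.
Proof.
  intros H. apply C_eq.
  - change (RInt (fun v => Re (f v)) 0 1 = RInt (fun v => Re (g v)) 0 1).
    apply RInt_ext. rewrite Rmin_left, Rmax_right by lra. intros x Hx. now rewrite H by lra.
  - change (RInt (fun v => Im (f v)) 0 1 = RInt (fun v => Im (g v)) 0 1).
    apply RInt_ext. rewrite Rmin_left, Rmax_right by lra. intros x Hx. now rewrite H by lra.
Qed.

Lemma is_RInt_const_unit (c : R) : is_RInt (fun _ : R => c) 0 1 c.
Proof.
  pose proof (is_RInt_const (V := R_NormedModule) 0 1 c) as H.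
  change (is_RInt (fun _ : R => c) 0 1 ((1 - 0) * c)%R) in H.
  now replace ((1 - 0) * c)%R with c in H by ring.
Qed.

(** Projection on the direction of the integral, as in [mean_value_le]. *)
Lemma Cmod_CInt_le f g M : Ccont f -> is_RInt g 0 1 M ->
  (forall v, (0 <= v <= 1)%R -> (Cmod (f v) <= g v)%R) -> (Cmod (CInt f) <= M)%R.
Proof.
  intros Hf Hg H.
  pose proof (CInt_scal (Cconj (CInt f)) f Hf) as Hd.
  set (d := CInt f) in *.
  assert (Hc : Ccont (fun v => Cconj d * f v)) by (apply Ccont_mult; [apply Ccont_const|exact Hf]).
  destruct (is_RInt_CInt _ Hc) as [H1 _]. rewrite Hd, Cconj_mod2 in H1.
  assert (Hle : (Cmod d * Cmod d <= Cmod d * M)%R).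
  { refine (is_RInt_le _ _ 0 1 _ _ Rle_0_1 H1 (is_RInt_scal _ _ _ (Cmod d) _ Hg) _).
    intros v Hv. eapply Rle_trans; [apply Rle_abs|]. eapply Rle_trans; [apply re_le_Cmod|].
    rewrite Cmod_mult, Cmod_conj. apply Rmult_le_compat_l; [apply Cmod_ge_0|apply H; lra]. }
  destruct (Cmod_ge_0 d) as [Hp|Hp]; [nra|].
  rewrite <- Hp.
  refine (is_RInt_le _ _ 0 1 _ _ Rle_0_1 (is_RInt_const_unit 0) Hg _).
  intros v Hv. eapply Rle_trans; [apply Cmod_ge_0|apply H; lra].
Qed.

Lemma CInt_derive F f : (forall v, is_Cderive F v (f v)) -> Ccont f -> CInt f = F 1%R - F 0%R.
Proof.
  intros HF Hf. apply CInt_unique.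
  - apply (is_RInt_derive (fun v => Re (F v))); intros v _; [apply HF|apply Hf].
  - apply (is_RInt_derive (fun v => Im (F v))); intros v _; [apply HF|apply Hf].
Qed.

(** * The Beta functional *)

(** Substituting [t = v ^ p] with [p] large turns the density
    [t ^ (a - 1) (1 - t) ^ (b - 1)], which may be singular at [t = 0], into a
    continuous one. *)
Definition beta_weight (p : nat) (a b : C) (v : R) : C :=
  RtoC (INR p) * rpow v (RtoC (INR p) * a - 1) * rpow (1 - v ^ p) (b - 1).

Definition beta_int (p : nat) (a b : C) (g : R -> C) : C :=
  CInt (fun v => beta_weight p a b v * g (v ^ p)%R).

(** The thresholds make both exponents of the weight have real part at least
    [2], where [rpow] is differentiable; [3 <= p] does the same for [a = 1], with
    which a general [a] is compared. *)
Definition beta_admissible (p : nat) (a b : C) : Prop :=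
  (3 <= p)%nat /\ (3 <= INR p * Re a)%R /\ (3 <= Re b)%R.

Lemma is_derive_pow_S p v : is_derive (fun v => v ^ S p)%R v (INR (S p) * v ^ p)%R.
Proof.
  replace (INR (S p) * v ^ p)%R with (INR (S p) * 1 * v ^ p)%R by ring.
  apply (is_derive_pow (fun t => t) (S p) v 1%R). apply @is_derive_id.
Qed.

Lemma continuous_pow p v : continuous (fun v : R => (v ^ p)%R) v.
Proof.
  destruct p as [|p]; [apply continuous_const|].
  apply @ex_derive_continuous. eexists. apply is_derive_pow_S.
Qed.

Lemma continuous_1_pow p v : continuous (fun v : R => (1 - v ^ p)%R) v.
Proof.
  apply (continuous_minus (V := R_NormedModule)); [apply continuous_const|apply continuous_pow].
Qed.

Lemma Ccont_beta_weight p a b : beta_admissible p a b -> Ccont (beta_weight p a b).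
Proof.
  intros [Hp [Ha Hb]]. unfold beta_weight. apply Ccont_mult; [apply Ccont_mult|].
  - apply Ccont_const.
  - apply Ccont_rpow. rewrite re_minus, re_scal_l. simpl. lra.
  - apply (Ccont_comp (fun x => rpow x (b - 1))); [|apply continuous_1_pow].
    apply Ccont_rpow. rewrite re_minus. simpl. lra.
Qed.

Lemma Ccont_beta_integrand p a b g : beta_admissible p a b -> Ccont g ->
  Ccont (fun v => beta_weight p a b v * g (v ^ p)%R).
Proof.
  intros H Hg. apply Ccont_mult; [now apply Ccont_beta_weight|].
  apply (Ccont_comp g); [exact Hg|apply continuous_pow].
Qed.

Lemma pow_unit_interval p v : (0 <= v <= 1)%R -> (0 <= v ^ p <= 1)%R.
Proof.
  intros Hv. split; [apply pow_le; lra|].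
  rewrite <- (pow1 p). apply pow_incr; lra.
Qed.

Lemma beta_int_ext p a b f g : (forall t, (0 <= t <= 1)%R -> f t = g t) ->
  beta_int p a b f = beta_int p a b g.
Proof.
  intros H. apply CInt_ext. intros v Hv. rewrite H; [easy|now apply pow_unit_interval].
Qed.

Lemma beta_int_plus p a b f g : beta_admissible p a b -> Ccont f -> Ccont g ->
  beta_int p a b (fun t => f t + g t) = beta_int p a b f + beta_int p a b g.
Proof.
  intros H Hf Hg. unfold beta_int.
  rewrite <- CInt_plus by now apply Ccont_beta_integrand.
  apply CInt_ext. intros v _. ring.
Qed.

Lemma beta_int_scal p a b k f : beta_admissible p a b -> Ccont f ->
  beta_int p a b (fun t => k * f t) = k * beta_int p a b f.
Proof.
  intros H Hf. unfold beta_int.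
  rewrite <- CInt_scal by now apply Ccont_beta_integrand.
  apply CInt_ext. intros v _. ring.
Qed.

Lemma beta_int_minus p a b f g : beta_admissible p a b -> Ccont f -> Ccont g ->
  beta_int p a b (fun t => f t - g t) = beta_int p a b f - beta_int p a b g.
Proof.
  intros H Hf Hg.
  replace (beta_int p a b f - beta_int p a b g) with
    (beta_int p a b f + (- (1)) * beta_int p a b g) by ring.
  rewrite <- (beta_int_scal p a b _ g) by easy.
  rewrite <- beta_int_plus; try easy.
  - apply beta_int_ext. intros t _. ring.
  - apply Ccont_mult; [apply Ccont_const|easy].
Qed.

(** Maximise [x ^ Q exp (- x / 2)] with [x = s u]: the maximum is at [x = 2 Q]. *)
Lemma Rpower_exp_bound Q : (0 < Q)%R -> exists K, (0 < K)%R /\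
  forall s u, (0 < s)%R -> (0 < u)%R ->
   (exp (Q * ln u) * exp (- (s * u)) <= K * Rpower s (- Q) * exp (- (s * u) / 2))%R.
Proof.
  intros HQ. exists (exp (Q * (ln (2 * Q) - 1))). split; [apply exp_pos|].
  intros s u Hs Hu. unfold Rpower. rewrite <- !exp_plus. apply exp_le.
  assert (Hx : (0 < s * u)%R) by now apply Rmult_lt_0_compat.
  assert (Hl : (ln (s * u) = ln s + ln u)%R) by now apply ln_mult.
  assert (Hy : (0 < s * u / (2 * Q))%R) by (apply Rdiv_lt_0_compat; lra).
  pose proof (exp_ineq1_le (ln (s * u / (2 * Q)))) as H. rewrite exp_ln in H by easy.
  rewrite ln_div in H by lra. rewrite Hl in H.
  assert (H2 : (Q * (1 + (ln s + ln u - ln (2 * Q))) <= s * u / 2)%R).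
  { apply Rle_trans with (Q * (s * u / (2 * Q)))%R; [apply Rmult_le_compat_l; lra|].
    apply Req_le; field; lra. }
  lra.
Qed.

Lemma Cmod_rpow_left p a v : (0 <= v <= 1)%R -> (3 <= INR p * Re a)%R ->
  (Cmod (rpow v (RtoC (INR p) * a - 1)) <= 1)%R.
Proof.
  intros Hv Ha. apply Cmod_rpow_le_1; [lra|]. rewrite re_minus, re_scal_l. simpl. lra.
Qed.

(** The integrand concentrates at [t = 1]; by [1 - v ^ p >= 1 - v] the
    substitution [t = v ^ p] does not spoil the exponential decay. *)
Lemma laplace_bound p b k : (1 <= p)%nat -> (1 < Re b)%R -> exists K, (0 < K)%R /\
  forall s M h, (0 < s)%R -> (0 <= M)%R -> Ccont h ->
   (forall v, (0 <= v <= 1)%R -> (Cmod (h v) <=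
      M * (Cmod (rpow (1 - v ^ p) (b - 1)) * ((1 - v ^ p) ^ k * exp (- (s * (1 - v ^ p))))))%R) ->
   (Cmod (CInt h) <= K * M * Rpower s (- (Re b + INR k)))%R.
Proof.
  intros Hp Hb. pose proof (pos_INR k) as Hk.
  set (Q := (Re b - 1 + INR k)%R).
  destruct (Rpower_exp_bound Q) as [K0 [HK0 HK]]; [unfold Q; lra|].
  exists (K0 * 2)%R. split; [lra|].
  intros s M h Hs HM Hh Hle.
  set (W := (M * K0 * Rpower s (- Q))%R).
  assert (HW : (0 <= W)%R).
  { unfold W. repeat apply Rmult_le_pos; try lra. left; apply exp_pos. }
  assert (HI : is_RInt (fun v => (W * exp (- (s * (1 - v)) / 2))%R) 0 1
      (W * (2 / s) - W * (2 / s) * exp (- s / 2))%R).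
  { replace (W * (2 / s) - W * (2 / s) * exp (- s / 2))%R with
     (minus ((fun v => W * (2 / s) * exp (- (s * (1 - v)) / 2))%R 1%R)
            ((fun v => W * (2 / s) * exp (- (s * (1 - v)) / 2))%R 0%R)).
    2:{ unfold minus, plus, opp; simpl.
        replace (- (s * (1 - 1)) / 2)%R with 0%R by field.
        replace (- (s * (1 - 0)) / 2)%R with (- s / 2)%R by field.
        rewrite exp_0. ring. }
    apply (is_RInt_derive (fun v => W * (2 / s) * exp (- (s * (1 - v)) / 2))%R).
    - intros v _. auto_derive; trivial.
      change (- (s * (1 - v)) / 2)%R with (- (s * (1 - v)) * / 2)%R.
      replace (1 + - v)%R with (1 - v)%R by ring.
      generalize (exp (- (s * (1 - v)) * / 2)). intros; field; lra.
    - intros v _. apply @ex_derive_continuous. auto_derive. trivial. }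
  apply Rle_trans with (W * (2 / s) - W * (2 / s) * exp (- s / 2))%R.
  2:{ apply Rle_trans with (W * (2 / s))%R.
      - assert (0 <= W * (2 / s) * exp (- s / 2))%R.
        { apply Rmult_le_pos; [|left; apply exp_pos].
          apply Rmult_le_pos; [easy|]. left. apply Rdiv_lt_0_compat; lra. }
        lra.
      - apply Req_le. unfold W.
        replace (- (Re b + INR k))%R with (- Q + - (1))%R by (unfold Q; ring).
        rewrite Rpower_plus, (Rpower_Ropp s 1), Rpower_1 by easy. field. lra. }
  apply Cmod_CInt_le with (fun v => (W * exp (- (s * (1 - v)) / 2))%R); [exact Hh|exact HI|].
  intros v Hv. pose proof (pow_unit_interval p v Hv) as Ht.
  specialize (Hle v Hv). set (t := (v ^ p)%R) in *.
  eapply Rle_trans; [exact Hle|].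
  pose proof (exp_pos (- (s * (1 - v)) / 2)) as Hexp.
  destruct (Rlt_dec 0 (1 - t)) as [Hu|Hu].
  - rewrite (Cmod_rpow (1 - t)) by easy.
    replace (Re (b - 1)) with (Re b - 1)%R by (rewrite re_minus; simpl; ring).
    assert (Hvp : (t <= v)%R).
    { unfold t. destruct p as [|p']; [lia|]. simpl.
      pose proof (pow_unit_interval p' v Hv). nra. }
    assert (Hpk : ((1 - t) ^ k = exp (INR k * ln (1 - t)))%R) by (now rewrite <- Rpower_pow).
    rewrite Hpk.
    replace (exp ((Re b - 1) * ln (1 - t)) * (exp (INR k * ln (1 - t)) * exp (- (s * (1 - t)))))%R
      with (exp (Q * ln (1 - t)) * exp (- (s * (1 - t))))%R.
    2:{ replace (Q * ln (1 - t))%R with ((Re b - 1) * ln (1 - t) + INR k * ln (1 - t))%R by (unfold Q; ring).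
        rewrite exp_plus. ring. }
    specialize (HK s (1 - t)%R Hs Hu). unfold W.
    replace (M * K0 * Rpower s (- Q) * exp (- (s * (1 - v)) / 2))%R with
      (M * (K0 * Rpower s (- Q) * exp (- (s * (1 - v)) / 2)))%R by ring.
    apply Rmult_le_compat_l; [easy|].
    eapply Rle_trans; [exact HK|].
    apply Rmult_le_compat_l; [apply Rmult_le_pos; [lra|left; apply exp_pos]|].
    apply exp_le. nra.
  - rewrite (rpow_nonpos (1 - t)) by lra.
    rewrite Cmod_0. nra.
Qed.

Lemma beta_int_bound p a b k : beta_admissible p a b -> exists K, (0 < K)%R /\
  forall s M g, (0 < s)%R -> (0 <= M)%R -> Ccont g ->
   (forall t, (0 <= t <= 1)%R -> (Cmod (g t) <= M * ((1 - t) ^ k * exp (- (s * (1 - t)))))%R) ->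
   (Cmod (beta_int p a b g) <= K * M * Rpower s (- (Re b + INR k)))%R.
Proof.
  intros H. pose proof H as [Hp [Ha Hb]].
  assert (HpR : (0 < INR p)%R) by (apply lt_0_INR; lia).
  destruct (laplace_bound p b k) as [K [HK HL]]; [lia|lra|].
  exists (K * INR p)%R. split; [now apply Rmult_lt_0_compat|].
  intros s M g Hs HM Hg Hle.
  replace (K * INR p * M)%R with (K * (INR p * M))%R by ring.
  apply HL; trivial.
  - apply Rmult_le_pos; lra.
  - now apply Ccont_beta_integrand.
  - intros v Hv. specialize (Hle _ (pow_unit_interval p v Hv)).
    unfold beta_weight. rewrite !Cmod_mult, Cmod_nat.
    pose proof (Cmod_rpow_left p a v Hv Ha) as H1.
    pose proof (Cmod_ge_0 (rpow (1 - v ^ p) (b - 1))) as H2.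
    pose proof (Cmod_ge_0 (rpow v (RtoC (INR p) * a - 1))) as H3.
    eapply Rle_trans; [apply Rmult_le_compat_l; [|exact Hle]|].
    + apply Rmult_le_pos; [apply Rmult_le_pos; lra|easy].
    + set (E := (M * ((1 - v ^ p) ^ k * exp (- (s * (1 - v ^ p)))))%R) in *.
      assert (HE : (0 <= E)%R) by (eapply Rle_trans; [apply Cmod_ge_0|exact Hle]).
      apply Rle_trans with (INR p * 1 * Cmod (rpow (1 - v ^ p) (b - 1)) * E)%R.
      * apply Rmult_le_compat_r; [easy|]. apply Rmult_le_compat_r; [easy|].
        apply Rmult_le_compat_l; lra.
      * unfold E. apply Req_le. ring.
Qed.

Lemma beta_int_sup p a b M g : beta_admissible p a b -> Ccont g ->
  (forall t, (0 <= t <= 1)%R -> (Cmod (g t) <= M)%R) ->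
  (Cmod (beta_int p a b g) <= INR p * M)%R.
Proof.
  intros H Hg Hle. pose proof H as [Hp [Ha Hb]].
  assert (HpR : (0 < INR p)%R) by (apply lt_0_INR; lia).
  apply Cmod_CInt_le with (fun _ => (INR p * M)%R).
  - now apply Ccont_beta_integrand.
  - apply is_RInt_const_unit.
  - intros v Hv. pose proof (pow_unit_interval p v Hv) as Ht.
    rewrite Cmod_mult. apply Rmult_le_compat; try apply Cmod_ge_0; [|now apply Hle].
    unfold beta_weight. rewrite !Cmod_mult, Cmod_nat.
    pose proof (Cmod_rpow_left p a v Hv Ha).
    assert (Cmod (rpow (1 - v ^ p) (b - 1)) <= 1)%R.
    { apply Cmod_rpow_le_1; [lra|]. rewrite re_minus. simpl. lra. }
    pose proof (Cmod_ge_0 (rpow v (RtoC (INR p) * a - 1))).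
    pose proof (Cmod_ge_0 (rpow (1 - v ^ p) (b - 1))).
    rewrite Rmult_assoc. apply Rle_trans with (INR p * 1)%R; [|lra].
    apply Rmult_le_compat_l; [lra|nra].
Qed.

(** Integration by parts against [t ^ a (1 - t) ^ b], which vanishes at both
    ends. *)
Lemma beta_int_by_parts p a b phi phi' : beta_admissible p a b ->
  (forall t, is_Cderive phi t (phi' t)) -> Ccont phi' ->
  beta_int p a b (fun t => a * (RtoC (1 - t) * phi t) + RtoC (t * (1 - t)) * phi' t
     - b * (RtoC t * phi t)) = 0.
Proof.
  intros H Hphi Hc. pose proof H as [Hp [Ha Hb]].
  destruct p as [|p]; [lia|].
  set (F := fun v => rpow v (RtoC (INR (S p)) * a) * phi (v ^ S p)%R * rpow (1 - v ^ S p) b).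
  unfold beta_int.
  assert (Hphic : Ccont phi) by (apply Cderive_cont; intros t; eexists; apply Hphi).
  assert (HRt : forall f : R -> R, (forall t, continuous f t) -> Ccont (fun t => RtoC (f t))).
  { intros f Hf s. split; [apply Hf|apply continuous_const]. }
  rewrite (CInt_derive F).
  - unfold F. rewrite (rpow_nonpos 0) by lra. rewrite pow1. rewrite (rpow_nonpos (1 - 1)) by lra. ring.
  - intros v. unfold F.
    assert (H1 : is_Cderive (fun v => rpow v (RtoC (INR (S p)) * a)) v
       (RtoC (INR (S p)) * a * rpow v (RtoC (INR (S p)) * a - 1))).
    { apply Cderive_rpow. rewrite re_scal_l. lra. }
    assert (H2 : is_Cderive (fun v => phi (v ^ S p)%R) v (RtoC (INR (S p) * v ^ p) * phi' (v ^ S p)%R)).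
    { apply (Cderive_comp_real phi); [apply is_derive_pow_S|apply Hphi]. }
    assert (H3 : is_Cderive (fun v => rpow (1 - v ^ S p) b) v
       (RtoC (- (INR (S p) * v ^ p)) * (b * rpow (1 - v ^ S p) (b - 1)))).
    { apply (Cderive_comp_real (fun x => rpow x b) (fun v => (1 - v ^ S p)%R)).
      - replace (- (INR (S p) * v ^ p))%R with (0 - INR (S p) * v ^ p)%R by ring.
        apply (is_derive_minus (fun _ : R => 1%R) (fun v : R => (v ^ S p)%R)).
        + apply @is_derive_const.
        + apply is_derive_pow_S.
      - apply Cderive_rpow. lra. }
    eapply Cderive_eq; [exact (Cderive_mult _ _ _ _ _ (Cderive_mult _ _ _ _ _ H1 H2) H3)|].
    cbv beta. unfold beta_weight.
    rewrite (rpow_S v (RtoC (INR (S p)) * a)), (rpow_S (1 - v ^ S p) b).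
    assert (Ht : RtoC (v ^ S p) = RtoC v * RtoC (v ^ p)) by exact (RtoC_mult v (v ^ p)).
    rewrite !RtoC_opp, !RtoC_mult, !RtoC_minus, Ht.
    generalize (rpow v (RtoC (INR (S p)) * a - 1)) (rpow (1 - v ^ S p) (b - 1))
      (phi (v ^ S p)%R) (phi' (v ^ S p)%R) (RtoC (INR (S p))) (RtoC v) (RtoC (v ^ p)).
    intros; ring.
  - refine (Ccont_beta_integrand (S p) a b (fun t => a * (RtoC (1 - t) * phi t) + RtoC (t * (1 - t)) * phi' t
     - b * (RtoC t * phi t)) H _).
    apply Ccont_plus; [apply Ccont_plus|].
    + apply Ccont_mult; [apply Ccont_const|]. apply Ccont_mult; [|exact Hphic].
      apply HRt. intros t. apply (continuous_minus (V := R_NormedModule)); [apply continuous_const|apply continuous_id].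
    + apply Ccont_mult; [|exact Hc]. apply HRt. intros t.
      apply (continuous_mult (K := R_AbsRing)); [apply continuous_id|].
      apply (continuous_minus (V := R_NormedModule)); [apply continuous_const|apply continuous_id].
    + apply Ccont_ext with (fun t => (- (1)) * (b * (RtoC t * phi t))); [intros t; ring|].
      apply Ccont_mult; [apply Ccont_const|]. apply Ccont_mult; [apply Ccont_const|].
      apply Ccont_mult; [|exact Hphic]. apply HRt. intros t. apply continuous_id.
Qed.


Lemma Re_add_pos_nonpos_int p a b : beta_admissible p a b -> (0 < Re a)%R -> ~ nonpos_int (a + b).
Proof. intros [_ [_ Hb]] Ha. apply Re_pos_nonpos_int. rewrite re_plus. lra. Qed.

(** Integration by parts against [t ^ n]. *)
Lemma beta_moment_S p a b n : beta_admissible p a b ->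
  (a + RtoC (INR n)) * beta_int p a b (fun t => RtoC t ^ n) =
  (a + b + RtoC (INR n)) * beta_int p a b (fun t => RtoC t ^ S n).
Proof.
  intros H.
  set (phi' := fun t : R => match n with O => RtoC 0 | S k => RtoC (INR (S k)) * RtoC t ^ k end).
  assert (HD : forall t, is_Cderive (fun t => RtoC t ^ n) t (phi' t)).
  { intros t. unfold phi'. destruct n as [|k].
    - exact (Cderive_const 1 t).
    - eapply Cderive_eq; [exact (Cderive_pow _ _ _ k (Cderive_id t))|apply Cmult_1_r]. }
  assert (Hc : Ccont phi') by (unfold phi'; destruct n as [|k]; ccont).
  pose proof (beta_int_by_parts p a b _ _ H HD Hc) as HI.
  assert (Ht : forall t, RtoC t * phi' t = RtoC (INR n) * RtoC t ^ n).
  { intros t. unfold phi'. destruct n as [|k]; [simpl; ring|].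
    rewrite Cpow_S. ring. }
  rewrite (beta_int_ext p a b _ (fun t => (a + RtoC (INR n)) * RtoC t ^ n
     - (a + b + RtoC (INR n)) * RtoC t ^ S n)) in HI.
  - rewrite beta_int_minus, !beta_int_scal in HI by (try easy; ccont).
    apply Ceq_minus. exact HI.
  - intros t _. rewrite RtoC_mult, RtoC_minus, Cpow_S.
    replace (RtoC t * (1 - RtoC t) * phi' t) with ((1 - RtoC t) * (RtoC t * phi' t)) by ring.
    rewrite Ht. ring.
Qed.

Lemma beta_moment p a b n : beta_admissible p a b -> (0 < Re a)%R ->
  beta_int p a b (fun t => RtoC t ^ n) =
  poch a n / poch (a + b) n * beta_int p a b (fun _ => 1).
Proof.
  intros H Ha. pose proof (Re_add_pos_nonpos_int p a b H Ha) as Hab.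
  induction n as [|n IH].
  - simpl. field.
  - pose proof (beta_moment_S p a b n H) as HS. rewrite IH in HS.
    pose proof (add_nat_neq_0 _ n Hab) as Hn. pose proof (poch_neq_0 _ n Hab) as Hpn.
    replace (beta_int p a b (fun t => RtoC t ^ S n)) with
      ((a + b + RtoC (INR n)) * beta_int p a b (fun t => RtoC t ^ S n) / (a + b + RtoC (INR n)))
      by (field; easy).
    rewrite <- HS, !poch_S. field. auto.
Qed.

(** * Moments and generating functions *)

(** The coefficients of the [j]-th derivative of the generating function of
    [(a)_(m+n) / (c)_n]. *)
Definition poch_ratio (a c : C) (m j n : nat) : C := poch a (m + n + j) / poch c (n + j).

Lemma geom_bounded_poch_ratio a c m j : ~ nonpos_int c -> geom_bounded (poch_ratio a c m j).
Proof.
  intros Hc.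
  destruct (add_nat_ratio_bound (a + RtoC (INR (m + j))) _ (nonpos_int_add c j Hc)) as [D HD].
  apply geom_bounded_ratio with (2 := HD).
  intros n. unfold poch_ratio.
  replace (m + S n + j)%nat with (S (m + n + j)) by lia.
  change (S n + j)%nat with (S (n + j)). rewrite !poch_S.
  pose proof (poch_neq_0 c (n + j) Hc). pose proof (add_nat_neq_0 _ n (nonpos_int_add c j Hc)) as Hn.
  rewrite !plus_INR, !RtoC_plus.
  assert (c + (RtoC (INR n) + RtoC (INR j)) <> 0).
  { intros E. apply Hn. rewrite <- Cplus_assoc, (Cplus_comm (RtoC (INR j))). exact E. }
  field. auto.
Qed.

Lemma beta_int_Csum p a b (u : nat -> R -> C) N : beta_admissible p a b -> (forall n, Ccont (u n)) ->
  beta_int p a b (fun t => Csum (fun n => u n t) N) = Csum (fun n => beta_int p a b (u n)) N.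
Proof.
  intros H Hu. induction N as [|N IH]; simpl.
  - transitivity (0 * beta_int p a b (fun _ => 1)); [|ring].
    rewrite <- beta_int_scal by (try easy; ccont). apply beta_int_ext. intros t _; ring.
  - rewrite <- IH. apply beta_int_plus; trivial. now apply Ccont_Csum.
Qed.

(** The Taylor remainder of the exponential is uniform on [[0, 1]], so the
    exponential series may be integrated term by term. *)
Lemma beta_int_exp p a b j z : beta_admissible p a b -> (0 < Re a)%R ->
  beta_int p a b (fun t => RtoC t ^ j * Cexp (z * RtoC t)) =
  beta_int p a b (fun _ => 1) * egf (poch_ratio a (a + b) 0 j) z.
Proof.
  intros H Ha. pose proof (Re_add_pos_nonpos_int p a b H Ha) as Hab.
  set (B := beta_int p a b (fun _ => 1)).
  set (u := fun n : nat => B * (poch_ratio a (a + b) 0 j n * (z ^ n / factC n))).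
  apply (Clim_unique eventually (Csum u)).
  - apply Clim_squeeze with (fun N => (INR p * exp (Cmod z) * (Cmod z ^ N / INR (fact N)))%R).
    + intros N.
      assert (Hu : Csum u N = beta_int p a b (fun t => Csum (fun n => RtoC t ^ j * ((z * RtoC t) ^ n / factC n)) N)).
      { rewrite (beta_int_Csum p a b (fun n t => RtoC t ^ j * ((z * RtoC t) ^ n / factC n))); trivial.
        2:{ intros n. unfold Cdiv. ccont. }
        apply Csum_ext. intros n. unfold u.
        rewrite (beta_int_ext p a b _ (fun t => (z ^ n / factC n) * RtoC t ^ (n + j))).
        - rewrite beta_int_scal, beta_moment by (try easy; ccont).
          unfold poch_ratio, B. simpl (0 + n)%nat. ring.
        - intros t _. rewrite Cpow_mult_l, Cpow_add_r. unfold Cdiv; ring. }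
      rewrite Hu, Cmod_sub_sym, <- beta_int_minus; trivial.
      2,3: unfold Cdiv; ccont.
      2:{ apply Ccont_Csum. intros n. unfold Cdiv; ccont. }
      rewrite (Rmult_assoc (INR p)).
      apply beta_int_sup; trivial.
      * unfold Cdiv; ccont. apply (Ccont_Csum (fun n t => RtoC t ^ j * ((z * RtoC t) ^ n * / factC n))).
        intros n; ccont.
      * intros t Ht.
        replace (RtoC t ^ j * Cexp (z * RtoC t) - Csum (fun n => RtoC t ^ j * ((z * RtoC t) ^ n / factC n)) N)
          with (RtoC t ^ j * (Cexp (z * RtoC t) - Csum (fun n => (z * RtoC t) ^ n / factC n) N)).
        2:{ assert (E : forall k (v : nat -> C) M, Csum (fun n => k * v n) M = k * Csum v M).
            { intros k v M. induction M as [|M IH]; simpl; [ring|rewrite IH; ring]. }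
            rewrite E. ring. }
        rewrite Cmod_mult, Cmod_pow, Cmod_R, Rabs_right by lra.
        pose proof (pow_unit_interval j t Ht) as Hj.
        eapply Rle_trans; [apply Rmult_le_compat; [lra|apply Cmod_ge_0|apply Hj|apply Cexp_taylor]|].
        rewrite Rmult_1_l, Cmod_mult, Cmod_R, Rabs_right by lra.
        rewrite (Rmult_comm (exp _)).
        pose proof (Cmod_ge_0 z) as Hz. pose proof (INR_fact_lt_0 N) as Hf.
        apply Rmult_le_compat.
        -- apply Rdiv_le_0_compat; [apply pow_le; nra|easy].
        -- left; apply exp_pos.
        -- apply Rmult_le_compat_r; [left; now apply Rinv_0_lt_compat|]. apply pow_incr. nra.
        -- apply exp_le. nra.
    + replace (Finite 0) with (Rbar_mult (INR p * exp (Cmod z))%R 0%R) by (simpl; f_equal; ring).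
      apply (is_lim_seq_scal_l (fun N => (Cmod z ^ N / INR (fact N))%R)). apply ex_series_lim_0. eexists; apply is_series_exp.
  - apply Csum_lim. apply is_Cseries_scal, is_Cseries_egf. now apply geom_bounded_poch_ratio.
Qed.


(** * The Laplace integral of the Beta functional *)

Definition beta_laplace (p : nat) (a b : C) (k : nat) (z : C) : C :=
  beta_int p a b (fun t => RtoC (1 - t) ^ k * Cexp (- (z * RtoC (1 - t)))).

Lemma Ccont_kernel k z : Ccont (fun t => RtoC (1 - t) ^ k * Cexp (- (z * RtoC (1 - t)))).
Proof. ccont. Qed.

Lemma Cmod_Cexp_kernel z t : Cmod (Cexp (- (z * RtoC (1 - t)))) = exp (- (Re z * (1 - t))).
Proof. rewrite Cmod_Cexp, re_opp, re_scal_r. reflexivity. Qed.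

Lemma Cmod_pow_one_minus k t : (0 <= t <= 1)%R -> Cmod (RtoC (1 - t) ^ k) = ((1 - t) ^ k)%R.
Proof. intros Ht. rewrite Cmod_pow, Cmod_R, Rabs_right by lra. reflexivity. Qed.

Lemma beta_laplace_bound p a b k : beta_admissible p a b -> exists K, (0 < K)%R /\
  forall z, (0 < Re z)%R -> (Cmod (beta_laplace p a b k z) <= K * Rpower (Re z) (- (Re b + INR k)))%R.
Proof.
  intros H. destruct (beta_int_bound p a b k H) as [K [HK HB]].
  exists K. split; [easy|]. intros z Hz.
  rewrite <- (Rmult_1_r K). apply HB; trivial; [lra|apply Ccont_kernel|].
  intros t Ht. rewrite Cmod_mult, Cmod_Cexp_kernel, Cmod_pow_one_minus by easy. lra.
Qed.

(** This combination is what survives in the derivative of [z ^ b * beta_laplace 0 z]: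
    integration by parts cancels the leading order. *)
Lemma beta_laplace_relation p a b z : beta_admissible p a b ->
  b * beta_laplace p a b 0 z - z * beta_laplace p a b 1 z = (a + b) * beta_laplace p a b 1 z - z * beta_laplace p a b 2 z.
Proof.
  intros H.
  assert (HD : forall t, is_Cderive (fun t => Cexp (- (z * RtoC (1 - t)))) t (z * Cexp (- (z * RtoC (1 - t))))).
  { intros t. apply (Cderive_Cexp (fun t => - (z * RtoC (1 - t)))).
    eapply Cderive_eq; [apply Cderive_ext with (fun t => z * RtoC t - z)|].
    - intros s. rewrite RtoC_minus. ring.
    - apply Cderive_minus; [apply Cderive_scal, Cderive_id|apply Cderive_const].
    - ring. }
  assert (Hc : Ccont (fun t => z * Cexp (- (z * RtoC (1 - t))))) by ccont.
  pose proof (beta_int_by_parts p a b _ _ H HD Hc) as HI.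
  rewrite (beta_int_ext p a b _ (fun t =>
     ((a + b + z) * (RtoC (1 - t) ^ 1 * Cexp (- (z * RtoC (1 - t))))
      - z * (RtoC (1 - t) ^ 2 * Cexp (- (z * RtoC (1 - t)))))
      - b * (RtoC (1 - t) ^ 0 * Cexp (- (z * RtoC (1 - t)))))) in HI.
  - rewrite !beta_int_minus, !beta_int_scal in HI by (try easy; ccont).
    fold (beta_laplace p a b 0 z) (beta_laplace p a b 1 z) (beta_laplace p a b 2 z) in HI.
    transitivity (b * beta_laplace p a b 0 z - z * beta_laplace p a b 1 z +
      ((a + b + z) * beta_laplace p a b 1 z - z * beta_laplace p a b 2 z - b * beta_laplace p a b 0 z)); [|ring].
    rewrite HI. ring.
  - intros t _. rewrite RtoC_mult, RtoC_minus. simpl. ring.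
Qed.

(** Differentiation under the integral sign, from the second-order Taylor bound
    of the exponential. *)
Lemma Cderive_beta_laplace p a b z d s : beta_admissible p a b -> (0 <= Re (z + RtoC s * d))%R ->
  is_Cderive (fun s => beta_laplace p a b 0 (z + RtoC s * d)) s (- d * beta_laplace p a b 1 (z + RtoC s * d)).
Proof.
  intros H Hz. apply Cderive_quadratic with (INR p * (Cmod d ^ 2 * exp (Cmod d)))%R.
  intros h Hh. set (w := z + RtoC s * d) in *.
  replace (z + RtoC (s + h) * d) with (w + RtoC h * d) by (unfold w; rewrite RtoC_plus; ring).
  unfold beta_laplace.
  replace (RtoC h * (- d * beta_int p a b (fun t => RtoC (1 - t) ^ 1 * Cexp (- (w * RtoC (1 - t))))))
    with ((- (RtoC h * d)) * beta_int p a b (fun t => RtoC (1 - t) ^ 1 * Cexp (- (w * RtoC (1 - t))))) by ring.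
  rewrite <- (beta_int_scal p a b (- (RtoC h * d))) by (try easy; ccont).
  rewrite <- !beta_int_minus by (try easy; ccont).
  rewrite Rmult_assoc.
  apply beta_int_sup; [easy|ccont|].
  intros t Ht.
  set (u := RtoC (1 - t)). set (q := - (RtoC h * d * u)).
  replace (u ^ 0 * Cexp (- ((w + RtoC h * d) * u)) - u ^ 0 * Cexp (- (w * u)) -
     - (RtoC h * d) * (u ^ 1 * Cexp (- (w * u)))) with (Cexp (- (w * u)) * (Cexp q - 1 - q)).
  2:{ replace (- ((w + RtoC h * d) * u)) with (- (w * u) + q) by (unfold q; ring).
      rewrite Cexp_plus. unfold q. simpl. ring. }
  assert (Hq : (Cmod q <= Rabs h * Cmod d)%R).
  { unfold q, u. rewrite Cmod_opp, !Cmod_mult, !Cmod_R, (Rabs_right (1 - t)) by lra.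
    pose proof (Rabs_pos h). pose proof (Cmod_ge_0 d).
    assert (0 <= Rabs h * Cmod d)%R by now apply Rmult_le_pos. nra. }
  rewrite Cmod_mult. unfold u at 1. rewrite Cmod_Cexp_kernel.
  apply Rle_trans with (1 * ((Rabs h * Cmod d) ^ 2 * exp (Cmod d)))%R.
  - apply Rmult_le_compat; [left; apply exp_pos|apply Cmod_ge_0| |].
    + apply Rle_trans with (exp 0); [apply exp_le|rewrite exp_0; lra].
      assert (0 <= Re w * (1 - t))%R by (apply Rmult_le_pos; [exact Hz|lra]). lra.
    + eapply Rle_trans; [apply Cexp_2_le|].
      apply Rmult_le_compat; [apply pow2_ge_0|left; apply exp_pos| |].
      * apply pow_incr. split; [apply Cmod_ge_0|easy].
      * apply exp_le. pose proof (Cmod_ge_0 d). nra.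
  - apply Req_le. rewrite Rpow_mult_distr, pow2_abs. ring.
Qed.

Definition scaled_laplace (p : nat) (a b z : C) : C := Cpower z b * beta_laplace p a b 0 z.

Lemma Cderive_scaled_laplace p a b z d s : beta_admissible p a b -> (0 < Re (z + RtoC s * d))%R ->
  is_Cderive (fun s => scaled_laplace p a b (z + RtoC s * d)) s
   (d / (z + RtoC s * d) * Cpower (z + RtoC s * d) b *
     ((a + b) * beta_laplace p a b 1 (z + RtoC s * d) - (z + RtoC s * d) * beta_laplace p a b 2 (z + RtoC s * d))).
Proof.
  intros H Hz. unfold scaled_laplace.
  assert (HL : is_Cderive (fun s => z + RtoC s * d) s d).
  { eapply Cderive_eq; [apply (Cderive_plus (fun _ => z)); [apply Cderive_const|]|].
    - apply (Cderive_mult (fun s => RtoC s) (fun _ => d)); [apply Cderive_id|apply Cderive_const].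
    - cbv beta; ring. }
  eapply Cderive_eq.
  - apply Cderive_mult; [apply (Cderive_Cpower _ _ _ b HL Hz)|apply Cderive_beta_laplace; [exact H|lra]].
  - rewrite <- beta_laplace_relation by easy. pose proof (Re_pos_neq_0 _ Hz).
    generalize dependent (z + RtoC s * d). intros w _ Hw. field. exact Hw.
Qed.

Lemma Rpower_cancel x q k : (0 < x)%R -> (Rpower x q * Rpower x (- (q + INR k)) = / x ^ k)%R.
Proof.
  intros Hx. rewrite <- Rpower_plus. replace (q + - (q + INR k))%R with (- INR k)%R by ring.
  rewrite Rpower_Ropp, Rpower_pow by easy. reflexivity.
Qed.

(** The derivative of [scaled_laplace] is O(1/n^2) on the segment from [n] to [z],
    whose length is O(n). *)
Lemma scaled_laplace_segment p a b kappa : beta_admissible p a b -> (1 <= kappa)%R -> exists K,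
  forall (n : nat) z, (1 <= n)%nat -> (INR n <= Re z)%R -> (Cmod z <= kappa * INR n)%R ->
  (Cmod (scaled_laplace p a b z - scaled_laplace p a b (RtoC (INR n))) <= K / INR n)%R.
Proof.
  intros H Hkap. pose proof H as [_ [_ Hb]].
  destruct (beta_laplace_bound p a b 1 H) as [K1 [HK1 HB1]].
  destruct (beta_laplace_bound p a b 2 H) as [K2 [HK2 HB2]].
  set (C0 := exp (Rabs (Im b) * PI)). assert (HC0 : (0 < C0)%R) by apply exp_pos.
  set (Pk := Rpower kappa (Re b)). assert (HPk : (0 < Pk)%R) by apply exp_pos.
  set (A := Cmod (a + b)). assert (HA : (0 <= A)%R) by apply Cmod_ge_0.
  exists (2 * kappa * C0 * Pk * (A * K1 + kappa * K2))%R.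
  intros n z Hn Hre Hz.
  assert (HN : (1 <= INR n)%R) by (change 1%R with (INR 1); now apply le_INR).
  set (N := INR n) in *.
  set (d := z - RtoC N).
  assert (Hd : (Cmod d <= 2 * kappa * N)%R).
  { eapply Rle_trans; [apply Cmod_minus|]. rewrite Cmod_R, Rabs_right by lra. nra. }
  replace (scaled_laplace p a b z - scaled_laplace p a b (RtoC N)) with
    (scaled_laplace p a b (RtoC N + RtoC 1 * d) - scaled_laplace p a b (RtoC N + RtoC 0 * d)).
  2:{ f_equal; [f_equal; unfold d; ring|do 2 f_equal; ring]. }
  assert (Hw : forall s, (0 <= s <= 1)%R -> (N <= Re (RtoC N + RtoC s * d))%R /\
     (Cmod (RtoC N + RtoC s * d) <= kappa * N)%R).
  { intros s Hs. split.
    - rewrite re_plus, re_scal_l. unfold d. rewrite re_minus, re_RtoC. nra.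
    - replace (RtoC N + RtoC s * d) with (RtoC (1 - s) * RtoC N + RtoC s * z)
        by (unfold d; rewrite RtoC_minus; ring).
      eapply Rle_trans; [apply Cmod_triangle|].
      rewrite !Cmod_mult, !Cmod_R, !Rabs_right by lra.
      assert (N <= kappa * N)%R by nra. nra. }
  apply (mean_value_const (fun s => scaled_laplace p a b (RtoC N + RtoC s * d)) _ _
     (fun s Hs => Cderive_scaled_laplace p a b (RtoC N) d s H (Rlt_le_trans _ _ _ (Rlt_le_trans _ _ _ Rlt_0_1 HN) (proj1 (Hw s Hs))))).
  intros s Hs. destruct (Hw s Hs) as [Hw1 Hw2].
  set (w := RtoC N + RtoC s * d) in *.
  assert (Hw0 : (0 < Re w)%R) by lra.
  assert (HwN : (N <= Cmod w)%R) by (pose proof (Re_le_Cmod w); lra).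
  rewrite !Cmod_mult, Cmod_div by now apply Re_pos_neq_0.
  set (P := Rpower N (Re b)). assert (HP : (0 < P)%R) by apply exp_pos.
  assert (E1 : (Cmod d / Cmod w <= 2 * kappa)%R).
  { apply Rmult_le_reg_r with (Cmod w); [lra|].
    unfold Rdiv; rewrite Rmult_assoc, Rinv_l, Rmult_1_r by lra.
    apply Rle_trans with (2 * kappa * N)%R; [easy|]. apply Rmult_le_compat_l; lra. }
  assert (E2 : (Cmod (Cpower w b) <= C0 * (Pk * P))%R).
  { eapply Rle_trans; [now apply Cmod_Cpower_le|]. fold C0.
    apply Rmult_le_compat_l; [lra|]. unfold Pk, P. rewrite Rpower_mult_distr by lra.
    apply Rpower_le_base; lra. }
  assert (E3 : forall k Kk, (0 < Kk)%R -> (forall z, (0 < Re z)%R -> (Cmod (beta_laplace p a b k z) <= Kk * Rpower (Re z) (- (Re b + INR k)))%R) ->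
     (P * Cmod (beta_laplace p a b k w) <= Kk * / N ^ k)%R).
  { intros k Kk HKk HBk. pose proof (pos_INR k).
    rewrite <- (Rpower_cancel N (Re b) k) by lra. fold P.
    apply Rle_trans with (P * (Kk * Rpower N (- (Re b + INR k))))%R; [|lra].
    apply Rmult_le_compat_l; [lra|]. eapply Rle_trans; [now apply HBk|].
    apply Rmult_le_compat_l; [lra|]. apply Rpower_inv_le; lra. }
  pose proof (E3 1%nat K1 HK1 HB1) as F1. pose proof (E3 2%nat K2 HK2 HB2) as F2.
  assert (E4 : (P * Cmod ((a + b) * beta_laplace p a b 1 w - w * beta_laplace p a b 2 w) <= (A * K1 + kappa * K2) / N)%R).
  { apply Rle_trans with (A * (P * Cmod (beta_laplace p a b 1 w)) + Cmod w * (P * Cmod (beta_laplace p a b 2 w)))%R.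
    - apply Rle_trans with (P * (A * Cmod (beta_laplace p a b 1 w) + Cmod w * Cmod (beta_laplace p a b 2 w)))%R; [|lra].
      apply Rmult_le_compat_l; [lra|]. eapply Rle_trans; [apply Cmod_minus|].
      rewrite !Cmod_mult. unfold A. lra.
    - apply Rle_trans with (A * (K1 * / N ^ 1) + kappa * N * (K2 * / N ^ 2))%R.
      + apply Rplus_le_compat; [now apply Rmult_le_compat_l|].
        apply Rmult_le_compat; trivial; [apply Cmod_ge_0|].
        apply Rmult_le_pos; [lra|apply Cmod_ge_0].
      + apply Req_le. field. lra. }
  set (X := Cmod ((a + b) * beta_laplace p a b 1 w - w * beta_laplace p a b 2 w)) in *.
  assert (HX : (0 <= X)%R) by apply Cmod_ge_0.
  apply Rle_trans with (2 * kappa * (C0 * (Pk * P)) * X)%R.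
  - apply Rmult_le_compat_r; [easy|]. apply Rmult_le_compat; trivial.
    + apply Rdiv_le_0_compat; [apply Cmod_ge_0|lra].
    + apply Cmod_ge_0.
  - replace (2 * kappa * (C0 * (Pk * P)) * X)%R with (2 * kappa * C0 * Pk * (P * X))%R by ring.
    unfold Rdiv. rewrite (Rmult_assoc _ _ (/ N)). apply Rmult_le_compat_l; [|exact E4].
    repeat apply Rmult_le_pos; lra.
Qed.


(** * Comparison with moments along the integers *)

Lemma one_minus_pow_le t n : (0 <= t <= 1)%R -> (t ^ n <= exp (- (INR n * (1 - t))))%R.
Proof.
  intros Ht. induction n as [|n IH].
  - simpl. rewrite Rmult_0_l, Ropp_0, exp_0. lra.
  - rewrite S_INR. replace (- ((INR n + 1) * (1 - t)))%R with (- (1 - t) + - (INR n * (1 - t)))%R by ring.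
    rewrite exp_plus. simpl. apply Rmult_le_compat; [lra|apply pow_le; lra| |easy].
    pose proof (exp_ineq1_le (- (1 - t))). lra.
Qed.

(** The two sequences are [A ^ n] and [B ^ n] with [A = exp (- (1 - t))] and
    [B = t], and [A - B <= (1 - t) ^ 2]. *)
Lemma exp_minus_pow_le t n : (0 <= t <= 1)%R ->
  (exp (- (INR n * (1 - t))) - t ^ n <=
    INR n * exp 1 * ((1 - t) ^ 2 * exp (- (INR n * (1 - t)))))%R.
Proof.
  intros Ht. set (u := (1 - t)%R).
  assert (Hu : (0 <= u <= 1)%R) by (unfold u; lra).
  assert (H1 : (exp (- u) - t <= u ^ 2)%R).
  { rewrite exp_Ropp. pose proof (exp_ineq1_le u).
    assert (/ exp u <= / (1 + u))%R by (apply Rinv_le_contravar; lra).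
    assert (/ (1 + u) <= 1 - u + u ^ 2)%R.
    { apply Rmult_le_reg_r with (1 + u)%R; [lra|]. rewrite Rinv_l by lra.
      assert (0 <= u ^ 3)%R by (apply pow_le; lra). nra. }
    unfold u in *. lra. }
  induction n as [|n IH].
  - simpl. rewrite Rmult_0_l, Ropp_0, exp_0. lra.
  - rewrite S_INR. replace (- ((INR n + 1) * u))%R with (- u + - (INR n * u))%R by ring.
    rewrite exp_plus.
    set (A := exp (- u)) in *. set (E := exp (- (INR n * u))) in *.
    assert (HA : (0 < A <= 1)%R).
    { split; [apply exp_pos|]. apply exp_le_1. lra. }
    assert (HE : (0 < E)%R) by apply exp_pos.
    assert (HeA : (1 <= exp 1 * A)%R).
    { unfold A. rewrite <- exp_plus. apply exp_ge_1. lra. }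
    pose proof (one_minus_pow_le t n Ht) as Htn. fold u in Htn. fold E in Htn.
    assert (Htn0 : (0 <= t ^ n)%R) by (apply pow_le; lra).
    assert (Hu2 : (0 <= u ^ 2)%R) by apply pow2_ge_0.
    change (t ^ S n)%R with (t * t ^ n)%R.
    replace (A * E - t * t ^ n)%R with (A * (E - t ^ n) + t ^ n * (A - t))%R by ring.
    apply Rle_trans with (A * (INR n * exp 1 * (u ^ 2 * E)) + E * u ^ 2)%R.
    + apply Rplus_le_compat; [apply Rmult_le_compat_l; lra|].
      apply Rle_trans with (t ^ n * u ^ 2)%R; [apply Rmult_le_compat_l; lra|].
      apply Rmult_le_compat_r; lra.
    + assert (E * u ^ 2 <= (exp 1 * A) * (E * u ^ 2))%R.
      { rewrite <- (Rmult_1_l (E * u ^ 2)) at 1. apply Rmult_le_compat_r; [|easy].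
        apply Rmult_le_pos; lra. }
      lra.
Qed.

Lemma Cmod_Cpower_real_le n b : (1 <= n)%nat ->
  (Cmod (Cpower (RtoC (INR n)) b) <= exp (Rabs (Im b) * PI) * Rpower (INR n) (Re b))%R.
Proof.
  intros Hn. assert (HN : (0 < INR n)%R) by (apply lt_0_INR; lia).
  eapply Rle_trans; [apply Cmod_Cpower_le; simpl; easy|].
  rewrite Cmod_R, (Rabs_right (INR n)) by lra. simpl (Re _). lra.
Qed.

(** After multiplication by [n ^ b], each factor [1 - t] in the integrand costs a
    factor [1 / n], and the two integrands differ by
    [O((n (1 - t) ^ 2 + (1 - t)) exp (- n (1 - t)))]. *)
Lemma scaled_laplace_nat p a b : beta_admissible p a b -> exists K, forall n, (1 <= n)%nat ->
  (Cmod (scaled_laplace p a b (RtoC (INR n)) -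
     Cpower (RtoC (INR n)) b * beta_int p a b (fun t => RtoC t ^ S n)%C) <= K / INR n)%R.
Proof.
  intros H.
  destruct (beta_int_bound p a b 1 H) as [K1 [HK1 HB1]].
  destruct (beta_int_bound p a b 2 H) as [K2 [HK2 HB2]].
  set (C0 := exp (Rabs (Im b) * PI)). assert (HC0 : (0 < C0)%R) by apply exp_pos.
  exists (C0 * (K2 * exp 1 + K1))%R. intros n Hn.
  assert (HN : (0 < INR n)%R) by (apply lt_0_INR; lia).
  set (N := INR n) in *.
  set (g2 := fun t => RtoC (1 - t) ^ 0 * Cexp (- (RtoC N * RtoC (1 - t))) - RtoC t ^ n).
  set (g1 := fun t => RtoC t ^ n * RtoC (1 - t)).
  unfold scaled_laplace, beta_laplace.
  replace (Cpower N b * beta_int p a b (fun t => RtoC (1 - t) ^ 0 * Cexp (- (RtoC N * RtoC (1 - t)))) -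
     Cpower N b * beta_int p a b (fun t => RtoC t ^ S n)) with
    (Cpower N b * (beta_int p a b g2 + beta_int p a b g1)).
  2:{ match goal with |- _ = ?P * ?X - ?P * ?Y =>
        replace (P * X - P * Y) with (P * (X - Y)) by ring end.
      f_equal. rewrite <- beta_int_plus by (try easy; unfold g1, g2; ccont).
      rewrite <- beta_int_minus by (try easy; ccont).
      apply beta_int_ext. intros t _. unfold g1, g2. rewrite Cpow_S, RtoC_minus. ring. }
  rewrite Cmod_mult.
  assert (E2 : (Cmod (beta_int p a b g2) <= K2 * (N * exp 1) * Rpower N (- (Re b + INR 2)))%R).
  { apply HB2; trivial.
    - apply Rmult_le_pos; [lra|left; apply exp_pos].
    - unfold g2; ccont.
    - intros t Ht. unfold g2.
      replace (RtoC (1 - t) ^ 0 * Cexp (- (RtoC N * RtoC (1 - t))) - RtoC t ^ n) with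
        (RtoC (exp (- (N * (1 - t))) - t ^ n)).
      + rewrite Cmod_R, Rabs_right.
        * now apply exp_minus_pow_le.
        * pose proof (one_minus_pow_le t n Ht) as Hle. fold N in Hle. lra.
      + rewrite RtoC_minus, RtoC_pow, <- Cexp_real, RtoC_opp, RtoC_mult. simpl. ring. }
  assert (E1 : (Cmod (beta_int p a b g1) <= K1 * 1 * Rpower N (- (Re b + INR 1)))%R).
  { apply HB1; trivial; [lra|unfold g1; ccont|].
    intros t Ht. unfold g1. rewrite Cmod_mult, Cmod_pow, !Cmod_R, !Rabs_right by lra.
    pose proof (one_minus_pow_le t n Ht) as Hle. fold N in Hle. simpl. nra. }
  set (P := Rpower N (Re b)).
  assert (HP : (0 < P)%R) by apply exp_pos.
  pose proof (Rpower_cancel N (Re b) 1 HN) as R1. pose proof (Rpower_cancel N (Re b) 2 HN) as R2.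
  fold P in R1, R2.
  apply Rle_trans with (C0 * P * (K2 * (N * exp 1) * Rpower N (- (Re b + INR 2)) + K1 * 1 * Rpower N (- (Re b + INR 1))))%R.
  - apply Rmult_le_compat; try apply Cmod_ge_0.
    + now apply Cmod_Cpower_real_le.
    + eapply Rle_trans; [apply Cmod_triangle|]. lra.
  - apply Req_le.
    transitivity (C0 * (K2 * (N * exp 1) * (P * Rpower N (- (Re b + INR 2))) + K1 * (P * Rpower N (- (Re b + INR 1)))))%R; [ring|].
    rewrite R1, R2. field. lra.
Qed.

Lemma rpow_nat k v : (0 <= v)%R -> (1 <= k)%nat -> rpow v (RtoC (INR k)) = RtoC (v ^ k).
Proof.
  intros Hv Hk. destruct (Rlt_dec 0 v) as [Hp|Hp].
  - rewrite rpow_pos by easy. rewrite <- RtoC_mult, Cexp_real.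
    f_equal. change (exp (INR k * ln v))%R with (Rpower v (INR k)). now apply Rpower_pow.
  - assert (v = 0%R) by lra. subst v. rewrite rpow_nonpos by lra. rewrite pow_i by lia. easy.
Qed.

Lemma beta_int_1_total p b : beta_admissible p 1 b -> b * beta_int p 1 b (fun _ => 1) = 1.
Proof.
  intros H. pose proof H as [Hp [_ Hb]].
  destruct p as [|p]; [lia|].
  rewrite <- (beta_int_scal _ _ _ b) by (try easy; ccont).
  unfold beta_int.
  set (f := fun v => - (RtoC (- (INR (S p) * v ^ p)) * (b * rpow (1 - v ^ S p) (b - 1)))).
  rewrite (CInt_ext _ f).
  - assert (HD : forall v, is_Cderive (fun v => - rpow (1 - v ^ S p) b) v (f v)).
    { intros v. apply Cderive_ext with (fun v => (- (1)) * rpow (1 - v ^ S p) b); [intros s; ring|].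
      eapply Cderive_eq; [apply Cderive_scal|].
      - apply (Cderive_comp_real (fun x => rpow x b) (fun v => (1 - v ^ S p)%R)).
        + apply (is_derive_minus (fun _ : R => 1%R) (fun v : R => (v ^ S p)%R)).
          * apply @is_derive_const.
          * apply is_derive_pow_S.
        + apply Cderive_rpow. lra.
      - unfold f. cbv beta. rewrite RtoC_minus, RtoC_opp.
        change (RtoC zero) with (RtoC 0).
        generalize (RtoC (INR (S p) * v ^ p)) (rpow (1 - v ^ S p) (b - 1)). intros; ring. }
    rewrite (CInt_derive _ f HD).
    + rewrite pow1, pow_i by lia. rewrite (rpow_nonpos (1 - 1)) by lra.
      replace (1 - 0)%R with 1%R by ring. rewrite rpow_1. ring.
    + unfold f. apply Ccont_opp. apply Ccont_mult.
      * apply (Ccont_real (fun v => (- (INR (S p) * v ^ p))%R)). intros s.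
        apply (continuous_opp (V := R_NormedModule) (fun v => (INR (S p) * v ^ p)%R)).
        apply (continuous_mult (K := R_AbsRing) (fun _ => INR (S p)) (fun v => (v ^ p)%R));
          [apply continuous_const|apply continuous_pow].
      * apply Ccont_mult; [apply Ccont_const|].
        apply (Ccont_comp (fun x => rpow x (b - 1))); [|apply continuous_1_pow].
        apply Ccont_rpow. rewrite re_minus. simpl. lra.
  - intros v Hv. unfold f, beta_weight.
    replace (RtoC (INR (S p)) * 1 - 1) with (RtoC (INR p)) by (rewrite S_INR, RtoC_plus; ring).
    rewrite rpow_nat by (lra || lia). rewrite RtoC_opp, RtoC_mult. ring.
Qed.

(** The exponent has real part at least [2], so the derivative is bounded by
    [|w|] on [[0, 1]]. *)
Lemma rpow_lipschitz w v : (2 <= Re w)%R -> (0 <= v <= 1)%R ->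
  (Cmod (rpow v w - 1) <= Cmod w * (1 - v))%R.
Proof.
  intros Hw Hv.
  replace (rpow v w - 1) with (- (rpow (v + 1 * (1 - v)) w - rpow (v + 0 * (1 - v)) w)).
  2:{ replace (v + 1 * (1 - v))%R with 1%R by ring. replace (v + 0 * (1 - v))%R with v by ring.
      rewrite rpow_1. ring. }
  rewrite Cmod_opp.
  apply (mean_value_const (fun s => rpow (v + s * (1 - v)) w)
     (fun s => RtoC (1 - v) * (w * rpow (v + s * (1 - v)) (w - 1)))).
  - intros s _. apply (Cderive_comp_real (fun x => rpow x w) (fun s => (v + s * (1 - v))%R)).
    + auto_derive; [trivial|ring].
    + now apply Cderive_rpow.
  - intros s Hs. rewrite !Cmod_mult, Cmod_R, Rabs_right by lra.
    assert (Cmod (rpow (v + s * (1 - v)) (w - 1)) <= 1)%R.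
    { apply Cmod_rpow_le_1; [nra|]. rewrite re_minus. simpl. lra. }
    pose proof (Cmod_ge_0 w).
    assert (Cmod w * Cmod (rpow (v + s * (1 - v)) (w - 1)) <= Cmod w * 1)%R by now apply Rmult_le_compat_l.
    nra.
Qed.

(** Near [t = 1] the factor [t ^ (a - 1)] is [1 + O(1 - t)], so that up to
    O(1/n) the scaled moment does not depend on [a]. *)
Lemma beta_moment_compare p a b : beta_admissible p a b -> exists K, forall n, (1 <= n)%nat ->
  (Cmod (Cpower (RtoC (INR n)) b * (beta_int p a b (fun t => RtoC t ^ n)%C
     - beta_int p 1 b (fun t => RtoC t ^ n)%C)) <= K / INR n)%R.
Proof.
  intros H. pose proof H as [Hp [Ha Hb]].
  assert (Hp3 : (3 <= INR p)%R) by (replace 3%R with (INR 3) by (simpl; ring); now apply le_INR).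
  assert (H1 : beta_admissible p 1 b).
  { split; [easy|split; [|easy]]. simpl. lra. }
  destruct (laplace_bound p b 1) as [K [HK HL]]; [lia|lra|].
  set (wa := RtoC (INR p) * a - 1). set (w1 := RtoC (INR p) * 1 - 1).
  assert (Hwa : (2 <= Re wa)%R) by (unfold wa; rewrite re_minus, re_scal_l; simpl; lra).
  assert (Hw1 : (2 <= Re w1)%R) by (unfold w1; rewrite re_minus, re_scal_l; simpl; lra).
  set (M := (INR p * (Cmod wa + Cmod w1))%R).
  assert (HM : (0 <= M)%R).
  { apply Rmult_le_pos; [lra|]. pose proof (Cmod_ge_0 wa). pose proof (Cmod_ge_0 w1). lra. }
  set (C0 := exp (Rabs (Im b) * PI)). assert (HC0 : (0 < C0)%R) by apply exp_pos.
  exists (C0 * (K * M))%R. intros n Hn.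
  assert (HN : (0 < INR n)%R) by (apply lt_0_INR; lia).
  set (N := INR n) in *.
  assert (E : (Cmod (beta_int p a b (fun t => RtoC t ^ n)%C - beta_int p 1 b (fun t => RtoC t ^ n)%C)
     <= K * M * Rpower N (- (Re b + INR 1)))%R).
  { set (ha := fun v => beta_weight p a b v * RtoC (v ^ p) ^ n).
    set (h1 := fun v => beta_weight p 1 b v * RtoC (v ^ p) ^ n).
    assert (Hha : Ccont ha) by (refine (Ccont_beta_integrand p a b (fun t => RtoC t ^ n) H _); ccont).
    assert (Hh1 : Ccont h1) by (refine (Ccont_beta_integrand p 1 b (fun t => RtoC t ^ n) H1 _); ccont).
    change (Cmod (CInt ha - CInt h1) <= K * M * Rpower N (- (Re b + INR 1)))%R.
    replace (CInt ha - CInt h1) with (CInt ha + (- (1)) * CInt h1) by ring.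
    assert (Hh1' : Ccont (fun v => (- (1)) * h1 v)) by (apply Ccont_mult; [apply Ccont_const|exact Hh1]).
    rewrite <- CInt_scal by exact Hh1. rewrite <- CInt_plus by assumption.
    apply HL; trivial; [now apply Ccont_plus|].
    intros v Hv. pose proof (pow_unit_interval p v Hv) as Ht.
    replace (ha v + - (1) * h1 v) with
      (RtoC (INR p) * ((rpow v wa - 1) - (rpow v w1 - 1)) * (rpow (1 - v ^ p) (b - 1) * RtoC (v ^ p) ^ n))
      by (unfold ha, h1, beta_weight; fold wa w1; ring).
    assert (Hvp : (v ^ p <= v)%R).
    { destruct p as [|p']; [lia|]. simpl. pose proof (pow_unit_interval p' v Hv). nra. }
    set (t := (v ^ p)%R) in *.
    rewrite !Cmod_mult, Cmod_nat, Cmod_pow, Cmod_R, (Rabs_right t) by lra.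
    pose proof (rpow_lipschitz wa v Hwa Hv) as L1. pose proof (rpow_lipschitz w1 v Hw1 Hv) as L2.
    pose proof (Cmod_minus (rpow v wa - 1) (rpow v w1 - 1)) as L3.
    pose proof (Cmod_ge_0 wa) as Q1. pose proof (Cmod_ge_0 w1) as Q2.
    set (D := Cmod (rpow v wa - 1 - (rpow v w1 - 1))) in *.
    assert (L4 : (D <= (Cmod wa + Cmod w1) * (1 - t))%R) by nra.
    pose proof (one_minus_pow_le t n Ht) as Hle. fold N in Hle.
    set (r := Cmod (rpow (1 - t) (b - 1))). assert (Hr : (0 <= r)%R) by apply Cmod_ge_0.
    apply Rle_trans with (INR p * ((Cmod wa + Cmod w1) * (1 - t)) * (r * exp (- (N * (1 - t)))))%R.
    - apply Rmult_le_compat.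
      + apply Rmult_le_pos; [lra|apply Cmod_ge_0].
      + apply Rmult_le_pos; [easy|apply pow_le; lra].
      + apply Rmult_le_compat_l; lra.
      + now apply Rmult_le_compat_l.
    - apply Req_le. unfold M. simpl. ring. }
  rewrite Cmod_mult.
  pose proof (Rpower_cancel N (Re b) 1 HN) as R1.
  apply Rle_trans with (C0 * Rpower N (Re b) * (K * M * Rpower N (- (Re b + INR 1))))%R.
  - apply Rmult_le_compat; try apply Cmod_ge_0; [|exact E]. now apply Cmod_Cpower_real_le.
  - apply Req_le.
    transitivity (C0 * (K * M) * (Rpower N (Re b) * Rpower N (- (Re b + INR 1))))%R; [ring|].
    rewrite R1. field. lra.
Qed.

Lemma poch_1 n : poch 1 n = factC n.
Proof.
  induction n as [|n IH]; [easy|].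
  rewrite poch_S, IH, factC_S, S_INR, RtoC_plus. ring.
Qed.

(** Otherwise all moments would vanish, hence so would the limit of the scaled
    moments for [a = 1], which is [Gamma b]. *)
Lemma beta_int_total_neq_0 p a b : beta_admissible p a b -> (0 < Re a)%R ->
  beta_int p a b (fun _ => 1) <> 0.
Proof.
  intros H Ha E. pose proof H as [Hp [_ Hb]].
  assert (Hp3 : (3 <= INR p)%R) by (replace 3%R with (INR 3) by (simpl; ring); now apply le_INR).
  assert (H1 : beta_admissible p 1 b).
  { split; [easy|split; [|easy]]. simpl. lra. }
  assert (Hbn : ~ nonpos_int b) by (apply Re_pos_nonpos_int; lra).
  apply (CGamma_neq_0 b Hbn).
  apply (Clim_unique eventually (euler_seq b)); [now apply CGamma_lim|].
  destruct (beta_moment_compare p a b H) as [K HK].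
  apply Clim_eventually_intro with K. intros n Hn. specialize (HK n Hn).
  rewrite (beta_moment p a b n H Ha), E in HK.
  assert (H1p : (0 < Re 1)%R) by (simpl; lra).
  rewrite (beta_moment p 1 b n H1 H1p) in HK.
  pose proof (beta_int_1_total p b H1) as HB.
  pose proof (nonpos_int_neq_0 b Hbn) as Hb0.
  pose proof (Re_add_pos_nonpos_int p 1 b H1 H1p) as H1b.
  replace (beta_int p 1 b (fun _ => 1)) with (/ b) in HK
    by (replace (beta_int p 1 b (fun _ => 1)) with (b * beta_int p 1 b (fun _ => 1) / b) by (field; easy); rewrite HB; field; easy).
  replace (euler_seq b n - 0) with
    (- (Cpower (RtoC (INR n)) b * (poch a n / poch (a + b) n * 0 - poch 1 n / poch (1 + b) n * / b))).
  - rewrite Cmod_opp. exact HK.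
  - unfold euler_seq. rewrite poch_1.
    pose proof (poch_shift b n) as Hs. rewrite <- poch_S in Hs. rewrite Hs.
    rewrite (Cplus_comm 1 b) in *.
    pose proof (poch_neq_0 _ n H1b).
    replace (poch a n / poch (a + b) n * 0) with (RtoC 0) by ring. field. auto.
Qed.


(** * Asymptotics in a sector of the right half-plane *)

Definition sector_infty (e : R) (P : C -> Prop) : Prop :=
  exists R0, (1 <= R0)%R /\ forall z, (R0 <= Cmod z)%R -> (e * Cmod z <= Re z)%R -> P z.

Lemma sector_infty_filter e : Filter (sector_infty e).
Proof.
  constructor.
  - exists 1%R. split; [lra|auto].
  - intros P Q [R1 [H1 HP]] [R2 [H2 HQ]]. exists (Rmax R1 R2).
    pose proof (Rmax_l R1 R2). pose proof (Rmax_r R1 R2).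
    split; [lra|]. intros z Hz Hs. split; [apply HP|apply HQ]; trivial; lra.
  - intros P Q HPQ [R1 [H1 HP]]. exists R1. split; [easy|auto].
Qed.

#[local] Existing Instance sector_infty_filter.

Lemma Clim_inv_infty e : Clim (sector_infty e) (fun z => / z) 0.
Proof.
  intros eps He. exists (Rmax 1 (/ eps)). split; [apply Rmax_l|].
  intros z Hz _.
  pose proof (Rmax_l 1 (/ eps)). pose proof (Rmax_r 1 (/ eps)).
  assert (Hz0 : z <> 0) by (apply Cmod_gt_0; lra).
  replace (/ z - 0) with (/ z) by ring. rewrite Cmod_inv by easy.
  rewrite <- (Rinv_inv eps). apply Rinv_le_contravar; [|lra].
  now apply Rinv_0_lt_compat.
Qed.

(** Compare with the integer part [n] of [Re z], where the value is a scaled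
    moment up to O(1/n). *)
Lemma scaled_laplace_lim p a b e : beta_admissible p a b -> (0 < Re a)%R -> (0 < e <= 1)%R ->
  Clim (sector_infty e) (scaled_laplace p a b)
    (CGamma (a + b) / CGamma a * beta_int p a b (fun _ => 1)).
Proof.
  intros H Ha He. pose proof (Re_add_pos_nonpos_int p a b H Ha) as Hab.
  set (L := CGamma (a + b) / CGamma a * beta_int p a b (fun _ => 1)).
  assert (Hnat : Clim eventually (fun n => scaled_laplace p a b (RtoC (INR n))) L).
  { destruct (scaled_laplace_nat p a b H) as [K HK].
    replace L with (0 + L) by ring.
    apply Clim_eventually_ext with (fun n => (scaled_laplace p a b (RtoC (INR n)) -
     Cpower (RtoC (INR n)) b * beta_int p a b (fun t => RtoC t ^ S n)) +
     poch a (S n) / poch (a + b) (S n) * Cpower (RtoC (INR n)) (a + b - a) * beta_int p a b (fun _ => 1)).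
    - intros n Hn. rewrite (beta_moment p a b (S n)) by easy.
      replace (a + b - a) with b by ring. ring.
    - apply Clim_plus; [apply eventually_filter| |].
      + apply Clim_eventually_intro with K. intros n Hn.
        rewrite Cminus_0_r.
        now apply HK.
      + apply Clim_mult; [apply eventually_filter| |apply Clim_const, eventually_filter].
        apply poch_ratio_lim; [now apply Re_pos_nonpos_int|easy]. }
  intros eps Heps.
  (* [|z| <= Re z / e <= (n + 1) / e <= 2 n / e] for the integer part [n] of [Re z]. *)
  destruct (scaled_laplace_segment p a b (2 / e) H) as [K HK].
  { apply Rmult_le_reg_r with e; [lra|]. unfold Rdiv. rewrite Rmult_assoc, Rinv_l by lra. lra. }
  destruct (Hnat (eps / 2)%R) as [N0 HN0]; [lra|].
  pose proof (Rabs_pos K) as HK0. pose proof (pos_INR N0) as HNp.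
  set (q := (2 * Rabs K / eps)%R).
  assert (Hq : (0 <= q)%R) by (apply Rdiv_le_0_compat; lra).
  exists ((INR N0 + q + 2) / e)%R. split.
  { apply Rmult_le_reg_r with e; [lra|]. unfold Rdiv. rewrite Rmult_assoc, Rinv_l by lra. lra. }
  intros z Hz Hs.
  assert (Hre : (INR N0 + q + 2 <= Re z)%R).
  { eapply Rle_trans; [|exact Hs].
    replace (INR N0 + q + 2)%R with (e * ((INR N0 + q + 2) / e))%R by (field; lra).
    apply Rmult_le_compat_l; lra. }
  destruct (nfloor_ex (Re z)) as [n [Hn1 Hn2]]; [lra|].
  assert (HnN : (N0 <= n)%nat) by (apply INR_le; lra).
  assert (Hn : (1 <= n)%nat) by (apply INR_le; simpl; lra).
  assert (Hmod : (Cmod z <= 2 / e * INR n)%R).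
  { apply Rmult_le_reg_l with e; [lra|].
    replace (e * (2 / e * INR n))%R with (2 * INR n)%R by (field; lra). lra. }
  replace (scaled_laplace p a b z - L) with
   ((scaled_laplace p a b z - scaled_laplace p a b (RtoC (INR n))) + (scaled_laplace p a b (RtoC (INR n)) - L)) by ring.
  eapply Rle_trans; [apply Cmod_triangle|].
  specialize (HK n z Hn Hn1 Hmod). specialize (HN0 n HnN). cbv beta in HN0.
  assert (K / INR n <= eps / 2)%R.
  { apply Rmult_le_reg_r with (INR n); [lra|].
    unfold Rdiv at 1. rewrite Rmult_assoc, Rinv_l, Rmult_1_r by lra.
    apply Rle_trans with (Rabs K); [apply Rle_abs|].
    replace (Rabs K) with (eps / 2 * q)%R by (unfold q; field; lra).
    apply Rmult_le_compat_l; lra. }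
  lra.
Qed.

(** * The normalised confluent functions *)

(** For [m = 0] the generating function is the [j]-th derivative of
    [1F1 (a; c; z)] and for [j = 0] it is the inner sum of the Humbert series; the
    other factors remove its expected growth. *)
Definition normalized_confluent (a c : C) (m j : nat) (z : C) : C :=
  Cpower z (c - a) * Cexp (- z) * (egf (poch_ratio a c m j) z / z ^ m).

Lemma normalized_confluent_beta p a b j z : beta_admissible p a b -> (0 < Re a)%R ->
  normalized_confluent a (a + b) 0 j z * beta_int p a b (fun _ => 1) =
  Cpower z b * beta_int p a b (fun t => RtoC t ^ j * Cexp (- (z * RtoC (1 - t)))).
Proof.
  intros H Ha. unfold normalized_confluent. replace (a + b - a) with b by ring.
  rewrite (beta_int_ext p a b (fun t => RtoC t ^ j * Cexp (- (z * RtoC (1 - t))))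
    (fun t => Cexp (- z) * (RtoC t ^ j * Cexp (z * RtoC t)))).
  - rewrite beta_int_scal, beta_int_exp by (try easy; ccont).
    change (z ^ 0) with (RtoC 1). field.
  - intros t _. replace (- (z * RtoC (1 - t))) with (- z + z * RtoC t) by (rewrite RtoC_minus; ring).
    rewrite Cexp_plus. ring.
Qed.

Lemma sector_power_bound b k e z : (0 < e)%R -> (0 <= Re b)%R -> (0 < Cmod z)%R ->
  (e * Cmod z <= Re z)%R ->
  (Cmod (Cpower z b) * Rpower (Re z) (- (Re b + INR k)) <=
    exp (Rabs (Im b) * PI) * Rpower e (- (Re b + INR k)) * / Cmod z ^ k)%R.
Proof.
  intros He Hb Hz Hs. pose proof (pos_INR k) as Hk.
  assert (Hez : (0 < e * Cmod z)%R) by now apply Rmult_lt_0_compat.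
  assert (Hre : (0 < Re z)%R) by lra.
  rewrite <- (Rpower_cancel (Cmod z) (Re b) k) by easy.
  apply Rle_trans with (exp (Rabs (Im b) * PI) * Rpower (Cmod z) (Re b) *
     (Rpower e (- (Re b + INR k)) * Rpower (Cmod z) (- (Re b + INR k))))%R.
  - apply Rmult_le_compat; [apply Cmod_ge_0|left; apply exp_pos|now apply Cmod_Cpower_le|].
    rewrite Rpower_mult_distr by easy. apply Rpower_inv_le; lra.
  - apply Req_le. ring.
Qed.

Lemma one_minus_pow_linear t j : (0 <= t <= 1)%R -> (0 <= 1 - t ^ j <= INR j * (1 - t))%R.
Proof.
  intros Ht. induction j as [|j IH]; [simpl; lra|].
  rewrite S_INR. simpl (t ^ S j)%R. pose proof (pow_unit_interval j t Ht). nra.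
Qed.

(** Both bounds come from absolute values in the integral; in the second,
    [1 - t ^ j <= j (1 - t)] gains a factor [1 / |z|]. *)
Lemma normalized_confluent_beta_bound p a b e : beta_admissible p a b -> (0 < Re a)%R -> (0 < e)%R ->
  exists K, forall j z, (0 < Cmod z)%R -> (e * Cmod z <= Re z)%R ->
    (Cmod (normalized_confluent a (a + b) 0 j z) <= K)%R /\
    (Cmod (normalized_confluent a (a + b) 0 j z - normalized_confluent a (a + b) 0 0 z) <= K * INR j / Cmod z)%R.
Proof.
  intros H Ha He. pose proof H as [_ [_ Hb]].
  destruct (beta_int_bound p a b 0 H) as [K0 [HK0 HB0]].
  destruct (beta_int_bound p a b 1 H) as [K1 [HK1 HB1]].
  pose proof (beta_int_total_neq_0 p a b H Ha) as HB.
  set (B := beta_int p a b (fun _ => 1)) in *.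
  pose proof (proj1 (Cmod_gt_0 _) HB) as HBp.
  set (C0 := (exp (Rabs (Im b) * PI))%R). assert (HC0 : (0 < C0)%R) by apply exp_pos.
  set (P0 := Rpower e (- (Re b + INR 0))). assert (HP0 : (0 < P0)%R) by apply exp_pos.
  set (P1 := Rpower e (- (Re b + INR 1))). assert (HP1 : (0 < P1)%R) by apply exp_pos.
  set (Ka := (C0 * P0 * K0 / Cmod B)%R). set (Kb := (C0 * P1 * K1 / Cmod B)%R).
  exists (Rmax Ka Kb). intros j z Hz Hs.
  assert (Hre : (0 < Re z)%R).
  { assert (0 < e * Cmod z)%R by now apply Rmult_lt_0_compat. lra. }
  assert (Hrepr : forall i, normalized_confluent a (a + b) 0 i z =
     Cpower z b * beta_int p a b (fun t => RtoC t ^ i * Cexp (- (z * RtoC (1 - t)))) / B).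
  { intros i. rewrite <- (normalized_confluent_beta p a b i z H Ha). fold B. field. exact HB. }
  split.
  - apply Rle_trans with Ka; [|apply Rmax_l].
    rewrite Hrepr, Cmod_div, Cmod_mult by easy.
    unfold Ka, Rdiv. apply Rmult_le_compat_r; [left; now apply Rinv_0_lt_compat|].
    pose proof (sector_power_bound b 0 e z He ltac:(lra) Hz Hs) as Hp. fold C0 P0 in Hp.
    simpl (Cmod z ^ 0)%R in Hp. rewrite Rinv_1, Rmult_1_r in Hp.
    apply Rle_trans with (Cmod (Cpower z b) * (K0 * 1 * Rpower (Re z) (- (Re b + INR 0))))%R.
    + apply Rmult_le_compat_l; [apply Cmod_ge_0|].
      apply HB0; trivial; [lra|ccont|].
      intros t Ht. rewrite Cmod_mult, Cmod_Cexp_kernel, Cmod_pow, Cmod_R, Rabs_right by lra.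
      pose proof (pow_unit_interval j t Ht). pose proof (exp_pos (- (Re z * (1 - t)))). simpl. nra.
    + replace (Cmod (Cpower z b) * (K0 * 1 * Rpower (Re z) (- (Re b + INR 0))))%R with
        (Cmod (Cpower z b) * Rpower (Re z) (- (Re b + INR 0)) * K0)%R by ring.
      apply Rmult_le_compat_r; lra.
  - pose proof (pos_INR j) as Hj.
    apply Rle_trans with (Kb * INR j / Cmod z)%R.
    2:{ unfold Rdiv. rewrite !Rmult_assoc. apply Rmult_le_compat_r; [|apply Rmax_r].
        apply Rmult_le_pos; [easy|left; now apply Rinv_0_lt_compat]. }
    rewrite !Hrepr.
    replace (Cpower z b * beta_int p a b (fun t => RtoC t ^ j * Cexp (- (z * RtoC (1 - t)))) / B -
       Cpower z b * beta_int p a b (fun t => RtoC t ^ 0 * Cexp (- (z * RtoC (1 - t)))) / B) with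
      (Cpower z b * (beta_int p a b (fun t => RtoC t ^ j * Cexp (- (z * RtoC (1 - t)))) -
       beta_int p a b (fun t => RtoC t ^ 0 * Cexp (- (z * RtoC (1 - t))))) / B) by (field; exact HB).
    rewrite <- beta_int_minus by (try easy; ccont).
    rewrite Cmod_div, Cmod_mult by easy.
    pose proof (sector_power_bound b 1 e z He ltac:(lra) Hz Hs) as Hp. fold C0 P1 in Hp.
    replace (Kb * INR j / Cmod z)%R with (C0 * P1 * / Cmod z ^ 1 * (K1 * INR j) / Cmod B)%R
      by (unfold Kb; field; split; lra).
    unfold Rdiv. apply Rmult_le_compat_r; [left; now apply Rinv_0_lt_compat|].
    apply Rle_trans with (Cmod (Cpower z b) * (K1 * INR j * Rpower (Re z) (- (Re b + INR 1))))%R.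
    + apply Rmult_le_compat_l; [apply Cmod_ge_0|].
      apply HB1; trivial; [ccont|].
      intros t Ht.
      replace (RtoC t ^ j * Cexp (- (z * RtoC (1 - t))) - RtoC t ^ 0 * Cexp (- (z * RtoC (1 - t))))
        with (- (RtoC (1 - t ^ j) * Cexp (- (z * RtoC (1 - t))))) by (rewrite RtoC_minus, RtoC_pow; simpl; ring).
      pose proof (one_minus_pow_linear t j Ht) as Hl.
      rewrite Cmod_opp, Cmod_mult, Cmod_Cexp_kernel, Cmod_R, Rabs_right by lra.
      pose proof (exp_pos (- (Re z * (1 - t)))). simpl. nra.
    + replace (Cmod (Cpower z b) * (K1 * INR j * Rpower (Re z) (- (Re b + INR 1))))%R with
        (Cmod (Cpower z b) * Rpower (Re z) (- (Re b + INR 1)) * (K1 * INR j))%R by ring.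
      apply Rmult_le_compat_r; [|lra]. apply Rmult_le_pos; lra.
Qed.

(** What the Humbert series needs to know about [1F1 (a; c; z)] and its
    derivatives. *)
Definition confluent_asymp (e : R) (a c : C) : Prop :=
  (exists K D R0, (0 <= K)%R /\ (1 <= D)%R /\ (1 <= R0)%R /\
    forall j z, (R0 <= Cmod z)%R -> (e * Cmod z <= Re z)%R ->
      (Cmod (normalized_confluent a c 0 j z) <= K * D ^ j)%R) /\
  (forall j, Clim (sector_infty e) (normalized_confluent a c 0 j) (CGamma c / CGamma a)).

Lemma confluent_asymp_beta p a b e : beta_admissible p a b -> (0 < Re a)%R -> (0 < e <= 1)%R ->
  confluent_asymp e a (a + b).
Proof.
  intros H Ha He.
  destruct (normalized_confluent_beta_bound p a b e H Ha) as [K HK]; [lra|].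
  pose proof (beta_int_total_neq_0 p a b H Ha) as HB.
  split.
  - exists (Rmax 0 K), 1%R, 1%R. split; [apply Rmax_l|]. split; [lra|]. split; [lra|].
    intros j z Hz Hs. rewrite pow1, Rmult_1_r.
    apply Rle_trans with K; [|apply Rmax_r]. apply HK; [lra|easy].
  - assert (H0 : Clim (sector_infty e) (normalized_confluent a (a + b) 0 0) (CGamma (a + b) / CGamma a)).
    { replace (CGamma (a + b) / CGamma a) with
       (CGamma (a + b) / CGamma a * beta_int p a b (fun _ => 1) * / beta_int p a b (fun _ => 1)).
      2:{ pose proof (CGamma_neq_0 a (Re_pos_nonpos_int a Ha)). field. auto. }
      apply Clim_ext_loc with (fun z => scaled_laplace p a b z * / beta_int p a b (fun _ => 1)).
      - apply sector_infty_filter.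
      - apply filter_forall. intros z.
        unfold scaled_laplace, beta_laplace.
        rewrite (beta_int_ext p a b (fun t => RtoC (1 - t) ^ 0 * _) (fun t => RtoC t ^ 0 * Cexp (- (z * RtoC (1 - t)))))
          by (intros t _; simpl; ring).
        rewrite <- (normalized_confluent_beta p a b 0 z H Ha). field. exact HB.
      - apply Clim_mult; [apply sector_infty_filter|now apply scaled_laplace_lim|].
        apply Clim_const, sector_infty_filter. }
    intros j.
    replace (CGamma (a + b) / CGamma a) with (0 + CGamma (a + b) / CGamma a) by ring.
    apply Clim_ext_loc with (fun z => (normalized_confluent a (a + b) 0 j z - normalized_confluent a (a + b) 0 0 z) + normalized_confluent a (a + b) 0 0 z).
    + apply sector_infty_filter.
    + apply filter_forall. intros z. ring.
    + apply Clim_plus; [apply sector_infty_filter| |exact H0].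
      intros eps Heps. pose proof (Rabs_pos (K * INR j)) as Hk.
      exists (1 + Rabs (K * INR j) / eps)%R. 
      assert (Hq : (0 <= Rabs (K * INR j) / eps)%R) by (apply Rdiv_le_0_compat; lra).
      split; [lra|].
      intros z Hz Hs.
      rewrite Cminus_0_r.
      eapply Rle_trans; [apply HK; [lra|easy]|].
      apply Rmult_le_reg_r with (Cmod z); [lra|].
      unfold Rdiv. rewrite Rmult_assoc, Rinv_l, Rmult_1_r by lra.
      apply Rle_trans with (Rabs (K * INR j)); [apply Rle_abs|].
      replace (Rabs (K * INR j)) with (eps * (Rabs (K * INR j) / eps))%R by (field; lra).
      apply Rmult_le_compat_l; lra.
Qed.


Lemma poch_ratio_shift a c m j n : poch_ratio a c m j (S n) = poch_ratio a c m (S j) n.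
Proof.
  unfold poch_ratio.
  replace (m + S n + j)%nat with (m + n + S j)%nat by lia.
  now replace (S n + j)%nat with (n + S j)%nat by lia.
Qed.

Lemma egf_poch_index a c m j z : ~ nonpos_int c ->
  egf (fun n => RtoC (INR n) * poch_ratio a c m j n) z = z * egf (poch_ratio a c m (S j)) z.
Proof.
  intros Hc. rewrite egf_index by now apply geom_bounded_poch_ratio.
  f_equal. apply egf_ext.
  - intros n. apply poch_ratio_shift.
  - now apply geom_bounded_shift, geom_bounded_poch_ratio.
Qed.

Lemma egf_affine a c m j k l z : ~ nonpos_int c ->
  egf (fun n => k * poch_ratio a c m j n + l * (RtoC (INR n) * poch_ratio a c m j n)) z =
  k * egf (poch_ratio a c m j) z + l * (z * egf (poch_ratio a c m (S j)) z).
Proof.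
  intros Hc. pose proof (geom_bounded_poch_ratio a c m j Hc) as Hg.
  rewrite egf_lin; trivial; [|now apply geom_bounded_index].
  now rewrite egf_poch_index.
Qed.

(** From [1 / (c)_k = (c + k) / (c (c + 1)_k)] with [k = n + j]. *)
Lemma normalized_confluent_c_step a c j z : ~ nonpos_int c -> (0 < Re z)%R ->
  normalized_confluent a c 0 j z = (c + RtoC (INR j)) / c * (/ z * normalized_confluent a (c + 1) 0 j z)
     + / c * normalized_confluent a (c + 1) 0 (S j) z.
Proof.
  intros Hc Hz. pose proof (nonpos_int_S c Hc) as Hc1.
  pose proof (nonpos_int_neq_0 c Hc) as Hc0. pose proof (Re_pos_neq_0 z Hz) as Hz0.
  unfold normalized_confluent.
  replace (c + 1 - a) with ((c - a) + 1) by ring. rewrite Cpower_plus, Cpower_1 by easy.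
  rewrite (egf_ext _ (fun n => (c + RtoC (INR j)) / c * poch_ratio a (c + 1) 0 j n
     + / c * (RtoC (INR n) * poch_ratio a (c + 1) 0 j n))).
  - rewrite egf_affine by easy. simpl (z ^ 0). field. auto.
  - intros n. unfold poch_ratio.
    pose proof (poch_shift c (n + j)) as Hs.
    pose proof (poch_neq_0 c (n + j) Hc) as Hp. pose proof (poch_neq_0 _ (n + j) Hc1) as Hp1.
    assert (E : / poch c (n + j) = (c + RtoC (INR (n + j))) / (c * poch (c + 1) (n + j))).
    { rewrite <- Hs. pose proof (add_nat_neq_0 c (n + j) Hc). field. auto. }
    unfold Cdiv at 1. rewrite E, plus_INR, RtoC_plus. field. auto.
  - now apply geom_bounded_poch_ratio.
Qed.

(** From [(a)_(k+1) = (a + k) (a)_k] with [k = m + n + j]. *)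
Lemma normalized_confluent_m_step a c m j (z : C) : ~ nonpos_int c -> z <> 0 ->
  normalized_confluent a c (S m) j z = (a + RtoC (INR (m + j))) * (/ z * normalized_confluent a c m j z)
     + normalized_confluent a c m (S j) z.
Proof.
  intros Hc Hz. unfold normalized_confluent.
  rewrite (egf_ext _ (fun n => (a + RtoC (INR (m + j))) * poch_ratio a c m j n
     + 1 * (RtoC (INR n) * poch_ratio a c m j n))).
  - rewrite egf_affine by easy. rewrite Cpow_S. pose proof (Cpow_nz z m Hz). field. auto.
  - intros n. unfold poch_ratio.
    replace (S m + n + j)%nat with (S (m + n + j)) by lia. rewrite poch_S.
    pose proof (poch_neq_0 c (n + j) Hc).
    rewrite !plus_INR, !RtoC_plus. field. auto.
  - now apply geom_bounded_poch_ratio.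
Qed.

(** In [normalized_confluent_c_step] the first term carries [1 / z], so the limit
    is divided by [c], in accordance with [Gamma (c + 1) = c Gamma c]. *)
Lemma confluent_asymp_step e a c : (0 < e)%R -> (0 < Re a)%R -> ~ nonpos_int c ->
  confluent_asymp e a (c + 1) -> confluent_asymp e a c.
Proof.
  intros He Ha Hc [[K [D [R0 [HK [HD [HR HB]]]]]] HL].
  pose proof (nonpos_int_neq_0 c Hc) as Hc0.
  assert (Hre : forall z, (1 <= Cmod z)%R -> (e * Cmod z <= Re z)%R -> (0 < Re z)%R).
  { intros z Hz Hs. assert (0 < e * Cmod z)%R by (apply Rmult_lt_0_compat; lra). lra. }
  split.
  - pose proof (proj1 (Cmod_gt_0 c) Hc0) as Hcp.
    assert (Hcc : (0 <= / Cmod c)%R) by (left; now apply Rinv_0_lt_compat).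
    exists ((1 + / Cmod c + / Cmod c * D) * K)%R, (2 * D)%R, R0.
    split. { apply Rmult_le_pos; [nra|easy]. }
    split; [lra|]. split; [easy|].
    intros j z Hz Hs. rewrite normalized_confluent_c_step by (trivial; apply Hre; trivial; lra).
    assert (Hz1 : (1 <= Cmod z)%R) by lra.
    pose proof (HB j z Hz Hs) as B1. pose proof (HB (S j) z Hz Hs) as B2.
    eapply Rle_trans; [apply Cmod_triangle|].
    rewrite !Cmod_mult, !Cmod_inv, Cmod_div; trivial; [|apply Re_pos_neq_0, Hre; trivial].
    assert (Dj : (1 <= D ^ j)%R) by now apply pow_R1_Rle.
    assert (T1 : (Cmod (c + RtoC (INR j)) / Cmod c <= (1 + / Cmod c) * 2 ^ j)%R).
    { apply Rmult_le_reg_r with (Cmod c); [easy|].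
      unfold Rdiv. rewrite Rmult_assoc, Rinv_l, Rmult_1_r by lra.
      replace ((1 + / Cmod c) * 2 ^ j * Cmod c)%R with ((Cmod c + 1) * 2 ^ j)%R by (field; lra).
      eapply Rle_trans; [apply Cmod_triangle|]. rewrite Cmod_nat.
      pose proof (INR_le_pow2 j). pose proof (pow_R1_Rle 2 j ltac:(lra)). nra. }
    assert (T2 : (/ Cmod z * Cmod (normalized_confluent a (c + 1) 0 j z) <= K * D ^ j)%R).
    { apply Rle_trans with (1 * (K * D ^ j))%R; [|lra].
      apply Rmult_le_compat; [left; apply Rinv_0_lt_compat; lra|apply Cmod_ge_0| |easy].
      rewrite <- Rinv_1. apply Rinv_le_contravar; lra. }
    assert (P2 : (1 <= 2 ^ j)%R) by (apply pow_R1_Rle; lra).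
    apply Rle_trans with ((1 + / Cmod c) * 2 ^ j * (K * D ^ j) + / Cmod c * (K * D ^ S j))%R.
    + apply Rplus_le_compat.
      * apply Rmult_le_compat; trivial.
        -- apply Rdiv_le_0_compat; [apply Cmod_ge_0|easy].
        -- apply Rmult_le_pos; [left; apply Rinv_0_lt_compat; lra|apply Cmod_ge_0].
      * now apply Rmult_le_compat_l.
    + rewrite Rpow_mult_distr. simpl (D ^ S j)%R.
      set (q := (/ Cmod c * (K * (D * D ^ j)))%R).
      assert (Hq : (0 <= q)%R).
      { unfold q. repeat apply Rmult_le_pos; lra. }
      assert (q <= 2 ^ j * q)%R by nra.
      apply Rle_trans with ((1 + / Cmod c) * 2 ^ j * (K * D ^ j) + 2 ^ j * q)%R; [lra|].
      apply Req_le. unfold q. ring.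
  - intros j.
    assert (HG : CGamma c / CGamma a = (c + RtoC (INR j)) / c * (0 * (CGamma (c + 1) / CGamma a))
       + / c * (CGamma (c + 1) / CGamma a)).
    { rewrite CGamma_S by easy. pose proof (CGamma_neq_0 a (Re_pos_nonpos_int a Ha)). field. auto. }
    rewrite HG.
    apply Clim_ext_loc with (fun z => (c + RtoC (INR j)) / c * (/ z * normalized_confluent a (c + 1) 0 j z)
     + / c * normalized_confluent a (c + 1) 0 (S j) z).
    + apply sector_infty_filter.
    + exists 1%R. split; [lra|]. intros z Hz Hs. symmetry. apply normalized_confluent_c_step; auto.
    + apply Clim_plus; [apply sector_infty_filter| |];
      (apply Clim_mult; [apply sector_infty_filter|apply Clim_const, sector_infty_filter|]).
      * apply Clim_mult; [apply sector_infty_filter|apply Clim_inv_infty|apply HL].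
      * apply HL.
Qed.

(** Start from [c + N] with [N] so large that the Beta integral converges well,
    and descend to [c]. *)
Lemma confluent_asymp_all e a c : (0 < e <= 1)%R -> (0 < Re a)%R -> ~ nonpos_int c ->
  confluent_asymp e a c.
Proof.
  intros He Ha Hc.
  destruct (nfloor_ex (Rabs (Re a) + Rabs (Re c) + 4)) as [N [_ HN]].
  { pose proof (Rabs_pos (Re a)). pose proof (Rabs_pos (Re c)). lra. }
  assert (Hbase : confluent_asymp e a (c + RtoC (INR N))).
  { set (b := c + RtoC (INR N) - a).
    assert (Hb : (3 <= Re b)%R).
    { unfold b. rewrite re_minus, re_plus, re_RtoC.
      pose proof (Rle_abs (Re a)). pose proof (Rle_abs (- Re c)) as Hn. rewrite Rabs_Ropp in Hn. lra. }
    destruct (nfloor_ex (3 / Re a + 3)) as [p [_ Hp]].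
    { assert (0 < 3 / Re a)%R by (apply Rdiv_lt_0_compat; lra). lra. }
    assert (H3a : (0 < 3 / Re a)%R) by (apply Rdiv_lt_0_compat; lra).
    replace (c + RtoC (INR N)) with (a + b) by (unfold b; ring).
    apply confluent_asymp_beta with (S p); trivial.
    split; [|split]; trivial.
    - apply INR_le. rewrite (S_INR p). simpl (INR 3). lra.
    - rewrite S_INR. replace 3%R with (3 / Re a * Re a)%R by (field; lra).
      apply Rmult_le_compat_r; lra. }
  assert (Hdown : forall n, (n <= N)%nat -> confluent_asymp e a (c + RtoC (INR (N - n)))).
  { induction n as [|n IH]; intros Hn.
    - now rewrite Nat.sub_0_r.
    - apply confluent_asymp_step; trivial; [lra|now apply nonpos_int_add|].
      replace (c + RtoC (INR (N - S n)) + 1) with (c + RtoC (INR (N - n))); [apply IH; lia|].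
      replace (N - n)%nat with (S (N - S n)) by lia. rewrite S_INR, RtoC_plus. ring. }
  specialize (Hdown N (Nat.le_refl N)). rewrite Nat.sub_diag in Hdown. simpl in Hdown.
  now rewrite Cplus_0_r in Hdown.
Qed.

(** In [normalized_confluent_m_step] the term with [1 / z] vanishes in the limit. *)
Lemma normalized_confluent_lim e a c m j : (0 < e <= 1)%R -> (0 < Re a)%R -> ~ nonpos_int c ->
  Clim (sector_infty e) (normalized_confluent a c m j) (CGamma c / CGamma a).
Proof.
  intros He Ha Hc. revert j. induction m as [|m IH]; intros j.
  - now apply confluent_asymp_all.
  - replace (CGamma c / CGamma a) with
      ((a + RtoC (INR (m + j))) * (0 * (CGamma c / CGamma a)) + CGamma c / CGamma a) by ring.
    apply Clim_ext_loc with (fun z => (a + RtoC (INR (m + j))) * (/ z * normalized_confluent a c m j z)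
     + normalized_confluent a c m (S j) z).
    + apply sector_infty_filter.
    + exists 1%R. split; [lra|]. intros z Hz Hs. symmetry. apply normalized_confluent_m_step; [easy|].
      apply Cmod_gt_0; lra.
    + apply Clim_plus; [apply sector_infty_filter| |apply IH].
      apply Clim_mult; [apply sector_infty_filter|apply Clim_const, sector_infty_filter|].
      apply Clim_mult; [apply sector_infty_filter|apply Clim_inv_infty|apply IH].
Qed.

(** Each step in [m] multiplies the bound by at most [D] plus
    [(|a| + m + j) / R]; the coefficient [2] of [m] leaves room for [j] to increase
    by one in the second term of the recursion. *)
Lemma normalized_confluent_growth e a c : (0 < e <= 1)%R -> (0 < Re a)%R -> ~ nonpos_int c ->
  exists K D R0, (0 <= K)%R /\ (1 <= D)%R /\ (1 <= R0)%R /\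
   forall R m j z, (R0 <= R)%R -> (R <= Cmod z)%R -> (e * Cmod z <= Re z)%R ->
    (Cmod (normalized_confluent a c m j z) <= K * D ^ j * (D + (Cmod a + INR j + 2 * INR m) / R) ^ m)%R.
Proof.
  intros He Ha Hc.
  destruct (confluent_asymp_all e a c He Ha Hc) as [[K [D [R0 [HK [HD [HR HB]]]]]] _].
  exists K, D, R0. split; [easy|]. split; [easy|]. split; [easy|].
  intros R m j z HR1 Hz Hs. revert j.
  assert (HRp : (0 < R)%R) by lra. pose proof (Cmod_ge_0 a) as HA.
  assert (Hz0 : z <> 0) by (apply Cmod_gt_0; lra).
  induction m as [|m IH]; intros j.
  - simpl (_ ^ 0)%R. rewrite Rmult_1_r. apply HB; [lra|easy].
  - rewrite normalized_confluent_m_step by easy.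
    pose proof (pos_INR m) as Hm. pose proof (pos_INR j) as Hj.
    set (X := (D + (Cmod a + INR j + 2 * INR (S m)) / R)%R).
    assert (HX1 : (0 <= (Cmod a + INR j + 2 * INR (S m)) / R)%R).
    { rewrite S_INR. apply Rdiv_le_0_compat; lra. }
    assert (HDj : (0 < D ^ j)%R) by (apply pow_lt; lra).
    assert (Hcmp : forall q, (0 <= q <= Cmod a + INR j + 2 * INR (S m))%R -> ((D + q / R) ^ m <= X ^ m)%R).
    { intros q Hq. apply pow_incr. unfold X.
      assert (0 <= q / R)%R by (apply Rdiv_le_0_compat; lra).
      assert (q / R <= (Cmod a + INR j + 2 * INR (S m)) / R)%R.
      { apply Rmult_le_compat_r; [left; now apply Rinv_0_lt_compat|lra]. }
      lra. }
    assert (HXm : (0 <= X ^ m)%R) by (apply pow_le; unfold X; lra).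
    eapply Rle_trans; [apply Cmod_triangle|].
    rewrite !Cmod_mult, Cmod_inv by easy.
    assert (T1 : (Cmod (normalized_confluent a c m j z) <= K * D ^ j * X ^ m)%R).
    { eapply Rle_trans; [apply IH|]. apply Rmult_le_compat_l; [nra|]. apply Hcmp. rewrite S_INR. lra. }
    assert (T2 : (Cmod (normalized_confluent a c m (S j) z) <= K * D ^ S j * X ^ m)%R).
    { eapply Rle_trans; [apply IH|]. apply Rmult_le_compat_l.
      - apply Rmult_le_pos; [easy|apply pow_le; lra].
      - apply Hcmp. rewrite !S_INR. lra. }
    assert (T3 : (Cmod (a + RtoC (INR (m + j))) <= Cmod a + INR j + 2 * INR (S m))%R).
    { eapply Rle_trans; [apply Cmod_triangle|]. rewrite Cmod_nat, plus_INR, S_INR. lra. }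
    assert (T4 : (/ Cmod z <= / R)%R) by (apply Rinv_le_contravar; lra).
    assert (T5 : (0 <= / Cmod z)%R) by (left; apply Rinv_0_lt_compat; lra).
    set (Y := (K * D ^ j * X ^ m)%R) in *.
    assert (HY : (0 <= Y)%R) by (eapply Rle_trans; [apply Cmod_ge_0|exact T1]).
    replace (K * D ^ S j * X ^ m)%R with (D * Y)%R in T2 by (unfold Y; simpl; ring).
    replace (K * D ^ j * X ^ S m)%R with (X * Y)%R by (unfold Y; simpl; ring).
    apply Rle_trans with ((Cmod a + INR j + 2 * INR (S m)) * (/ R * Y) + D * Y)%R.
    + apply Rplus_le_compat; [|easy].
      apply Rmult_le_compat; trivial; [apply Cmod_ge_0| |].
      * apply Rmult_le_pos; [easy|apply Cmod_ge_0].
      * apply Rmult_le_compat; trivial. apply Cmod_ge_0.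
    + apply Req_le. unfold X, Rdiv. ring.
Qed.


(** * The Humbert series *)

(** For [N > 0] write the left side as [(q / N) ^ m] times [(N X) ^ m / m!], and
    bound the latter by [exp (N X)].  For [R0 = 2 N] this exponential grows like
    [exp m], which [N] large compared to [q] compensates. *)
Lemma linear_pow_over_fact (q D A : R) : (0 <= q)%R -> (0 <= D)%R -> (0 <= A)%R ->
  exists M R0, (0 <= M)%R /\ (1 <= R0)%R /\ forall m : nat,
   (q ^ m / INR (fact m) * (D + (A + 2 * INR m) / R0) ^ m <= M * (/ 4) ^ m)%R.
Proof.
  intros Hq HD HA.
  set (N := (4 * exp 1 * q + 1)%R).
  assert (HN : (1 <= N)%R).
  { unfold N. assert (0 <= 4 * exp 1 * q)%R.
    { apply Rmult_le_pos; [|easy]. pose proof (exp_pos 1). lra. }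
    lra. }
  exists (exp (N * D + A)), (2 * N)%R. split; [left; apply exp_pos|]. split; [lra|].
  intros m. pose proof (pos_INR m) as Hm.
  set (X := (D + (A + 2 * INR m) / (2 * N))%R).
  assert (HX : (0 <= X)%R).
  { unfold X. assert (0 <= (A + 2 * INR m) / (2 * N))%R by (apply Rdiv_le_0_compat; lra). lra. }
  replace (q ^ m / INR (fact m) * X ^ m)%R with ((q / N) ^ m * ((N * X) ^ m / INR (fact m)))%R.
  2:{ unfold Rdiv. rewrite !Rpow_mult_distr, pow_inv. field. split; [apply INR_fact_neq_0|apply pow_nonzero; lra]. }
  assert (Hqn : (0 <= q / N)%R) by (apply Rdiv_le_0_compat; lra).
  apply Rle_trans with ((q / N) ^ m * exp (N * X))%R.
  { apply Rmult_le_compat_l; [now apply pow_le|]. apply pow_fact_le_exp. nra. }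
  apply Rle_trans with ((q / N) ^ m * (exp (N * D + A) * exp 1 ^ m))%R.
  - apply Rmult_le_compat_l; [now apply pow_le|].
    replace (exp 1 ^ m)%R with (exp (INR m)).
    2:{ rewrite <- Rpower_pow by apply exp_pos. unfold Rpower. now rewrite ln_exp, Rmult_1_r. }
    rewrite <- exp_plus. apply exp_le.
    replace (N * X)%R with (N * D + A / 2 + INR m)%R by (unfold X; field; lra). lra.
  - replace ((q / N) ^ m * (exp (N * D + A) * exp 1 ^ m))%R with
      (exp (N * D + A) * (q / N * exp 1) ^ m)%R by (rewrite Rpow_mult_distr; ring).
    apply Rmult_le_compat_l; [left; apply exp_pos|].
    apply pow_incr. pose proof (exp_pos 1). split; [nra|].
    apply Rmult_le_reg_r with N; [lra|].
    replace (q / N * exp 1 * N)%R with (q * exp 1)%R by (field; lra). unfold N. lra.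
Qed.

Definition hyp1F1_term (b c w : C) (m : nat) : C := poch b m / poch c m * (w ^ m / factC m).

Lemma hyp1F1_term_bound b c w : ~ nonpos_int c -> exists K q, (0 <= K)%R /\ (0 <= q)%R /\
  forall m, (Cmod (hyp1F1_term b c w m) <= K * (q ^ m / INR (fact m)))%R.
Proof.
  intros Hc. destruct (geom_bounded_poch_ratio b c 0 0 Hc) as [K [D H]].
  exists (Rabs K), (Rabs D * Cmod w)%R. split; [apply Rabs_pos|].
  split; [apply Rmult_le_pos; [apply Rabs_pos|apply Cmod_ge_0]|].
  intros m. apply (egf_term_le (fun n => poch b n / poch c n)).
  specialize (H m). unfold poch_ratio in H. simpl (0 + m)%nat in H. rewrite Nat.add_0_r in H.
  eapply Rle_trans; [exact H|]. rewrite RPow_abs, <- Rabs_mult. apply Rle_abs.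
Qed.

(** By [x ^ m = y ^ m / (y / x) ^ m] the powers of [x] go into the weights. *)
Lemma Psi1_eq_1F1_series a b c c' (x y s : C) : ~ nonpos_int c -> ~ nonpos_int c' -> x <> 0 -> y <> 0 ->
  Psi1 a b c c' (s * x) (y / x) =
  CSeries (fun m => hyp1F1_term b c (s * y) m * (egf (poch_ratio a c' m 0) (y / x) / (y / x) ^ m)).
Proof.
  intros Hc Hc' Hx Hy. unfold Psi1, CSeries2.
  assert (E : forall m, CSeries (fun n => poch a (m + n) * poch b m / (poch c m * poch c' n)
      * ((s * x) ^ m / factC m) * ((y / x) ^ n / factC n)) =
     hyp1F1_term b c (s * y) m * (egf (poch_ratio a c' m 0) (y / x) / (y / x) ^ m)).
  { intros m.
    replace (hyp1F1_term b c (s * y) m * (egf (poch_ratio a c' m 0) (y / x) / (y / x) ^ m)) with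
      ((poch b m * / poch c m * ((s * x) ^ m / factC m)) * egf (poch_ratio a c' m 0) (y / x)).
    2:{ unfold hyp1F1_term.
        assert (Hd : (y / x) ^ m = y ^ m / x ^ m)
          by (unfold Cdiv; rewrite Cpow_mult_l, Cpow_inv by easy; reflexivity).
        rewrite Hd, !Cpow_mult_l.
        pose proof (Cpow_nz x m Hx). pose proof (Cpow_nz y m Hy). pose proof (factC_neq_0 m).
        pose proof (poch_neq_0 c m Hc). field. auto. }
    apply CSeries_unique.
    apply is_Cseries_ext with (2 := is_Cseries_scal _ _ _ (is_Cseries_egf _ _ (geom_bounded_poch_ratio a c' m 0 Hc'))).
    intros n. unfold poch_ratio. rewrite !Nat.add_0_r.
    pose proof (poch_neq_0 c m Hc). pose proof (poch_neq_0 c' n Hc').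
    pose proof (factC_neq_0 m). pose proof (factC_neq_0 n).
    field. auto. }
  apply CSeries_ext. exact E.
Qed.

(** The weights are [normalized_confluent a c' m 0 z]; subtracting their common
    limit from each of them leaves a series to which [tannery] applies. *)
Lemma Psi1_asymp e a b c c' (w : C) : (0 < e <= 1)%R -> (0 < Re a)%R ->
  ~ nonpos_int c -> ~ nonpos_int c' ->
  Clim (sector_infty e)
    (fun z => CSeries (fun m => hyp1F1_term b c w m * (egf (poch_ratio a c' m 0) z / z ^ m))
                * (Cpower z (c' - a) * Cexp (- z)))
    (CGamma c' / CGamma a * hyp1F1 b c w).
Proof.
  intros He Ha Hc Hc'.
  set (kappa := CGamma c' / CGamma a).
  destruct (hyp1F1_term_bound b c w Hc) as [Kb [q [HKb [Hq Hterm]]]].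
  destruct (normalized_confluent_growth e a c' He Ha Hc') as [K [D [R1 [HK [HD [HR1 Hgrow]]]]]].
  destruct (linear_pow_over_fact q D (Cmod a)) as [M [R2 [HM [HR2 Hfact]]]];
    [easy|lra|apply Cmod_ge_0|].
  set (rho := Rmax R1 R2).
  assert (HR : (R1 <= rho /\ R2 <= rho)%R) by (split; [apply Rmax_l|apply Rmax_r]).
  set (d := fun m z => hyp1F1_term b c w m * (normalized_confluent a c' m 0 z - kappa)).
  set (B := (Kb * M * (K + Cmod kappa))%R).
  assert (Hbase : forall m, (Cmod (hyp1F1_term b c w m) * (D + (Cmod a + 2 * INR m) / R2) ^ m <= Kb * M * (/ 4) ^ m)%R).
  { intros m. specialize (Hterm m). specialize (Hfact m).
    assert (0 <= (D + (Cmod a + 2 * INR m) / R2) ^ m)%R.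
    { apply pow_le. pose proof (Cmod_ge_0 a). pose proof (pos_INR m).
      assert (0 <= (Cmod a + 2 * INR m) / R2)%R by (apply Rdiv_le_0_compat; lra). lra. }
    eapply Rle_trans; [apply Rmult_le_compat_r; [easy|exact Hterm]|].
    rewrite Rmult_assoc, (Rmult_assoc Kb M). now apply Rmult_le_compat_l. }
  assert (Hone : forall m, (1 <= (D + (Cmod a + 2 * INR m) / R2) ^ m)%R).
  { intros m. apply pow_R1_Rle. pose proof (Cmod_ge_0 a). pose proof (pos_INR m).
    assert (0 <= (Cmod a + 2 * INR m) / R2)%R by (apply Rdiv_le_0_compat; lra). lra. }
  assert (Hdom : sector_infty e (fun z => forall m, (Cmod (d m z) <= B * (/ 4) ^ m)%R)).
  { exists rho. split; [lra|]. intros z Hz Hs m. unfold d. rewrite Cmod_mult.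
    set (X := ((D + (Cmod a + 2 * INR m) / R2) ^ m)%R) in *.
    assert (Hv : (Cmod (normalized_confluent a c' m 0 z - kappa) <= (K + Cmod kappa) * X)%R).
    { eapply Rle_trans; [apply Cmod_minus|].
      pose proof (Hgrow rho m 0%nat z (proj1 HR) Hz Hs) as Hg.
      simpl (D ^ 0)%R in Hg. simpl (INR 0) in Hg. rewrite Rplus_0_r, Rmult_1_r in Hg.
      assert (Hmono : ((D + (Cmod a + 2 * INR m) / rho) ^ m <= X)%R).
      { apply pow_incr. pose proof (Cmod_ge_0 a). pose proof (pos_INR m).
        assert (0 <= (Cmod a + 2 * INR m) / rho)%R by (apply Rdiv_le_0_compat; lra).
        assert ((Cmod a + 2 * INR m) / rho <= (Cmod a + 2 * INR m) / R2)%R.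
        { apply Rmult_le_compat_l; [lra|]. apply Rinv_le_contravar; lra. }
        lra. }
      specialize (Hone m). fold X in Hone. pose proof (Cmod_ge_0 kappa).
      assert (K * (D + (Cmod a + 2 * INR m) / rho) ^ m <= K * X)%R by now apply Rmult_le_compat_l.
      nra. }
    eapply Rle_trans; [apply Rmult_le_compat_l; [apply Cmod_ge_0|exact Hv]|].
    specialize (Hbase m). fold X in Hbase. pose proof (Cmod_ge_0 kappa) as Hk.
    replace (Cmod (hyp1F1_term b c w m) * ((K + Cmod kappa) * X))%R with
      ((K + Cmod kappa) * (Cmod (hyp1F1_term b c w m) * X))%R by ring.
    replace (B * (/ 4) ^ m)%R with ((K + Cmod kappa) * (Kb * M * (/ 4) ^ m))%R by (unfold B; ring).
    apply Rmult_le_compat_l; [lra|exact Hbase]. }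
  assert (Hlim : Clim (sector_infty e) (fun z => CSeries (fun m => d m z)) 0).
  { apply (tannery (sector_infty e) d B Hdom).
    intros m. unfold d. replace (RtoC 0) with (hyp1F1_term b c w m * (kappa + - kappa)) by ring.
    apply Clim_mult; [apply sector_infty_filter|apply Clim_const, sector_infty_filter|].
    apply Clim_plus; [apply sector_infty_filter|now apply normalized_confluent_lim|apply Clim_const, sector_infty_filter]. }
  replace (kappa * hyp1F1 b c w) with (0 + kappa * hyp1F1 b c w) by ring.
  apply Clim_ext_loc with (fun z => CSeries (fun m => d m z) + kappa * hyp1F1 b c w);
    [apply sector_infty_filter| |apply Clim_plus; [apply sector_infty_filter|exact Hlim|apply Clim_const, sector_infty_filter]].
  revert Hdom. apply filter_imp. intros z Hz.
  assert (Hd : is_Cseries (fun m => d m z) (CSeries (fun m => d m z))).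
  { apply is_Cseries_dom with (1 := Hz). apply (ex_series_scal (V := R_NormedModule) B).
    apply ex_series_geom. rewrite Rabs_right; lra. }
  assert (Hh : is_Cseries (hyp1F1_term b c w) (hyp1F1 b c w)).
  { apply is_Cseries_dom with (1 := Hterm). apply (ex_series_scal (V := R_NormedModule) Kb).
    eexists; apply is_series_exp. }
  pose proof (is_Cseries_plus _ _ _ _ Hd (is_Cseries_scal kappa _ _ Hh)) as Hs.
  pose proof (Cpower_neq_0 z (c' - a)) as Hp. pose proof (Cexp_neq_0 (- z)) as He0.
  set (phi := Cpower z (c' - a) * Cexp (- z)).
  assert (Hphi : phi <> 0) by now apply Cmult_neq_0.
  rewrite (CSeries_unique (fun m => hyp1F1_term b c w m * (egf (poch_ratio a c' m 0) z / z ^ m))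
    (/ phi * (CSeries (fun m => d m z) + kappa * hyp1F1 b c w))).
  - field. exact Hphi.
  - apply is_Cseries_ext with (2 := is_Cseries_scal (/ phi) _ _ Hs).
    intros m. unfold d, normalized_confluent. fold phi.
    generalize (egf (poch_ratio a c' m 0) z / z ^ m). intros X. field. exact Hphi.
Qed.

Lemma Re_ge_of_Carg_le (x : C) (theta : R) : x <> 0 -> (0 <= theta <= PI)%R -> (Rabs (Carg x) <= theta)%R ->
  (cos theta * Cmod x <= Re x)%R.
Proof.
  intros Hx Ht Harg. pose proof (proj1 (Cmod_gt_0 x) Hx) as Hm.
  pose proof (re_le_Cmod x) as Hre.
  assert (Hq : (-1 <= Re x / Cmod x <= 1)%R).
  { assert (Hr : (- Cmod x <= Re x <= Cmod x)%R) by now apply Rabs_le_between.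
    split; apply Rmult_le_reg_r with (Cmod x); trivial;
    unfold Rdiv; rewrite Rmult_assoc, Rinv_l by lra; lra. }
  pose proof (acos_bound (Re x / Cmod x)) as Hb.
  assert (Ha : Rabs (Carg x) = acos (Re x / Cmod x)).
  { unfold Carg. destruct (Rle_dec 0 (Im x)); [|rewrite Rabs_Ropp]; apply Rabs_right; lra. }
  rewrite Ha in Harg.
  assert (Hc : (cos theta <= Re x / Cmod x)%R).
  { rewrite <- (cos_acos (Re x / Cmod x)) by easy. apply cos_decr_1; lra. }
  apply Rmult_le_compat_r with (r := Cmod x) in Hc; [|lra].
  unfold Rdiv in Hc. rewrite Rmult_assoc, Rinv_l in Hc by lra. lra.
Qed.

(** Inversion [x |-> y / x] maps the sector at [0] to the same sector at infinity. *)
Lemma Clim_sector0 f l theta e y : (0 < y)%R -> (0 <= theta <= PI)%R -> e = cos theta ->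
  Clim (sector_infty e) f l -> Clim (sector0 theta) (fun x => f (RtoC y / x)) l.
Proof.
  intros Hy Ht He Hf eps Heps.
  destruct (Hf eps Heps) as [R0 [HR HP]].
  assert (Hd : (0 < y / R0 / 2)%R).
  { repeat apply Rdiv_lt_0_compat; lra. }
  (* Balls are squares: the modulus is bounded by twice the radius. *)
  exists (mkposreal _ Hd). intros x. change C in x. intros Hball Hx0 Harg.
  assert (Hx : x <> 0) by exact Hx0.
  pose proof (proj1 (Cmod_gt_0 x) Hx) as Hm.
  assert (Hmx : (Cmod x <= y / R0)%R).
  { destruct Hball as [H1 H2]. simpl in H1, H2.
    unfold ball in H1, H2; simpl in H1, H2. unfold AbsRing_ball, abs, minus, plus, opp in H1, H2; simpl in H1, H2.
    eapply Rle_trans; [apply Cmod_le_parts|].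
    unfold Re, Im. rewrite Ropp_0, !Rplus_0_r in *. lra. }
  assert (Hmz : Cmod (RtoC y / x) = (y / Cmod x)%R).
  { rewrite Cmod_div, Cmod_R, Rabs_right by (easy || lra). easy. }
  apply HP.
  - rewrite Hmz. apply Rmult_le_reg_r with (Cmod x); [easy|].
    replace (y / Cmod x * Cmod x)%R with y by (field; lra).
    apply Rmult_le_compat_l with (r := R0) in Hmx; [|lra].
    replace (R0 * (y / R0))%R with y in Hmx by (field; lra). easy.
  - rewrite Hmz.
    pose proof (Re_ge_of_Carg_le x theta Hx Ht Harg) as Hs. rewrite <- He in Hs.
    assert (Hre : Re (RtoC y / x) = (y * Re x / (Cmod x * Cmod x))%R).
    { replace (Cmod x * Cmod x)%R with (Cmod x ^ 2)%R by ring. rewrite Cmod2_alt.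
      unfold Re, Im, Cdiv, Cinv, Cmult, RtoC; simpl. field.
      pose proof (Cmod2_alt x) as H2. unfold Re, Im in H2. simpl in H2. nra. }
    rewrite Hre.
    apply Rmult_le_reg_r with (Cmod x * Cmod x / y)%R.
    { apply Rdiv_lt_0_compat; [|easy]. now apply Rmult_lt_0_compat. }
    replace (e * (y / Cmod x) * (Cmod x * Cmod x / y))%R with (e * Cmod x)%R by (field; lra).
    replace (y * Re x / (Cmod x * Cmod x) * (Cmod x * Cmod x / y))%R with (Re x) by (field; lra).
    exact Hs.
Qed.

Theorem theorem3p2 :
  forall (a b c c' : C) (delta : R),
    (0 < Re a)%R ->
    ~ nonpos_int c ->
    ~ nonpos_int c' ->
    (0 < delta <= PI / 2)%R ->
    forall (y s : R),
      (0 < y)%R ->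
      (s = 1 \/ s = -1)%R ->
      asymp (sector0 (PI / 2 - delta))
        (fun x : C => Psi1 a b c c' (RtoC s * x) (RtoC y / x))
        (CGamma c' / CGamma a * hyp1F1 b c (RtoC s * RtoC y))
        (fun x : C => Cpower (RtoC y / x) (a - c') * Cexp (RtoC y / x)).
Proof.
  intros a b c c' delta Ha Hc Hc' Hdelta y s Hy _.
  (* With [e = cos theta] the sector in the statement is the one of [Clim_sector0]. *)
  set (theta := (PI / 2 - delta)%R). set (w := RtoC s * RtoC y).
  set (L := CGamma c' / CGamma a * hyp1F1 b c w).
  set (psi := fun x => Psi1 a b c c' (RtoC s * x) (RtoC y / x)).
  set (phi := fun x => Cpower (RtoC y / x) (a - c') * Cexp (RtoC y / x)).
  assert (Hphi : forall x, phi x <> 0).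
  { intros x. apply Cmult_neq_0; [apply Cpower_neq_0|apply Cexp_neq_0]. }
  assert (Hth : (0 <= theta <= PI)%R) by (unfold theta; pose proof PI_RGT_0; lra).
  assert (He : (0 < cos theta <= 1)%R).
  { split; [apply cos_gt_0; unfold theta; lra|apply COS_bound]. }
  assert (Hlim : Clim (sector0 theta) (fun x => psi x / phi x) L).
  { pose proof (Clim_sector0 _ _ theta _ y Hy Hth eq_refl (Psi1_asymp (cos theta) a b c c' w He Ha Hc Hc')) as H.
    intros eps Heps. specialize (H eps Heps). unfold sector0, within in *.
    destruct H as [d Hd]. exists d. intros x. change C in x. intros Hx Hx0 Harg.
    specialize (Hd x Hx Hx0 Harg).
    assert (Hx1 : x <> 0) by exact Hx0.
    replace (psi x / phi x) with
     (CSeries (fun m => hyp1F1_term b c w m * (egf (poch_ratio a c' m 0) (RtoC y / x) / (RtoC y / x) ^ m))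
                * (Cpower (RtoC y / x) (c' - a) * Cexp (- (RtoC y / x)))); [exact Hd|].
    unfold psi. rewrite Psi1_eq_1F1_series; trivial; [|apply RtoC_neq_0; lra]. fold w.
    unfold phi. replace (c' - a) with (- (a - c')) by ring. rewrite Cpower_opp, Cexp_opp.
    field. split; [apply Cexp_neq_0|apply Cpower_neq_0]. }
  exists (fun x => psi x / phi x - L). split.
  - intros P [eps HP]. assert (Heps : (0 < eps / 2)%R) by (pose proof (cond_pos eps); lra).
    generalize (Hlim _ Heps). unfold filtermap, sector0, within. apply filter_imp.
    intros x Hx Hs. specialize (Hx Hs). apply HP.
    pose proof (cond_pos eps) as Hp.
    pose proof (re_le_Cmod (psi x / phi x - L)) as H1.
    pose proof (im_le_Cmod (psi x / phi x - L)) as H2.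
    assert (Hball : forall u : R, (Rabs u < eps)%R -> ball (M := R_UniformSpace) 0%R eps u).
    { intros u Hu. unfold ball; simpl. unfold AbsRing_ball, abs, minus, plus, opp; simpl.
      now rewrite Ropp_0, Rplus_0_r. }
    split; apply Hball.
    + eapply Rle_lt_trans; [exact H1|lra].
    + eapply Rle_lt_trans; [exact H2|lra].
  - unfold sector0, within. apply filter_forall. intros x _.
    change (psi x = (L + (psi x / phi x - L)) * phi x). field. apply Hphi.
Qed.
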